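(* Let $A, B \subset \mathbb{R}^n$ be subanalytic set-germs at $0 \in \mathbb{R}^n$ such that $0 \in \overline{A} \cap \overline{B}$, and let $h : (\mathbb{R}^n,0) \to (\mathbb{R}^n,0)$ be a bi-Lipschitz homeomorphism (germ). Suppose that $h(A)$ and $h(B)$ are also subanalytic. Then $$\dim (D(h(A)) \cap D(h(B))) = \dim (D(A) \cap D(B)).$$
   Context: A bi-Lipschitz homeomorphism germ $h:(\mathbb{R}^n,0)\to(\mathbb{R}^n,0)$ is a homeomorphism from a neighbourhood of $0$ onto a neighbourhood of $0$ with $h(0)=0$ such that there are constants $0<K_1\le K_2$ with $K_1|x-y|\le |h(x)-h(y)|\le K_2|x-y|$ for $x,y$ near $0$. For a set-germ $A$ at $0$ with $0\in\overline{A}$, the direction set is $D(A)=\{a\in S^{n-1} : \exists\, \{x_i\}\subset A\setminus\{0\},\ x_i\to 0,\ x_i/\|x_i\|\to a\}$, where $S^{n-1}$ is the unit sphere. For subanalytic germs $D(A)$ is a closed subanalytic subset of $S^{n-1}$, so its dimension is defined, with the convention $\dim\emptyset=-1$. *)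

(* Defs.v *)
From HB Require Import structures.
From mathcomp Require Import all_boot all_order all_algebra.
From mathcomp Require Import boolp classical_sets reals.
Set Implicit Arguments. Unset Strict Implicit. Unset Printing Implicit Defensive.
Import Order.TTheory GRing.Theory Num.Theory.
Local Open Scope ring_scope.
Local Open Scope classical_set_scope.

Section Defs.
Variable R : realType.

Definition pt (n : nat) := 'I_n -> R.
Definition pzero (n : nat) : pt n := fun _ => 0.
Definition psub (n : nat) (x y : pt n) : pt n := fun i => x i - y i.
Definition pscale (n : nat) (t : R) (x : pt n) : pt n := fun i => t * x i.

Definition enorm (n : nat) (x : pt n) : R := Num.sqrt (\sum_(i < n) x i ^+ 2).
Definition eball (n : nat) (a : pt n) (r : R) : set (pt n) :=
  [set x | enorm (psub x a) < r].
Definition eopen (n : nat) (U : set (pt n)) : Prop :=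
  forall a, U a -> exists r, 0 < r /\ eball a r `<=` U.
Definition ebounded (n : nat) (Y : set (pt n)) : Prop :=
  exists M : R, forall y, Y y -> enorm y <= M.

Definition rseq_cvg (u : nat -> R) (l : R) : Prop :=
  forall e : R, 0 < e -> exists N0, forall N, (N0 <= N)%N -> `|u N - l| < e.
Definition pseq_cvg (n : nat) (u : nat -> pt n) (l : pt n) : Prop :=
  forall e : R, 0 < e -> exists N0, forall N, (N0 <= N)%N -> enorm (psub (u N) l) < e.

Definition box_sum (n : nat) (c : ('I_n -> nat) -> R) (x : pt n) (N : nat) : R :=
  \sum_(al : {ffun 'I_n -> 'I_N.+1})
     c (fun i => nat_of_ord (al i)) * \prod_(i < n) x i ^+ al i.

Definition analytic_at (n : nat) (f : pt n -> R) (a : pt n) : Prop :=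
  exists (c : ('I_n -> nat) -> R) (r : R), 0 < r /\
    (exists M : R, forall N, box_sum (fun al => `|c al|) (fun _ => r) N <= M) /\
    (forall x, enorm (psub x a) < r -> rseq_cvg (box_sum c (psub x a)) (f x)).
Definition analytic_on (n : nat) (U : set (pt n)) (f : pt n -> R) : Prop :=
  forall a, U a -> analytic_at f a.

Definition semianalytic (n : nat) (X : set (pt n)) : Prop :=
  forall a : pt n, exists r : R, 0 < r /\
    exists (p q : nat) (f g : 'I_p -> 'I_q -> pt n -> R),
      (forall i j, analytic_on (eball a r) (f i j) /\ analytic_on (eball a r) (g i j)) /\
      X `&` eball a r =
        eball a r `&` [set x | exists i, forall j, f i j x = 0 /\ 0 < g i j x].

Definition proj (n m : nat) (y : pt (n + m)) : pt n := fun i => y (lshift m i).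

(** subanalytic set-germ at 0: near 0, it is the projection of a relatively
    compact (= bounded) semianalytic set *)
Definition subanalytic_germ0 (n : nat) (X : set (pt n)) : Prop :=
  exists r : R, 0 < r /\
    exists (m : nat) (Y : set (pt (n + m))),
      semianalytic Y /\ ebounded Y /\
      X `&` eball (@pzero n) r = (@proj n m @` Y) `&` eball (@pzero n) r.

Definition zero_in_closure (n : nat) (A : set (pt n)) : Prop :=
  forall r : R, 0 < r -> exists x, A x /\ enorm x < r.

Definition bilipschitz_on (n : nat) (U : set (pt n)) (h : pt n -> pt n) : Prop :=
  exists K1 K2 : R, 0 < K1 /\ K1 <= K2 /\
    forall x y, U x -> U y ->
      K1 * enorm (psub x y) <= enorm (psub (h x) (h y)) /\
      enorm (psub (h x) (h y)) <= K2 * enorm (psub x y).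

Definition dirset (n : nat) (A : set (pt n)) : set (pt n) :=
  [set a | enorm a = 1 /\
     exists u : nat -> pt n,
       (forall k, A (u k) /\ u k <> @pzero n) /\
       pseq_cvg u (@pzero n) /\
       pseq_cvg (fun k => pscale (enorm (u k))^-1 (u k)) a].

Definition has_piece (n : nat) (X : set (pt n)) (k : nat) : Prop :=
  exists (W : set (pt k)) (phi : pt k -> pt n),
    eopen W /\ W !=set0 /\
    (forall i, analytic_on W (fun x => phi x i)) /\
    (forall x y, W x -> W y -> phi x = phi y -> x = y) /\
    (forall x, W x -> X (phi x)).

Definition sdim (n : nat) (X : set (pt n)) : int :=
  if `[< X = set0 >] then (-1)%R
  else ((\max_(k < n.+1 | `[< has_piece X k >]) (k : nat))%N : int).

End Defs.

(* Main.v *)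
Require Import Defs.
From HB Require Import structures.
From mathcomp Require Import all_boot all_order all_algebra.
From mathcomp Require Import boolp classical_sets filter reals.
From mathcomp Require Import ring lra zify.
From mathcomp Require ordered_qelim qe_rcf.
Set Implicit Arguments. Unset Strict Implicit. Unset Printing Implicit Defensive.
Import Order.TTheory GRing.Theory Num.Theory.
Local Open Scope ring_scope.

(* Blow [h] up at 0 along an ultrafilter: the ultralimit of [(k+1) h(x/(k+1))]
   is a global bi-Lipschitz map.  Subanalytic germs have the sequence selection
   property: if [v] is a direction of [A] then the distance from [t v] to [A]
   is [o(t)] as [t -> 0+], along all [t] and not only along a sequence.  Hence
   the blow-up carries the cone over [D(A) `&` D(B)] into the cone over
   [D(h A) `&` D(h B)].

   The selection property, and the fact that the limits at [t = 0] of a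
   semianalytic family are a countable union of analytic images of analytic
   sets, come from one induction on the number of variables: divide out powers
   of [t], make everything polynomial in the last variable by Weierstrass
   preparation, and eliminate that variable with Tarski's theorem.  Such
   countable unions decompose into countably many analytic graphs.

   If [D(A) `&` D(B)] contains a graph of dimension [k], its cone contains a
   bi-Lipschitz [k+1]-cube, which is covered by the preimages of the cones over
   the graphs composing [D(h A) `&` D(h B)].  A counting argument with nested
   cubes shows that one of these graphs has dimension at least [k].  The same
   argument for the inverse of [h] gives the equality. *)

(** The germ [h] need not be differentiable at 0, so the direction of [h (t v)] may keep turning as
    [t] tends to 0. An ultrafilter selects one limit for all points at once. It sees only the scales
    [1/(k+1)], while a sequence that defines a direction has scales of its own; hence the need for
    points of [A] near [t v] at every small [t]. On the image side subanalyticity serves another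
    purpose: it splits the target set of directions into pieces that have a dimension. The limit map
    is only bi-Lipschitz, so tangent spaces cannot compare dimensions, and boxes are counted
    instead. Since this map does not preserve the unit sphere, cones replace direction sets; both
    dimensions then go up by one. The counting argument is of Baire type and tolerates countably
    many pieces, which frees the development from the finiteness theorems of subanalytic geometry: a
    class stable under countable unions, finite intersections and analytic images is enough. *)

Ltac abs_lra := intros; repeat match goal with
  | H : is_true (`|_| < _) |- _ => move: H => /ltr_normlP[? ?]
  | H : is_true (`|_| <= _) |- _ => move: H => /ler_normlP[? ?]
  end; try (apply/ltr_normlP; split); try (apply/ler_normlP; split); lra.

(** * Unconditional sums and power series *)

Section HasSum.
Variable R : realType.

(** Convergence along the directed set of finite subsets, coded by duplicate-free lists. The index
    set carries no order, so reindexing and regrouping a series need no separate argument. *)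
Definition has_sum (T : eqType) (a : T -> R) (s : R) :=
  forall e, 0 < e -> exists S0 : seq T, forall S, uniq S ->
    {subset S0 <= S} -> `|\sum_(i <- S) a i - s| < e.

Definition abs_le (T : eqType) (a : T -> R) (M : R) :=
  forall S : seq T, uniq S -> \sum_(i <- S) `|a i| <= M.

Lemma eq_ler (x y : R) : x = y -> x <= y.
Proof. by move=> ->. Qed.

Lemma eps_eq (x y : R) : (forall e, 0 < e -> `|x - y| < e) -> x = y.
Proof.
move=> H; apply/eqP; rewrite -subr_eq0 -normr_eq0; apply/negP => /negP h.
have := H `|x - y|; rewrite ltxx normr_gt0 -normr_eq0 => /(_ h); by [].
Qed.

Lemma has_sum_unique (T : eqType) (a : T -> R) s s' :
  has_sum a s -> has_sum a s' -> s = s'.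
Proof.
move=> H H'; apply: eps_eq => e e0.
have e2 : 0 < e / 2 by lra.
have [S0 h] := H _ e2; have [S1 h'] := H' _ e2.
have u := undup_uniq (S0 ++ S1).
have h1 := h _ u; have h2 := h' _ u.
have k1 : {subset S0 <= undup (S0 ++ S1)}.
  by move=> x xS; rewrite mem_undup mem_cat xS.
have k2 : {subset S1 <= undup (S0 ++ S1)}.
  by move=> x xS; rewrite mem_undup mem_cat xS orbT.
move: (h1 k1) (h2 k2); set z := \sum_(i <- _) _; abs_lra.
Qed.

Lemma eq_has_sum (T : eqType) (a b : T -> R) s :
  a =1 b -> has_sum a s -> has_sum b s.
Proof. by move=> ab; have -> : a = b by apply/funext. Qed.

Lemma has_sum_add (T : eqType) (a b : T -> R) s t :
  has_sum a s -> has_sum b t -> has_sum (fun i => a i + b i) (s + t).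
Proof.
move=> H H' e e0; have e2 : 0 < e / 2 by lra.
have [S0 h] := H _ e2; have [S1 h'] := H' _ e2.
exists (S0 ++ S1) => S u sub; rewrite big_split /=.
have := h _ u; have := h' _ u.
have k1 : {subset S0 <= S} by move=> x xS; apply: sub; rewrite mem_cat xS.
have k2 : {subset S1 <= S} by move=> x xS; apply: sub; rewrite mem_cat xS orbT.
by move=> /(_ k2) + /(_ k1); abs_lra.
Qed.

Lemma has_sum_scale (T : eqType) (a : T -> R) s c :
  has_sum a s -> has_sum (fun i => c * a i) (c * s).
Proof.
move=> H e e0; have [c0|c0] := eqVneq c 0.
  exists [::] => S _ _; rewrite c0 mul0r big1 ?subrr ?normr0 // => i _.
  by rewrite mul0r.
have c1 : 0 < `|c| by rewrite normr_gt0.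
have [|S0 h] := H (e / `|c|); first by rewrite divr_gt0.
exists S0 => S u sub; rewrite -mulr_sumr -mulrBr normrM mulrC -ltr_pdivlMr //.
exact: h.
Qed.

Lemma has_sum0 (T : eqType) : has_sum (fun _ : T => 0) 0.
Proof. by move=> e e0; exists [::] => S _ _; rewrite big1 ?subrr ?normr0. Qed.

Lemma has_sum_fin (T : eqType) (a : T -> R) (S0 : seq T) : uniq S0 ->
  (forall i, i \notin S0 -> a i = 0) -> has_sum a (\sum_(i <- S0) a i).
Proof.
move=> u0 h e e0; exists S0 => S u sub.
suff -> : \sum_(i <- S) a i = \sum_(i <- S0) a i by rewrite subrr normr0.
rewrite (bigID (mem S0)) /= [X in _ + X]big1 ?addr0; last by move=> i /h.
rewrite -big_filter; apply: perm_big; apply: uniq_perm => //.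
  exact: filter_uniq.
move=> x; rewrite mem_filter /=; case xs: (x \in S0) => //=; exact: sub.
Qed.

Lemma has_sum_sum (T : eqType) (I : Type) (r : seq I) (a : I -> T -> R) s :
  (forall i, has_sum (a i) (s i)) ->
  has_sum (fun t => \sum_(i <- r) a i t) (\sum_(i <- r) s i).
Proof.
move=> H; elim: r => [|i r IH].
  by rewrite big_nil; apply: eq_has_sum (has_sum0 T) => t; rewrite big_nil.
rewrite big_cons; apply: eq_has_sum (has_sum_add (H i) IH) => t.
by rewrite big_cons.
Qed.

Lemma has_sum_nneg (T : eqType) (a : T -> R) M :
  (forall i, 0 <= a i) -> (forall S, uniq S -> \sum_(i <- S) a i <= M) ->
  exists s, has_sum a s.
Proof.
move=> a0 aM.
pose E : set R := [set x | exists2 S : seq T, uniq S & x = \sum_(i <- S) a i]%classic.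
have hE : has_sup E.
  split; first by exists 0, [::] => //; rewrite big_nil.
  by exists M => _ [S u ->]; exact: aM.
exists (sup E) => e e0.
have [_ [S0 u0 ->] lt] := sup_adherent e0 hE.
exists S0 => S u sub.
have h1 : \sum_(i <- S) a i <= sup E.
  by apply: (ub_le_sup (proj2 hE)); exists S.
have h2 : \sum_(i <- S0) a i <= \sum_(i <- S) a i.
  rewrite [leRHS](bigID (mem S0)) /= -[leLHS]addr0 lerD ?sumr_ge0 //.
  rewrite -[leRHS]big_filter; apply: eq_ler; apply: perm_big; apply: uniq_perm => //.
    exact: filter_uniq.
  move=> x; rewrite mem_filter /=; case xs: (x \in S0) => //=.
  by rewrite sub.
by rewrite ltr_norml; apply/andP; split; lra.
Qed.

(** Write [a] as the difference of the non-negative families [|a|] and [|a| - a], whose finite sums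
    are bounded by [M] and [2 M]. *)
Lemma abs_le_ex (T : eqType) (a : T -> R) M : abs_le a M -> exists s, has_sum a s.
Proof.
move=> aM.
have [s hs] : exists s, has_sum (fun i => `|a i|) s.
  by apply: (@has_sum_nneg _ _ M).
have [t ht] : exists s, has_sum (fun i => `|a i| - a i) s.
  apply: (@has_sum_nneg _ _ (M + M)) => [i|S u].
    by rewrite subr_ge0 ler_norm.
  rewrite big_split /= lerD ?aM //; apply: le_trans (aM _ u).
  by apply: ler_sum => i _; rewrite -normrN ler_norm.
exists (s + -1 * t); apply: eq_has_sum (has_sum_add hs (has_sum_scale (-1) ht)).
by move=> i; ring.
Qed.

Lemma has_sum_le (T : eqType) (a : T -> R) M s : abs_le a M -> has_sum a s -> `|s| <= M.
Proof.
move=> aM H; rewrite leNgt; apply/negP => h.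
have [|S0 k] := H (`|s| - M); first by lra.
have u0 := undup_uniq S0; have h1 := aM _ u0.
have := k _ u0 (fun x (h : x \in S0) => etrans (mem_undup S0 x) h).
have := ler_norm_sum (undup S0) a xpredT; set z := \sum_(i <- _) _ in h1 *.
set w := \sum_(i <- _) _ => h2 h3.
have : `|s| <= `|w - s| + `|w| by have := ler_normB w (w - s); rewrite opprB addrC subrK addrC.
lra.
Qed.

(** For a finite set [I1] of rows, take in each row a finite set of columns that contains those of
    [S0] and brings the row within [e / 2 / size I1] of its sum. The chosen pairs contain [S0], so
    their total is within [e / 2] of [s]. *)
Lemma has_sum_pair (I J : eqType) (a : I -> J -> R) s t :
  has_sum (fun p : I * J => a p.1 p.2) s -> (forall i, has_sum (a i) (t i)) ->
  has_sum t s.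
Proof.
move=> H Hi e e0; have e2 : 0 < e / 2 by lra.
have [S0 h] := H _ e2.
exists [seq p.1 | p <- S0] => I1 u1 sub1.
have [I1n|I1p] := posnP (size I1).
  have S00 : S0 = [::].
    case: S0 sub1 {h} => // p S0 /(_ p.1); rewrite (size0nil I1n) inE eqxx.
    by move/(_ isT).
  rewrite (size0nil I1n) big_nil.
  have := h [::] isT; rewrite S00 big_nil => /(_ (fun _ => id)); abs_lra.
have d0 : 0 < e / 2 / (size I1)%:R by rewrite divr_gt0 // ltr0n.
have hJ i : exists Ji : seq J, uniq Ji /\ {subset [seq p.2 | p <- S0] <= Ji} /\
    `|\sum_(j <- Ji) a i j - t i| < e / 2 / (size I1)%:R.
  have [J0 k] := Hi i _ d0.
  exists (undup ([seq p.2 | p <- S0] ++ J0)).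
  rewrite undup_uniq; split=> //; split.
    by move=> x xS; rewrite mem_undup mem_cat xS.
  by apply: k => [|x xS]; rewrite ?undup_uniq // mem_undup mem_cat xS orbT.
have [F hF] := choice hJ.
have := h [seq (i, j) | i <- I1, j <- F i].
rewrite allpairs_uniq_dep //; last first.
- by move=> [x y] [x' y'] _ _ /= [-> ->].
- by move=> i _; have [] := hF i.
have sub : {subset S0 <= [seq (i, j) | i <- I1, j <- F i]}.
  move=> [i j] pS; apply/allpairsPdep; exists i, j; split => //.
    by apply: sub1; apply/mapP; exists (i, j).
  by have [_ [k _]] := hF i; apply: k; apply/mapP; exists (i, j).
move=> /(_ isT sub); rewrite big_allpairs_dep /= => h1.
have h2 : `|\sum_(i <- I1) \sum_(j <- F i) a i j - \sum_(i <- I1) t i| <= e / 2.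
  rewrite -sumrB; apply: le_trans (ler_norm_sum _ _ _) _.
  have -> : e / 2 = \sum_(i <- I1) (e / 2 / (size I1)%:R).
    rewrite big_const_seq count_predT iter_addr_0 -[RHS]mulr_natr divfK //.
    by rewrite pnatr_eq0 -lt0n.
  by apply: ler_sum => i _; have [_ [_ /ltW]] := hF i.
move: h1 h2; set x := \sum_(i <- I1) _; set y := \sum_(i <- I1) _; abs_lra.
Qed.

Lemma mem_lt_max (S : seq nat) x : x \in S -> (x < \max_(i <- S) i.+1)%N.
Proof. by move=> xS; exact: (@leq_bigmax_seq _ S xpredT succn x xS isT). Qed.

Lemma has_sum_nat (a : nat -> R) s : has_sum a s ->
  forall e, 0 < e -> exists N0, forall N, (N0 <= N)%N -> `|\sum_(i < N) a i - s| < e.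
Proof.
move=> H e e0; have [S0 h] := H e e0.
exists (\max_(i <- S0) i.+1)%N => N le; rewrite -(big_mkord xpredT a).
apply: h; first exact: iota_uniq.
move=> x xS; rewrite mem_index_iota /=; apply: leq_trans le.
exact: mem_lt_max.
Qed.

(** Absolute summability provides some unconditional sum, and its ordered partial sums identify it
    with [s]. *)
Lemma nat_has_sum (a : nat -> R) M s : abs_le a M ->
  (forall e, 0 < e -> exists N0, forall N, (N0 <= N)%N -> `|\sum_(i < N) a i - s| < e) ->
  has_sum a s.
Proof.
move=> aM H; have [t ht] := abs_le_ex aM.
suff -> : s = t by [].
apply: eps_eq => e e0; have e2 : 0 < e / 2 by lra.
have [N1 h1] := H _ e2; have [N2 h2] := has_sum_nat ht e2.
move: (h1 _ (leq_maxl N1 N2)) (h2 _ (leq_maxr N1 N2)).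
set z := \sum_(i < _) _; abs_lra.
Qed.

Lemma abs_le_nat (a : nat -> R) M :
  (forall N, \sum_(i < N) `|a i| <= M) -> abs_le a M.
Proof.
move=> H S u; apply: le_trans (H (\max_(i <- S) i.+1)%N).
rewrite -(big_mkord xpredT (fun i => `|a i|)).
rewrite [leRHS](bigID (mem S)) /= -[leLHS]addr0 lerD ?sumr_ge0 //.
rewrite -[leRHS]big_filter; apply: eq_ler; apply: perm_big; apply: uniq_perm => //.
  by apply: filter_uniq; apply: iota_uniq.
move=> x; rewrite mem_filter /= mem_index_iota; case xs: (x \in S) => //=.
by rewrite mem_lt_max.
Qed.

(** Transfers a family to the index set [nat]; integers that code no element of [T] contribute 0. *)
Definition unpickled (T : countType) (a : T -> R) (n : nat) : R :=
  oapp a 0 (pickle_inv n).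

Lemma unpickled_sum (T : countType) (a : T -> R) (S : seq nat) :
  \sum_(n <- S) unpickled a n = \sum_(t <- pmap pickle_inv S) a t.
Proof.
elim: S => [|n S IH]; first by rewrite !big_nil.
rewrite big_cons IH /= /unpickled; case: pickle_inv => [t|] /=.
  by rewrite big_cons.
by rewrite add0r.
Qed.

Lemma pmap_unpickle_uniq (T : countType) (S : seq nat) :
  uniq S -> uniq (pmap (@pickle_inv T) S).
Proof. by move=> u; apply: (pmap_uniq (@pickle_invK T)). Qed.

Lemma abs_le_unpickled (T : countType) (a : T -> R) M :
  abs_le a M -> abs_le (unpickled a) M.
Proof.
move=> aM S u.
have -> : \sum_(i <- S) `|unpickled a i| = \sum_(i <- S) unpickled (fun t => `|a t|) i.
  apply: eq_bigr => i _; rewrite /unpickled; case: pickle_inv => //=.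
  by rewrite normr0.
by rewrite unpickled_sum; apply: aM; apply: pmap_unpickle_uniq.
Qed.

Lemma has_sum_unpickled (T : countType) (a : T -> R) s :
  has_sum a s -> has_sum (unpickled a) s.
Proof.
move=> H e e0; have [S0 h] := H e e0.
exists [seq pickle t | t <- S0] => S u sub; rewrite unpickled_sum.
apply: h; first exact: pmap_unpickle_uniq.
move=> t tS; rewrite mem_pmap; apply/mapP; exists (pickle t).
  by apply: sub; apply: map_f.
by rewrite pickleK_inv.
Qed.

End HasSum.

(** * Absolutely convergent power series on a box *)

Section Pseries.
Variable R : realType.
Implicit Types (n : nat) (r x : nat -> R) (M : R).

Lemma sum_sub_le (T : eqType) (a : T -> R) (S S' : seq T) :
  (forall i, 0 <= a i) -> uniq S -> uniq S' -> {subset S <= S'} ->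
  \sum_(i <- S) a i <= \sum_(i <- S') a i.
Proof.
move=> a0 u u' sub; rewrite [leRHS](bigID (mem S)) /= -[leLHS]addr0 lerD ?sumr_ge0 //.
rewrite -[leRHS]big_filter; apply: eq_ler; apply: perm_big; apply: uniq_perm => //.
  exact: filter_uniq.
by move=> y; rewrite mem_filter /=; case ys: (y \in S) => //=; rewrite sub.
Qed.

Lemma abs_le_ge0 (T : eqType) (a : T -> R) M : abs_le a M -> 0 <= M.
Proof. by move=> /(_ [::] isT); rewrite big_nil. Qed.

Lemma abs_le_dom (T : eqType) (a b : T -> R) M :
  (forall i, `|a i| <= `|b i|) -> abs_le b M -> abs_le a M.
Proof. by move=> ab bM S u; apply: le_trans (bM S u); apply: ler_sum. Qed.

Lemma abs_le_pair (I J : eqType) (a : I -> J -> R) m M :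
  (forall i, abs_le (a i) (m i)) -> abs_le m M ->
  abs_le (fun p : I * J => a p.1 p.2) M.
Proof.
move=> am mM S u.
pose I0 := undup [seq p.1 | p <- S]; pose J0 := undup [seq p.2 | p <- S].
have u' : uniq [seq (i, j) | i <- I0, j <- J0].
  by apply: allpairs_uniq; rewrite ?undup_uniq // => -[? ?] [? ?] _ _ /= [-> ->].
apply: (le_trans (sum_sub_le _ u u' _)) => //.
  move=> [i j] ijS; apply/allpairsP; exists (i, j); split => //=; rewrite mem_undup.
    by apply/mapP; exists (i, j).
  by apply/mapP; exists (i, j).
rewrite big_allpairs /=; apply: le_trans (mM I0 (undup_uniq _)).
apply: ler_sum => i _; apply: (le_trans (am i J0 (undup_uniq _))).
exact: ler_norm.
Qed.

(** The value 0 is a default for families without a sum. *)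
Definition tsum (T : eqType) (a : T -> R) : R := xget 0 [set s | has_sum a s]%classic.

Lemma tsumP (T : eqType) (a : T -> R) M : abs_le a M -> has_sum a (tsum a).
Proof.
by move=> /abs_le_ex[s hs]; rewrite /tsum; case: xgetP => [y _ //|/(_ s)].
Qed.

Definition mono n (al : nat -> nat) x : R := \prod_(i < n) x i ^+ al i.

Definition inbox n r x := forall i, (i < n)%N -> `|x i| <= r i.

(* Points are sequences of which only the first [n] entries matter: dimensions
   then vary without casts. *)
Definition pseries n r M (f : (nat -> R) -> R) :=
  exists (c : nat -> R) (al : nat -> nat -> nat),
    abs_le (fun j => c j * mono n (al j) r) M /\
    forall x, inbox n r x -> has_sum (fun j => c j * mono n (al j) x) (f x).

Lemma mono_ext n al x y : (forall i, (i < n)%N -> x i = y i) -> mono n al x = mono n al y.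
Proof. by move=> xy; apply: eq_bigr => i _; rewrite xy. Qed.

Lemma mono_le n al r x : inbox n r x -> `|mono n al x| <= `|mono n al r|.
Proof.
move=> b; rewrite /mono !normr_prod; apply: ler_prod => i _.
rewrite normr_ge0 /= !normrX lerXn2r // ?nnegrE //.
by apply: le_trans (b _ (ltn_ord i)) _; exact: ler_norm.
Qed.

Lemma inbox_sub n r r' x : inbox n r r' -> inbox n r' x -> inbox n r x.
Proof.
move=> h h' i ni; apply: le_trans (h' i ni) _; apply: le_trans (h i ni).
exact: ler_norm.
Qed.

Lemma inboxS n r x : inbox n.+1 r x -> inbox n r x.
Proof. by move=> h i ni; apply: h; rewrite ltnS ltnW. Qed.

Lemma term_le n r M c (al : nat -> nat -> nat) x : inbox n r x ->
  abs_le (fun j : nat => c j * mono n (al j) r) M ->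
  abs_le (fun j : nat => c j * mono n (al j) x) M.
Proof.
move=> b; apply: abs_le_dom => i; rewrite !normrM ler_wpM2l //.
exact: mono_le.
Qed.

Lemma pseries_ge0 n r M f : pseries n r M f -> 0 <= M.
Proof. by move=> [c [al [/abs_le_ge0]]]. Qed.

Lemma pseries_bound n r M f x : pseries n r M f -> inbox n r x -> `|f x| <= M.
Proof.
by move=> [c [al [cM h]]] b; apply: has_sum_le (h x b); apply: term_le cM.
Qed.

(** The exponents of an expansion may repeat, so any countable family of monomials will do. Products
    and double series therefore never collect like terms. *)
Lemma pseriesT (T : countType) n r M f (c : T -> R) (al : T -> nat -> nat) :
  abs_le (fun j => c j * mono n (al j) r) M ->
  (forall x, inbox n r x -> has_sum (fun j => c j * mono n (al j) x) (f x)) ->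
  pseries n r M f.
Proof.
move=> cM h.
pose al' (j : nat) := oapp al (fun=> 0%N) (pickle_inv j).
have E x j : unpickled c j * mono n (al' j) x =
             unpickled (fun t => c t * mono n (al t) x) j.
  by rewrite /unpickled /al'; case: pickle_inv => //=; rewrite mul0r.
exists (unpickled c), al'; split.
  by rewrite (funext (E r)); exact: abs_le_unpickled.
by move=> x b; rewrite (funext (E x)); apply: has_sum_unpickled; apply: h.
Qed.

Lemma eq_pseries n r M f g : (forall x, inbox n r x -> f x = g x) ->
  pseries n r M f -> pseries n r M g.
Proof.
by move=> fg [c [al [cM h]]]; exists c, al; split=> // x b; rewrite -fg //; exact: h.
Qed.

Lemma pseries_le n r M M' f : M <= M' -> pseries n r M f -> pseries n r M' f.
Proof.
move=> le [c [al [cM h]]]; exists c, al; split=> // S u.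
exact: le_trans (cM S u) le.
Qed.

Lemma pseries_sub n r r' M f : inbox n r r' -> pseries n r M f -> pseries n r' M f.
Proof.
move=> b [c [al [cM h]]]; exists c, al; split; first exact: term_le cM.
by move=> x b'; apply: h; exact: inbox_sub b'.
Qed.

Lemma pseries_local n r M f x y : pseries n r M f -> inbox n r x ->
  (forall i, (i < n)%N -> x i = y i) -> f x = f y.
Proof.
move=> [c [al [cM h]]] b xy; apply: has_sum_unique (h x b) _.
have by' : inbox n r y by move=> i ni; rewrite -xy //; exact: b.
by apply: eq_has_sum (h y by') => j; rewrite (mono_ext _ xy).
Qed.

Lemma abs_le_fin (T : eqType) (a : T -> R) (S0 : seq T) : uniq S0 ->
  (forall i, i \notin S0 -> a i = 0) -> abs_le a (\sum_(i <- S0) `|a i|).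
Proof.
move=> u0 h S u; rewrite (bigID (mem S0)) /= [X in _ + X]big1 ?addr0; last first.
  by move=> i /h ->; rewrite normr0.
rewrite -big_filter; apply: sum_sub_le => //; first exact: filter_uniq.
by move=> x; rewrite mem_filter => /andP[].
Qed.

Lemma pseries_mono n r (al : nat -> nat) c :
  pseries n r `|c * mono n al r| (fun x => c * mono n al x).
Proof.
apply: (@pseriesT unit n r _ _ (fun=> c) (fun=> al)).
  have := @abs_le_fin unit (fun=> c * mono n al r) [:: tt] isT.
  by rewrite big_seq1; apply; case.
move=> x _; have := @has_sum_fin R unit (fun=> c * mono n al x) [:: tt] isT.
by rewrite big_seq1; apply; case.
Qed.

Lemma pseries_const n r c : pseries n r `|c| (fun=> c).
Proof.
have := pseries_mono n r (fun=> 0%N) c.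
have E x : mono n (fun=> 0%N) x = 1 by rewrite /mono big1.
by rewrite E mulr1; apply: eq_pseries => x _; rewrite E mulr1.
Qed.

Lemma pseries_coord n r i : (i < n)%N -> 0 <= r i -> pseries n r (r i) (fun x => x i).
Proof.
move=> ni r0; have := pseries_mono n r (fun j => (j == i)%N : nat) 1.
have E x : mono n (fun j => (j == i)%N : nat) x = x i.
  rewrite /mono (bigD1 (Ordinal ni)) //= eqxx expr1 big1 ?mulr1 // => j.
  by rewrite -val_eqE /= => /negbTE ->.
rewrite E mul1r ger0_norm //; apply: eq_pseries => x _.
by rewrite E mul1r.
Qed.

(** Completeness of the norm bounded by [M]: norms [m k] with a finite sum make the double family of
    monomials absolutely summable, and [has_sum_pair] identifies its sum. *)
Lemma pseries_series (K : countType) n r (m : K -> R) M (f : K -> (nat -> R) -> R) g :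
  (forall k, pseries n r (m k) (f k)) -> abs_le m M ->
  (forall x, inbox n r x -> has_sum (fun k => f k x) (g x)) ->
  pseries n r M g.
Proof.
move=> fm mM fg; have [c hc] := choice fm; have [al hal] := choice hc.
apply: (@pseriesT (K * nat)%type n r M g (fun p => c p.1 p.2) (fun p => al p.1 p.2)).
  by apply: (abs_le_pair (a := fun k j => c k j * mono n (al k j) r)) mM => k; case: (hal k).
move=> x b.
have [s hs] : exists s, has_sum (fun p : K * nat => c p.1 p.2 * mono n (al p.1 p.2) x) s.
  apply: (@abs_le_ex _ _ _ M).
  apply: (abs_le_pair (a := fun k j => c k j * mono n (al k j) x)) mM => k.
  by have [cM _] := hal k; exact: term_le cM.
suff <- : s = g x by [].
apply: has_sum_unique (fg x b).
apply: (has_sum_pair hs) => k.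
by case: (hal k) => _; apply.
Qed.

Lemma pseries_fsum n r (T : finType) (m : T -> R) (f : T -> (nat -> R) -> R) :
  (forall k, pseries n r (m k) (f k)) ->
  pseries n r (\sum_k m k) (fun x => \sum_k f k x).
Proof.
move=> fm; apply: (pseries_series fm).
  have -> : \sum_k m k = \sum_(k <- enum T) `|m k|.
    by rewrite big_enum; apply: eq_bigr => k _; rewrite ger0_norm // (pseries_ge0 (fm k)).
  by apply: abs_le_fin; rewrite ?enum_uniq // => i; rewrite mem_enum.
move=> x _; rewrite -big_enum; apply: has_sum_fin; first exact: enum_uniq.
by move=> i; rewrite mem_enum.
Qed.

Lemma pseries_add n r M M' f g : pseries n r M f -> pseries n r M' g ->
  pseries n r (M + M') (fun x => f x + g x).
Proof.
move=> hf hg.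
have := @pseries_fsum n r bool (fun b => if b then M else M') (fun b => if b then f else g).
rewrite big_bool => /(_ (fun b => if b return pseries n r (if b then M else M') (if b then f else g) then hf else hg)).
by apply: eq_pseries => x _; rewrite big_bool.
Qed.

(** The number [M] bounds the sum of the absolute values of the coefficients weighted by the radii,
    a submultiplicative norm. The expansion of the product is indexed by pairs of terms. *)
Lemma pseries_mul n r M M' f g : pseries n r M f -> pseries n r M' g ->
  pseries n r (M * M') (fun x => f x * g x).
Proof.
move=> [c [al [cM h]]] [c' [al' [cM' h']]].
have E x p : c p.1 * c' p.2 * mono n (fun i => al p.1 i + al' p.2 i)%N x =
             (c p.1 * mono n (al p.1) x) * (c' p.2 * mono n (al' p.2) x).
  rewrite mulrACA; congr (_ * _); rewrite /mono -big_split /=.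
  by apply: eq_bigr => i _; rewrite exprD.
have key x N N' :
   abs_le (fun j => c j * mono n (al j) x) N -> abs_le (fun j => c' j * mono n (al' j) x) N' ->
   abs_le (fun p : nat * nat => c p.1 * c' p.2 * mono n (fun i => al p.1 i + al' p.2 i)%N x) (N * N').
  move=> hN hN'; rewrite (funext (E x)).
  apply: (abs_le_pair (a := fun i j => (c i * mono n (al i) x) * (c' j * mono n (al' j) x))
                 (m := fun i => `|c i * mono n (al i) x| * N')).
    move=> i S u; apply: le_trans (_ : _ <= `|c i * mono n (al i) x| * \sum_(j <- S) `|c' j * mono n (al' j) x|) _.
      by rewrite mulr_sumr; apply: ler_sum => j _; rewrite normrM.
    by rewrite ler_wpM2l // hN'.
  move=> S u; have N'0 := abs_le_ge0 hN'.
  rewrite (eq_bigr (fun i => `|c i * mono n (al i) x| * N')) => [|i _]; last first.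
    by rewrite normrM normr_id (ger0_norm N'0).
  by rewrite -mulr_suml ler_wpM2r // hN.
have E2 x : inbox n r x -> has_sum (fun p : nat * nat => c p.1 * c' p.2 * mono n (fun i => al p.1 i + al' p.2 i)%N x) (f x * g x).
  move=> b; have [s hs] := abs_le_ex (key x _ _ (term_le b cM) (term_le b cM')).
  suff <- : s = f x * g x by [].
  have h1 := h' x b.
  have := has_sum_pair (a := fun i j => c i * c' j * mono n (fun k => al i k + al' j k)%N x) (t := fun i => c i * mono n (al i) x * g x) hs.
  have h2 i : has_sum (fun j => c i * c' j * mono n (fun k => al i k + al' j k)%N x) (c i * mono n (al i) x * g x).
    by apply: eq_has_sum (has_sum_scale _ h1) => j; rewrite (E x (i, j)).
  move=> /(_ h2) h3; apply: has_sum_unique h3 _.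
  by rewrite mulrC; apply: eq_has_sum (has_sum_scale (g x) (h x b)) => j; rewrite mulrC.
exact: (pseriesT (key r _ _ cM cM') E2).
Qed.

Lemma pseries_scale n r M c f : pseries n r M f -> pseries n r (`|c| * M) (fun x => c * f x).
Proof. exact/pseries_mul/pseries_const. Qed.

Lemma pseries_opp n r M f : pseries n r M f -> pseries n r M (fun x => - f x).
Proof.
move=> /(pseries_scale (-1)); rewrite normrN1 mul1r.
by apply: eq_pseries => x _; rewrite mulN1r.
Qed.

Lemma pseries_exp n r M f k : pseries n r M f -> pseries n r (M ^+ k) (fun x => f x ^+ k).
Proof.
move=> h; elim: k => [|k IH].
  by have := pseries_const n r 1; rewrite normr1; apply: eq_pseries => x _; rewrite expr0.
rewrite exprS; apply: eq_pseries (pseries_mul h IH) => x _.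
by rewrite exprS.
Qed.

Lemma pseries_prod n r (I : eqType) (s : seq I) (m : I -> R) (f : I -> (nat -> R) -> R) :
  (forall i, i \in s -> pseries n r (m i) (f i)) ->
  pseries n r (\prod_(i <- s) m i) (fun x => \prod_(i <- s) f i x).
Proof.
elim: s => [|i s IH] h.
  have := pseries_const n r 1; rewrite normr1 big_nil.
  by apply: eq_pseries => x _; rewrite big_nil.
rewrite big_cons; have hs : forall i, i \in s -> pseries n r (m i) (f i).
  by move=> j js; apply: h; rewrite inE js orbT.
apply: eq_pseries (pseries_mul (h i (mem_head _ _)) (IH hs)) => x _.
by rewrite big_cons.
Qed.

(** Substituting functions of norm at most [r i] for the variables does not increase the norm of any
    monomial, so the bound [M] survives. *)
Lemma pseries_comp n r M f k s (g : (nat -> R) -> nat -> R) :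
  pseries n r M f -> (forall i, (i < n)%N -> pseries k s (r i) (fun x => g x i)) ->
  pseries k s M (fun x => f (g x)).
Proof.
move=> [c [al [cM h]]] hg.
have r0 i : (i < n)%N -> 0 <= r i by move=> /hg/pseries_ge0.
apply: (@pseries_series nat k s (fun j => `|c j * mono n (al j) r|) M
          (fun j x => c j * mono n (al j) (g x))).
- move=> j; rewrite normrM; apply: pseries_scale.
  rewrite ger0_norm; last by apply: prodr_ge0 => i _; apply: exprn_ge0; exact: r0.
  apply: pseries_prod => i _; apply: pseries_exp; exact: hg.
- by move=> S u; under eq_bigr do rewrite normr_id; exact: cM.
- move=> x b; apply: h => i ni; exact: pseries_bound (hg i ni) b.
Qed.

Lemma mono_rec n al x : mono n.+1 al x = mono n al x * x n ^+ al n.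
Proof. by rewrite /mono big_ord_recr. Qed.

(** Expansion in powers of the last variable, cut at an arbitrary order. The coefficients [g] are
    fixed before the order [b], which makes it possible later to look for the first one that does
    not vanish. *)
Lemma pseries_split n r M f : 0 < r n -> pseries n.+1 r M f ->
  exists g : nat -> (nat -> R) -> R, (forall k, pseries n r (M / r n ^+ k) (g k)) /\
  forall b, exists h, pseries n.+1 r (M / r n ^+ b) h /\
    forall x, inbox n.+1 r x -> f x = \sum_(k < b) g k x * x n ^+ k + x n ^+ b * h x.
Proof.
move=> rn [c [al [cM H]]].
have rk k : 0 < r n ^+ k by rewrite exprn_gt0.
pose ck (k j : nat) := if al j n == k then c j else 0.
have ckM k : abs_le (fun j => ck k j * mono n (al j) r) (M / r n ^+ k).
  move=> S u; rewrite ler_pdivlMr // mulr_suml; apply: le_trans (cM S u).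
  apply: ler_sum => j _; rewrite -{1}(gtr0_norm (rk k)) -normrM /ck.
  by case: eqP => [<-|_]; rewrite ?mul0r ?normr0 // -mulrA -mono_rec.
exists (fun k x => tsum (fun j => ck k j * mono n (al j) x)); split.
  move=> k; exists (ck k), al; split=> // x b; apply: (@tsumP _ _ (M / r n ^+ k)).
  exact: term_le (ckM k).
move=> b.
pose cb j := if (b <= al j n)%N then c j else 0.
pose alb j i := if i == n then (al j n - b)%N else al j i.
have monob j x : mono n (alb j) x = mono n (al j) x.
  apply: eq_bigr => i _; rewrite /alb; case: eqP => // E.
  by have := ltn_ord i; rewrite E ltnn.
have cbM : abs_le (fun j => cb j * mono n.+1 (alb j) r) (M / r n ^+ b).
  move=> S u; rewrite ler_pdivlMr // mulr_suml; apply: le_trans (cM S u).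
  apply: ler_sum => j _; rewrite -{1}(gtr0_norm (rk b)) -normrM /cb.
  case: leqP => bj; rewrite ?mul0r ?normr0 // -mulrA !mono_rec monob /alb eqxx.
  by rewrite -mulrA -exprD subnK.
exists (fun x => tsum (fun j => cb j * mono n.+1 (alb j) x)).
have tb x : inbox n.+1 r x -> has_sum (fun j => cb j * mono n.+1 (alb j) x)
    (tsum (fun j => cb j * mono n.+1 (alb j) x)).
  move=> bx; apply: (@tsumP _ _ (M / r n ^+ b)); exact: term_le cbM.
split; first by exists cb, alb.
move=> x bx; apply: has_sum_unique (H x bx) _.
have tk k : has_sum (fun j => x n ^+ k * (ck k j * mono n (al j) x))
   (x n ^+ k * tsum (fun j => ck k j * mono n (al j) x)).
  apply: has_sum_scale; apply: (@tsumP _ _ (M / r n ^+ k)).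
  exact: term_le (inboxS bx) (ckM k).
have := has_sum_add (has_sum_sum (enum 'I_b) tk) (has_sum_scale (x n ^+ b) (tb x bx)).
rewrite [X in has_sum _ (X + _)]big_enum /=.
have -> : \sum_(i < b) x n ^+ i * tsum (fun j => ck i j * mono n (al j) x) =
  \sum_(k < b) tsum (fun j : nat => ck k j * mono n (al j) x) * x n ^+ k.
  by apply: eq_bigr => k _; rewrite mulrC.
apply: eq_has_sum => j; rewrite big_enum /=.
rewrite /ck /cb; have [bj|jb] := leqP b (al j n).
  rewrite big1 ?add0r => [|k _]; last first.
    by rewrite gtn_eqF ?mul0r ?mulr0 //; apply: leq_trans bj.
  rewrite !mono_rec monob /alb eqxx mulrCA; congr (_ * _).
  by rewrite mulrCA -exprD addnC subnK.
rewrite mul0r mulr0 addr0 (bigD1 (Ordinal jb)) //= eqxx big1 ?addr0 => [|k].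
  by rewrite mono_rec [RHS]mulrA [RHS]mulrC.
by rewrite -val_eqE /= eq_sym => /negbTE ->; rewrite mul0r mulr0.
Qed.

(** Each non-constant monomial gains at least one factor [d] when the radii are multiplied by [d].
    The smallness estimates on analytic functions come from here. *)
Lemma pseries_shrink n r M f d : 0 <= d <= 1 -> (forall i, (i < n)%N -> 0 <= r i) ->
  pseries n r M f -> pseries n (fun i => d * r i) (d * M) (fun x => f x - f (fun=> 0)).
Proof.
move=> /andP[d0 d1] r0 [c [al [cM h]]].
pose nz (j : nat) := [exists i : 'I_n, al j i != 0%N].
pose c' j := if nz j then c j else 0.
have nzmono x j : nz j = false -> mono n (al j) x = 1.
  move=> /existsPn nj; rewrite /mono big1 // => i _; have := nj i.
  by rewrite negbK => /eqP ->; rewrite expr0.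
have z0 j : nz j -> mono n (al j) (fun=> 0) = 0.
  by move=> /existsP[i ai]; rewrite /mono (bigD1 i) //= expr0n (negbTE ai) mul0r.
have b0 : inbox n r (fun=> 0) by move=> i ni; rewrite normr0 r0.
exists c', al; split.
  move=> S u; apply: (@le_trans _ _ (d * \sum_(i <- S) `|c i * mono n (al i) r|)).
    rewrite mulr_sumr; apply: ler_sum => j _.
    rewrite /c'; case nj: (nz j); last by rewrite mul0r normr0 mulr_ge0.
    rewrite !normrM [leRHS]mulrCA ler_wpM2l //.
    have -> : mono n (al j) (fun i => d * r i) = d ^+ (\sum_(i < n) al j i) * mono n (al j) r.
      by rewrite /mono -prodrXr -big_split /=; apply: eq_bigr => i _; exact: exprMn.
    rewrite normrM ler_wpM2r // ger0_norm ?exprn_ge0 // -[leRHS]expr1.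
    apply: ler_wiXn2l => //.
    move: nj => /existsP[i ai]; rewrite (bigD1 i) //= ltn_addr // lt0n //.
  by rewrite ler_wpM2l // cM.
move=> x bx.
have bx' : inbox n r x.
  move=> i ni; apply: (le_trans (bx i ni)).
  by rewrite -[leRHS]mul1r ler_wpM2r // r0.
have := has_sum_add (h x bx') (has_sum_scale (-1) (h _ b0)); rewrite mulN1r.
apply: eq_has_sum => j; rewrite /c'; case nj: (nz j).
  by rewrite z0 // mulr0 mulr0 addr0.
by rewrite !nzmono // mul0r mulr1 mulN1r subrr.
Qed.

Lemma pseries_shrink0 n r M f d : 0 <= d <= 1 -> (forall i, (i < n)%N -> 0 <= r i) ->
  pseries n r M f -> f (fun=> 0) = 0 -> pseries n (fun i => d * r i) (d * M) f.
Proof.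
move=> d01 r0 hf f0; apply: eq_pseries (pseries_shrink d01 r0 hf) => x _.
by rewrite f0 subr0.
Qed.

Lemma small_pow (q e : R) : 0 <= q <= 1 / 2 -> 0 < e ->
  exists N0, forall N, (N0 <= N)%N -> q ^+ N < e.
Proof.
move=> /andP[q0 q1] e0.
have ei : 0 <= e^-1 by rewrite invr_ge0 ltW.
exists (Num.bound e^-1) => N le.
have h1 : e^-1 < N%:R.
  apply: lt_le_trans (archi_boundP ei) _; by rewrite ler_nat.
have h2 : (N%:R : R) <= 2 ^+ N by rewrite -natrX ler_nat ltnW // ltn_expl.
apply: (@le_lt_trans _ _ ((2 ^+ N)^-1)).
  by rewrite -exprVn lerXn2r ?nnegrE //; lra.
rewrite invf_plt ?posrE ?exprn_gt0 //; lra.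
Qed.

Lemma abs_le_geom : abs_le (fun k => (1 / 2 : R) ^+ k) 2.
Proof.
apply: abs_le_nat => N.
have -> : \sum_(i < N) `|(1 / 2 : R) ^+ i| = 2 - 2 * (1 / 2) ^+ N.
  elim: N => [|N IH]; first by rewrite big_ord0 expr0; ring.
  rewrite big_ord_recr /= IH ger0_norm ?exprn_ge0 ?divr_ge0 // exprS; by field.
by rewrite lerBlDr lerDl mulr_ge0 // exprn_ge0 // divr_ge0.
Qed.

Lemma has_sum_geom (q : R) : `|q| <= 1 / 2 -> has_sum (fun k => q ^+ k) (1 - q)^-1.
Proof.
move=> q1.
have q2 : 1 - q != 0.
  by apply/negP => /eqP h; move: q1 => /ler_normlP[]; lra.
apply: (@nat_has_sum _ _ 2).
  apply: abs_le_dom abs_le_geom => k; rewrite !normrX lerXn2r ?nnegrE //.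
  by rewrite (@ger0_norm _ (1 / 2)) // divr_ge0.
move=> e e0; have [||N0 h] := @small_pow `|q| (e * `|1 - q|).
- by rewrite normr_ge0.
- by rewrite mulr_gt0 // normr_gt0.
exists N0 => N le.
have -> : \sum_(i < N) q ^+ i - (1 - q)^-1 = - (q ^+ N / (1 - q)).
  have := subrX1 q N => E.
  have -> : \sum_(i < N) q ^+ i = (1 - q ^+ N) / (1 - q).
    apply: (mulIf q2); rewrite divfK // mulrC -opprB mulNr -E opprB //.
  by field.
by rewrite normrN normrM normfV normrX ltr_pdivrMr ?normr_gt0 // h.
Qed.

(** Geometric series: with [F] the value at 0, [f = F * (1 - w)] where [w] vanishes at 0 and has
    norm at most 1/2 on a smaller box. The sign statement comes from the same estimate. *)
Lemma pseries_inv n r M f : (forall i, (i < n)%N -> 0 < r i) ->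
  pseries n r M f -> f (fun=> 0) != 0 ->
  exists d M', [/\ 0 < d <= 1, pseries n (fun i => d * r i) M' (fun x => (f x)^-1) &
    forall x, inbox n (fun i => d * r i) x -> 0 < f (fun=> 0) * f x].
Proof.
move=> r0 hf f0; set F := f _ in f0 *.
have M0 := pseries_ge0 hf.
have aF : 0 < `|F| by rewrite normr_gt0.
(* The norm of [w] is at most [d * M / |F|], which this choice makes equal to [M / (2 * (M + |F|))],
   hence at most 1/2. *)
pose d := `|F| / (2 * (M + `|F|)).
have d01 : 0 < d <= 1.
  apply/andP; split; first by rewrite divr_gt0 // mulr_gt0 // ltr_pwDr.
  by rewrite ler_pdivrMr ?mul1r; [lra | rewrite mulr_gt0 // ltr_pwDr].
have d01' : 0 <= d <= 1 by case/andP: d01 => /ltW -> ->.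
have rw i : (i < n)%N -> 0 <= r i by move=> /r0/ltW.
have hw := pseries_scale (- F^-1) (pseries_shrink d01' rw hf).
have small : `|- F^-1| * (d * M) <= 1 / 2.
  rewrite normrN normfV /d mulrA ler_pdivlMr //.
  have -> : `|F|^-1 * (`|F| / (2 * (M + `|F|))) * M * 2 = M / (M + `|F|).
    by field; rewrite !gt_eqF // ltr_pwDr.
  by rewrite ler_pdivrMr ?mul1r; [lra | exact: ltr_pwDr].
pose w x := - F^-1 * (f x - F).
have hw' : pseries n (fun i => d * r i) (1 / 2) w by exact: pseries_le hw.
have fw x : f x = F * (1 - w x) by rewrite /w; field.
have wb x : inbox n (fun i => d * r i) x -> `|w x| <= 1 / 2 by exact: pseries_bound.
exists d, (`|F^-1| * 2); split => //; last first.
  move=> x /wb; rewrite fw mulrA => h; apply: mulr_gt0; last by abs_lra.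
  by rewrite -expr2 exprn_even_gt0.
apply: (@eq_pseries _ _ _ (fun x => F^-1 * (1 - w x)^-1)).
  by move=> x _; rewrite fw invfM.
apply: pseries_scale.
apply: (@pseries_series nat _ _ (fun k => (1 / 2) ^+ k) 2 (fun k x => w x ^+ k)).
- by move=> k; exact: pseries_exp.
- exact: abs_le_geom.
- by move=> x /wb; exact: has_sum_geom.
Qed.

End Pseries.

(** * Weierstrass preparation *)

Section Weierstrass.
Variable R : realType.
Implicit Types (n : nat) (r x : nat -> R) (M : R).

Lemma pseries_lift n m r M (f : (nat -> R) -> R) : (n <= m)%N ->
  (forall i, (i < n)%N -> 0 <= r i) -> pseries n r M f -> pseries m r M f.
Proof.
move=> nm r0 hf; apply: (pseries_comp (g := fun x => x) hf) => i ni.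
by apply: pseries_coord; [exact: leq_trans nm | exact: r0].
Qed.

Lemma has_sum_shift (a : nat -> R) s : has_sum a s -> has_sum (fun k => a k.+1) (s - a 0%N).
Proof.
move=> H e e0; have [S0 h] := H e e0.
exists [seq k.-1 | k <- S0] => S u sub.
have := h (0%N :: [seq k.+1 | k <- S]); rewrite big_cons big_map /=.
rewrite map_inj_uniq; last exact: succn_inj.
have -> /= : 0%N \notin [seq k.+1 | k <- S] by apply/mapP => -[].
move=> /(_ u) hh; have := hh _; set z := \sum_(i <- S) _.
have -> : z - (s - a 0%N) = a 0%N + z - s by ring.
apply=> -[|k] kS; first exact: mem_head.
by rewrite inE /= mem_map; [apply: sub; apply: (map_f predn kS) | exact: succn_inj].
Qed.

(* Division by [f] amounts to inverting [id + T], with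
   [T w := (w e G - (its part of degree < b in z)) / z ^ b], [e := 1 / h] and
   [G := \sum_(k < b) g k z ^ k]; since the [g k] vanish at 0, shrinking the
   radii of the first [n] variables makes [T] a contraction. *)
Lemma weierstrass n (d0 : R) (b : nat) (Mg : nat -> R) Mh
    (g : nat -> (nat -> R) -> R) (h f : (nat -> R) -> R) :
  0 < d0 -> (forall k, (k < b)%N -> pseries n (fun=> d0) (Mg k) (g k)) ->
  pseries n.+1 (fun=> d0) Mh h ->
  (forall x, inbox n.+1 (fun=> d0) x ->
     f x = \sum_(k < b) g k x * x n ^+ k + x n ^+ b * h x) ->
  (forall k, (k < b)%N -> g k (fun=> 0) = 0) -> h (fun=> 0) != 0 ->
  exists d q (M' : nat -> R) a, [/\ 0 < d <= d0,
     forall j, pseries n (fun=> d) (M' j) (a j) &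
     forall x, inbox n.+1 (fun=> d) x -> 0 < h (fun=> 0) * q x /\
       q x * f x = x n ^+ b + \sum_(j < b) a j x * x n ^+ j].
Proof.
move=> d00 hg hh fE g0 h0.
have [d [C [d01 he hpos]]] := pseries_inv (fun _ _ => d00) hh h0.
have d0' : 0 < d by case/andP: d01.
pose d1 := d * d0.
have d10 : 0 < d1 by rewrite mulr_gt0.
have d1le : d1 <= d0 by rewrite ler_piMl //; [exact: ltW | case/andP: d01].
pose e x := (h x)^-1.
have {}he : pseries n.+1 (fun=> d1) C e := he.
have C0 := pseries_ge0 he.
pose C2 := \sum_(k < b) Mg k * d1 ^+ k.
have C20 : 0 <= C2.
  apply: sumr_ge0 => k _; apply: mulr_ge0; last by apply: exprn_ge0; exact: ltW.
  exact: pseries_ge0 (hg k (ltn_ord k)).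
have db : 0 < d1 ^+ b by rewrite exprn_gt0.
(* Chosen so that the contraction factor [C * (th * C2) / d1 ^+ b] is at most 1/4. *)
pose th := d1 ^+ b / (4 * (C * C2) + d1 ^+ b).
have den : 0 < 4 * (C * C2) + d1 ^+ b by rewrite ltr_pwDr // mulr_ge0 // mulr_ge0.
have th0 : 0 < th by rewrite divr_gt0.
have th1 : th <= 1 by rewrite ler_pdivrMr // mul1r lerDr mulr_ge0 // mulr_ge0.
have th01 : 0 <= th <= 1 by rewrite (ltW th0).
(* The radius of the last variable stays at [d1], because dividing by the [b]-th power of that
   variable costs the factor [d1 ^+ b] in the denominator. *)
pose rho (i : nat) := if i == n then d1 else th * d1.
have rho0 i : 0 < rho i by rewrite /rho; case: ifP => // _; rewrite mulr_gt0.
have rho0' i : 0 <= rho i by exact: ltW.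
have rhole i : rho i <= d1 by rewrite /rho; case: ifP => // _; rewrite ler_piMl // ltW.
have rhoge i : th * d1 <= rho i by rewrite /rho; case: ifP => // _; rewrite ler_piMl // ltW.
have thd1 : 0 <= th * d1 by rewrite mulr_ge0 // ltW.
have rhon : rho n = d1 by rewrite /rho eqxx.
have in_rho m x : inbox m rho x -> inbox m (fun=> d0) x.
  by move=> bx i mi; apply: le_trans (bx i mi) (le_trans (rhole i) d1le).
have {}he : pseries n.+1 rho C e.
  by apply: pseries_sub he => i _; rewrite ger0_norm.
have hg' k : (k < b)%N -> pseries n rho (th * Mg k) (g k).
  move=> kb; apply: (@pseries_sub _ _ (fun=> th * d1)).
    by move=> i ni; rewrite ger0_norm ?rhole // /rho ltn_eqF.
  apply: (pseries_shrink0 (r := fun=> d1)) th01 _ _ (g0 k kb).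
    by move=> i _; exact: ltW.
  by apply: pseries_sub (hg k kb) => i _; rewrite gtr0_norm.
pose G x := \sum_(k < b) g k x * x n ^+ k.
have hG : pseries n.+1 rho (th * C2) G.
  rewrite /C2 mulr_sumr; apply: pseries_fsum => k.
  rewrite mulrA; apply: pseries_mul.
    by apply: pseries_lift (hg' k _) => // i _.
  by rewrite -{1}rhon; apply: pseries_exp; apply: pseries_coord.
pose D j := C * (th * C2) / d1 ^+ j.
(* One application of [T]: [y.1] is the quotient by the [b]-th power and [y.2] lists the
   coefficients of lower degree. The hypothesis stands under the existential so that choice yields a
   total map, which can be iterated. *)
have step (s : ((nat -> R) -> R) * R) : exists y : ((nat -> R) -> R) * (nat -> (nat -> R) -> R),
   pseries n.+1 rho s.2 s.1 -> [/\ pseries n.+1 rho (s.2 / 4) y.1,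
      forall j, pseries n rho (s.2 * D j) (y.2 j) &
      forall x, inbox n.+1 rho x ->
       s.1 x * (e x * G x) = \sum_(j < b) y.2 j x * x n ^+ j + x n ^+ b * y.1 x].
  have [hs|ns] := pselect (pseries n.+1 rho s.2 s.1); last first.
    by exists (s.1, fun=> s.1) => /ns.
  have s0 := pseries_ge0 hs.
  have hp := pseries_mul hs (pseries_mul he hG).
  have [c [hc /(_ b)[t [ht E]]]] := pseries_split (rho0 n) hp.
  exists (t, c) => _; split => //=.
    apply: pseries_le ht; rewrite rhon -mulrA ler_wpM2l // ler_pdivrMr // /th.
    have -> : C * (d1 ^+ b / (4 * (C * C2) + d1 ^+ b) * C2) =
       (C * C2) / (4 * (C * C2) + d1 ^+ b) * d1 ^+ b by field; rewrite gt_eqF.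
    rewrite ler_wpM2r ?(ltW db) // ler_pdivrMr //; lra.
  by move=> j; have := hc j; rewrite rhon -mulrA.
have [F hF] := choice step.
(* [W k] is the [k]-th iterate of [- T] applied to 1. The Neumann series [Q] of these functions
   solves [Q + T Q = 1], and [Q / h] is the unit sought. *)
pose W := fix W k := if k is k'.+1 then (fun x => - (F (W k', (1 / 4) ^+ k')).1 x) else (fun=> 1).
pose c k := (F (W k, (1 / 4) ^+ k)).2.
have hW k : pseries n.+1 rho ((1 / 4) ^+ k) (W k).
  elim: k => [|k IH].
    by have := pseries_const n.+1 rho 1; rewrite normr1 expr0.
  have [/= h1 _ _] := hF (W k, (1 / 4) ^+ k) IH.
  apply: pseries_opp; apply: pseries_le h1.
  by rewrite exprS; lra.
have hc k j : pseries n rho ((1 / 4) ^+ k * D j) (c k j).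
  by have [_ /(_ j)] := hF (W k, (1 / 4) ^+ k) (hW k).
have hE k x : inbox n.+1 rho x ->
    \sum_(j < b) c k j x * x n ^+ j = W k x * (e x * G x) + x n ^+ b * W k.+1 x.
  have [_ _ E] := hF (W k, (1 / 4) ^+ k) (hW k).
  by move=> /E /= ->; rewrite mulrN addrK.
have q4 k : 0 <= (1 / 4 : R) ^+ k by rewrite exprn_ge0 // divr_ge0.
have q42 k : (1 / 4 : R) ^+ k <= (1 / 2) ^+ k by rewrite lerXn2r ?nnegrE //; lra.
have q2 k : 0 <= (1 / 2 : R) ^+ k by rewrite exprn_ge0 // divr_ge0.
have Wab x : inbox n.+1 rho x -> abs_le (fun k => W k x) 2.
  move=> bx; apply: abs_le_dom (@abs_le_geom R) => k.
  apply: le_trans (pseries_bound (hW k) bx) _.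
  by rewrite ger0_norm.
have Wab' x : inbox n.+1 rho x -> abs_le (fun k => W k.+1 x) (1 / 2).
  move=> bx; apply: (@abs_le_dom _ _ _ (fun k => 1 / 4 * (1 / 2) ^+ k)).
    move=> k; apply: le_trans (pseries_bound (hW k.+1) bx) _.
    rewrite exprS normrM (ger0_norm (q2 k)) (@ger0_norm _ (1 / 4)); last by lra.
    by rewrite ler_wpM2l //; lra.
  move=> S u; have p4 : (0 : R) < 1 / 4 by lra.
  have := @abs_le_geom R S u; rewrite -(ler_pM2l p4) mulr_sumr => h1.
  have E : (1 / 4 : R) * 2 = 1 / 2 by field.
  apply: le_trans (le_trans h1 (eq_ler E)); apply: ler_sum => k _.
  by rewrite normrM (ger0_norm (ltW p4)).
pose Q x := tsum (fun k => W k x).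
pose a j x := tsum (fun k => c k j x).
have hQ x : inbox n.+1 rho x -> has_sum (fun k => W k x) (Q x).
  by move=> /Wab/tsumP.
have Dpos j : 0 <= D j
  by apply: divr_ge0; [apply: mulr_ge0 => //; apply: mulr_ge0 => //; exact: ltW | apply: exprn_ge0; exact: ltW].
have aab j : abs_le (fun k => (1 / 4) ^+ k * D j) (2 * D j).
  move=> S u; have := @abs_le_geom R S u => h1.
  apply: le_trans (_ : _ <= (\sum_(i <- S) `|(1 / 2 : R) ^+ i|) * D j) _.
    rewrite mulr_suml; apply: ler_sum => k _.
    by rewrite normrM (ger0_norm (Dpos j)) ler_wpM2r // !ger0_norm.
  by rewrite ler_wpM2r.
have ha j x : inbox n rho x -> has_sum (fun k => c k j x) (a j x).
  move=> bx; apply: (@tsumP _ _ _ (2 * D j)).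
  apply: abs_le_dom (aab j) => k; apply: le_trans (pseries_bound (hc k j) bx) _.
  exact: ler_norm.
exists (th * d1), (fun x => Q x * e x), (fun j => 2 * D j), a; split.
- by rewrite mulr_gt0 //=; apply: le_trans d1le; rewrite ler_piMl // ltW.
- move=> j; apply: (@pseries_sub _ _ rho).
    by move=> i ni; rewrite ger0_norm.
  exact: (pseries_series (fun k => hc k j) (aab j) (ha j)).
move=> x bx.
have br : inbox n.+1 rho x.
  by move=> i ni; apply: le_trans (bx i ni) _.
(* [W 0] is 1 and the remaining terms sum to at most 1/2 in absolute value. *)
have Q0 : 0 < Q x.
  have := has_sum_le (Wab' x br) (has_sum_shift (hQ x br)).
  by move=> /= /ler_normlP[]; lra.
have hx : 0 < h (fun=> 0) * h x.
  by apply: hpos => i ni; apply: le_trans (br i ni) (rhole i).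
split.
  rewrite mulrCA mulr_gt0 // /e; have hx0 : h x != 0.
    by apply: contraTneq hx => ->; rewrite mulr0 ltxx.
  have -> : h (fun=> 0) * (h x)^-1 = h (fun=> 0) * h x / h x ^+ 2 by field.
  by rewrite divr_gt0 // exprn_even_gt0.
have hx0 : h x != 0 by apply: contraTneq hx => ->; rewrite mulr0 ltxx.
have S1 : has_sum (fun k => \sum_(j < b) c k j x * x n ^+ j) (\sum_(j < b) a j x * x n ^+ j).
  have H j : has_sum (fun k => c k j x * x n ^+ j) (a j x * x n ^+ j).
    rewrite mulrC; apply: eq_has_sum (has_sum_scale (x n ^+ j) (ha j x (inboxS br))) => k.
    by rewrite mulrC.
  have := has_sum_sum (enum 'I_b) H; rewrite big_enum /=.
  by apply: eq_has_sum => k; rewrite big_enum.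
have S2 : has_sum (fun k => \sum_(j < b) c k j x * x n ^+ j)
    (e x * G x * Q x + x n ^+ b * (Q x - 1)).
  apply: eq_has_sum (has_sum_add (has_sum_scale (e x * G x) (hQ x br))
    (has_sum_scale (x n ^+ b) (has_sum_shift (hQ x br)))) => k.
  by rewrite hE // mulrC.
rewrite (has_sum_unique S1 S2) (fE x (in_rho _ _ br)) -/(G x) /e.
by field.
Qed.

End Weierstrass.

(** * Analytic functions *)

Section Analytic.
Variable R : realType.
Implicit Types (n : nat) (p q x y : nat -> R) (f : (nat -> R) -> R).

Definition padd p x : nat -> R := fun i => p i + x i.
Definition ball n p (d : R) x := forall i, (i < n)%N -> `|x i - p i| < d.
(** Functions are total on sequences, and only their germ at [p] matters: no domain has to be
    carried along. *)
Definition anat n p f :=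
  exists d M, 0 < d /\ pseries n (fun=> d) M (fun x => f (padd p x)).

Lemma padd0 p : padd p (fun=> 0) = p.
Proof. by apply/funext => i; rewrite /padd addr0. Qed.

Lemma paddB p x : padd p (fun i => x i - p i) = x.
Proof. by apply/funext => i; rewrite /padd addrC subrK. Qed.

Lemma ball_center n p d : 0 < d -> ball n p d p.
Proof. by move=> d0 i _; rewrite subrr normr0. Qed.

Lemma ball_le n p d d' x : d <= d' -> ball n p d x -> ball n p d' x.
Proof. by move=> le b i ni; apply: lt_le_trans (b i ni) le. Qed.

Lemma ball_dim n n' p d x : (n <= n')%N -> ball n' p d x -> ball n p d x.
Proof. by move=> le b i ni; apply: b; exact: leq_trans le. Qed.

Lemma ball_open n p d x : ball n p d x -> exists2 e, 0 < e & forall y, ball n x e y -> ball n p d y.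
Proof.
elim: n => [|n IH] b; first by exists 1.
have [e e0 h] := IH (ball_dim (leqnSn n) b).
have bn := b n (leqnn _).
exists (Num.min e (d - `|x n - p n|)); first by rewrite lt_min e0 subr_gt0.
move=> y by_ i; rewrite ltnS leq_eqVlt => /orP[/eqP->|ni]; last first.
  by apply: h ni; move=> j nj; have := by_ j (ltnW nj); rewrite lt_min => /andP[].
have := by_ n (leqnn _); rewrite lt_min => /andP[_ h2].
have := ler_normD (y n - x n) (x n - p n); rewrite addrA subrK; lra.
Qed.

(** Takes the minimum of finitely many radii. Asking for [P i] at every smaller radius makes this
    possible without a monotonicity hypothesis on [P]. *)
Lemma unif_radius (P : nat -> R -> Prop) n :
  (forall i, (i < n)%N -> exists2 d, 0 < d & forall d', 0 < d' <= d -> P i d') ->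
  exists2 d, 0 < d & forall i, (i < n)%N -> forall d', 0 < d' <= d -> P i d'.
Proof.
elim: n => [|n IH] h; first by exists 1.
have [d d0 hd] := IH (fun i ni => h i (ltnW ni)).
have [e e0 he] := h n (leqnn _).
exists (Num.min d e); first by rewrite lt_min d0.
move=> i + d'; rewrite le_min => + /and3P[d'0 d'd d'e].
rewrite ltnS leq_eqVlt => /orP[/eqP->|ni]; first by apply: he; rewrite d'0.
by apply: hd => //; rewrite d'0.
Qed.

Lemma anat_small n p f D : 0 < D -> anat n p f ->
  exists2 d, 0 < d & forall d', 0 < d' <= d ->
    pseries n (fun=> d') D (fun x => f (padd p x) - f p).
Proof.
move=> D0 [d [M [d0 hf]]]; have M0 := pseries_ge0 hf.
exists (Num.min d (D * d / (M + 1))).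
  by rewrite lt_min d0 divr_gt0 ?mulr_gt0 // ltr_pwDr.
move=> d'; rewrite le_min => /and3P[d'0 d'd d'D].
have t01 : 0 <= d' / d <= 1.
  by apply/andP; split; [apply: divr_ge0; exact: ltW | rewrite ler_pdivrMr ?mul1r].
have := pseries_shrink t01 (fun _ _ => ltW d0) hf.
rewrite padd0 => h; have h2 : d' / d * M <= D.
  move: d'D; rewrite ler_pdivlMr ?ltr_pwDr // => h3.
  rewrite mulrAC ler_pdivrMr //; apply: le_trans h3; rewrite ler_wpM2l ?ltW //; lra.
apply: pseries_le h2 _; apply: pseries_sub h => i _.
by rewrite divfK ?gt_eqF // gtr0_norm.
Qed.

Lemma anat_cont n p f e : 0 < e -> anat n p f ->
  exists2 d, 0 < d & forall x, ball n p d x -> `|f x - f p| < e.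
Proof.
move=> e0 hf; have e2 : 0 < e / 2 by lra.
have [d d0 h] := anat_small e2 hf.
have hd : 0 < d <= d by rewrite d0 lexx.
exists d => // x b; have := pseries_bound (h d hd) (x := fun i => x i - p i).
rewrite paddB => h2; apply: le_lt_trans (h2 _) _; last lra.
by move=> i ni; exact/ltW/b.
Qed.

Lemma anat_comp n k p f (g : (nat -> R) -> nat -> R) :
  anat n (g p) f -> (forall i, (i < n)%N -> anat k p (fun x => g x i)) ->
  anat k p (fun x => f (g x)).
Proof.
move=> [d [M [d0 hf]]] hg.
have [e e0 he] := unif_radius (fun i ni => anat_small d0 (hg i ni)).
exists e, M; split=> //.
have E x : f (g (padd p x)) = f (padd (g p) (fun i => g (padd p x) i - g p i)).
  by rewrite paddB.
apply: eq_pseries (fun x _ => esym (E x)) _.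
apply: (pseries_comp hf (g := fun x i => g (padd p x) i - g p i)) => i ni.
by apply: he ni _ _; rewrite e0 lexx.
Qed.

Lemma anat_const n p c : anat n p (fun=> c).
Proof. by exists 1, `|c|; split=> //; exact: pseries_const. Qed.

Lemma anat_coord n p i : (i < n)%N -> anat n p (fun x => x i).
Proof.
move=> ni; exists 1, (`|p i| + 1); split=> //; apply: pseries_add.
  exact: pseries_const.
exact: (@pseries_coord R n (fun=> 1)).
Qed.

Lemma anat2 n p f g : anat n p f -> anat n p g -> exists d M N, 0 < d /\
  pseries n (fun=> d) M (fun x => f (padd p x)) /\
  pseries n (fun=> d) N (fun x => g (padd p x)).
Proof.
move=> [d [M [d0 hf]]] [e [N [e0 hg]]].
have h : 0 < Num.min d e by rewrite lt_min d0.
exists (Num.min d e), M, N; split=> //; split.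
  by apply: pseries_sub hf => i _; rewrite gtr0_norm // ge_min lexx.
by apply: pseries_sub hg => i _; rewrite gtr0_norm // ge_min lexx orbT.
Qed.

Lemma anat_add n p f g : anat n p f -> anat n p g -> anat n p (fun x => f x + g x).
Proof.
move=> hf hg; have [d [M [N [d0 [hf' hg']]]]] := anat2 hf hg.
by exists d, (M + N); split => //; exact: pseries_add.
Qed.

Lemma anat_mul n p f g : anat n p f -> anat n p g -> anat n p (fun x => f x * g x).
Proof.
move=> hf hg; have [d [M [N [d0 [hf' hg']]]]] := anat2 hf hg.
by exists d, (M * N); split => //; exact: pseries_mul.
Qed.

Lemma anat_opp n p f : anat n p f -> anat n p (fun x => - f x).
Proof. by move=> [d [M [d0 hf]]]; exists d, M; split=> //; exact: pseries_opp. Qed.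

Lemma anat_sub n p f g : anat n p f -> anat n p g -> anat n p (fun x => f x - g x).
Proof. by move=> hf hg; apply: anat_add => //; exact: anat_opp. Qed.

Lemma anat_exp n p f k : anat n p f -> anat n p (fun x => f x ^+ k).
Proof.
by move=> [d [M [d0 hf]]]; exists d, (M ^+ k); split=> //; exact: pseries_exp.
Qed.

Lemma anat_sum n p (T : Type) (r : seq T) (P : pred T) (F : T -> (nat -> R) -> R) :
  (forall t, anat n p (F t)) -> anat n p (fun x => \sum_(t <- r | P t) F t x).
Proof.
move=> h; elim: r => [|t r IH].
  have -> : (fun x => \sum_(t <- [::] | P t) F t x) = fun=> 0.
    by apply/funext => x; rewrite big_nil.
  exact: anat_const.
have -> : (fun x => \sum_(t <- t :: r | P t) F t x) =
    fun x => if P t then F t x + \sum_(t <- r | P t) F t x else \sum_(t <- r | P t) F t x.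
  by apply/funext => x; rewrite big_cons.
by case: (P t) => //; exact: anat_add.
Qed.

Lemma anat_nbhd n p f : anat n p f ->
  exists2 d, 0 < d & forall q, ball n p d q -> anat n q f.
Proof.
move=> [d [M [d0 hf]]]; have d2 : 0 < d / 2 by lra.
exists (d / 2) => // q b.
exists (d / 2), M; split=> //.
have E x : f (padd q x) = f (padd p (fun i => (q i - p i) + x i)).
  by congr f; apply/funext => i; rewrite /padd; ring.
apply: eq_pseries (fun x _ => esym (E x)) _.
apply: (pseries_comp hf (g := fun x i => (q i - p i) + x i)) => i ni.
have h1 : `|q i - p i| + d / 2 <= d by have := b i ni; lra.
apply: pseries_le h1 _; apply: pseries_add; first exact: pseries_const.
by apply: (@pseries_coord R n (fun=> d / 2)) => //; exact: ltW.
Qed.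

(** Analyticity in [n] variables constrains [f] only near [p]; even its independence of the entries
    from [n] on is a local fact. *)
Lemma anat_dep n p f : anat n p f -> exists2 d, 0 < d &
  forall x y, ball n p d x -> (forall i, (i < n)%N -> x i = y i) -> f x = f y.
Proof.
move=> [d [M [d0 hf]]]; exists d => // x y b xy.
have := pseries_local hf (x := fun i => x i - p i) (y := fun i => y i - p i).
rewrite !paddB; apply => [i ni|i ni]; first exact/ltW/b.
by rewrite xy.
Qed.

Lemma anat_dim n m p f : (n <= m)%N -> anat n p f -> anat m p f.
Proof.
move=> nm hf; apply: (anat_comp (g := fun x => x) hf) => i ni.
by apply: anat_coord; exact: leq_trans nm.
Qed.

Definition axis n (z : R) : nat -> R := fun i => if i == n then z else 0.

(** If every coefficient [g k] vanished at 0, then on the axis [f] would equal the [N]-th power of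
    [z] times a remainder of norm [M / d ^+ N]; as [|z| <= d / 2], this tends to 0 and contradicts
    [f (axis n z) != 0]. The order [b] is the first index with [g b] nonzero at 0. *)
Lemma order_split n d M f z : 0 < d -> pseries n.+1 (fun=> d) M f ->
  `|z| <= d / 2 -> f (axis n z) != 0 ->
  exists b (g : nat -> (nat -> R) -> R) h (Mg : nat -> R) (Mh : R),
   [/\ forall k, pseries n (fun=> d) (Mg k) (g k), pseries n.+1 (fun=> d) Mh h,
    forall x, inbox n.+1 (fun=> d) x ->
       f x = \sum_(k < b) g k x * x n ^+ k + x n ^+ b * h x,
    forall k, (k < b)%N -> g k (fun=> 0) = 0 & h (fun=> 0) != 0].
Proof.
move=> d0 hf zd fz; have M0 := pseries_ge0 hf.
have zd' : `|z| <= d by lra.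
have bz : inbox n.+1 (fun=> d) (axis n z).
  by move=> i ni; rewrite /axis; case: ifP => // _; rewrite normr0 ltW.
have [g [hg hs]] := pseries_split d0 hf.
have gz k : g k (axis n z) = g k (fun=> 0).
  apply: pseries_local (hg k) (inboxS bz) _ => i ni.
  by rewrite /axis ltn_eqF.
have [k0 Hk0] : exists k, g k (fun=> 0) != 0.
  apply: contrapT => nex.
  have all0 k : g k (fun=> 0) = 0.
    by apply/eqP/negPn/negP => hk; apply: nex; exists k.
  move/negP: fz; apply; apply/eqP/eps_eq => e e0; rewrite subr0.
  have [||N0 hN] := @small_pow R (`|z| / d) (e / (M + 1)).
  - by apply/andP; split; [apply: divr_ge0 => //; exact: ltW | rewrite ler_pdivrMr //; lra].
  - by rewrite divr_gt0 // ltr_pwDr.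
  have [h [hh ->]] := hs N0; last exact: bz.
  rewrite big1 ?add0r => [|k _]; last by rewrite gz all0 mul0r.
  have := hN _ (leqnn _); rewrite ltr_pdivlMr ?ltr_pwDr // => lt.
  have := pseries_bound hh bz => hb.
  rewrite normrM normrX {1}/axis eqxx; apply: le_lt_trans lt.
  apply: le_trans (ler_wpM2l _ hb) _; first exact: exprn_ge0.
  rewrite expr_div_n mulrA mulrAC ler_wpM2l //; last lra.
  by rewrite divr_ge0 ?exprn_ge0 // ltW.
pose P k := `[< g k (fun=> 0) != 0 >].
have exP : exists k, P k by exists k0; apply/asboolP.
have [b /asboolP gb bmin] := ex_minnP exP.
have [h [hh E]] := hs b.+1.
have hgb := pseries_lift (leqnSn n) (fun _ _ => ltW d0) (hg b).
have hz := pseries_coord (r := fun=> d) (ltnSn n) (ltW d0).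
exists b, g, (fun x => g b x + x n * h x), (fun k => M / d ^+ k), (M / d ^+ b + d * (M / d ^+ b.+1)).
split => //.
- by apply: pseries_add => //; exact: pseries_mul.
- move=> x bx; rewrite E // big_ord_recr /= exprS; ring.
- move=> k kb; apply/eqP/negPn/negP => hk.
  by have /bmin : P k by [apply/asboolP]; rewrite leqNgt kb.
- by rewrite mul0r addr0.
Qed.

(* Restriction to the line through [q] and [y]: a power series in one variable. *)
Lemma line_nonzero n p f d M q y : 0 < d -> pseries n (fun=> d) M (fun x => f (padd p x)) ->
  (forall i, (i < n)%N -> `|q i - p i| + 2 * `|y i - q i| <= d) -> f y != 0 ->
  exists2 e, 0 < e & forall s, 0 < `|s| < e -> f (fun i => q i + s * (y i - q i)) != 0.
Proof.
move=> d0 hf hd fy.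
pose F (s : nat -> R) := f (fun i => q i + s 0%N * (y i - q i)).
have hF : pseries 1 (fun=> 2) M F.
  have E s : F s = f (padd p (fun i => (q i - p i) + (y i - q i) * s 0%N)).
    by rewrite /F; congr f; apply/funext => i; rewrite /padd; ring.
  apply: eq_pseries (fun x _ => esym (E x)) _.
  apply: (pseries_comp hf (g := fun s i => (q i - p i) + (y i - q i) * s 0%N)) => i ni.
  apply: pseries_le (hd i ni) _; apply: pseries_add; first exact: pseries_const.
  rewrite mulrC; apply: pseries_scale; exact: (@pseries_coord R 1 (fun=> 2)).
have [||b [g [h [Mg [Mh [hg hh E g0 h0]]]]]] := order_split (ltr0Sn _ _) hF (z := 1).
  - by rewrite normr1; lra.
  - rewrite /F /axis eqxx; have -> : (fun i : nat => q i + 1 * (y i - q i)) = y.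
      by apply/funext => i; ring.
    by [].
have ah : anat 1 (fun=> 0) h.
  exists 2, Mh; split=> //; apply: eq_pseries hh => x _; congr h.
  by apply/funext => i; rewrite /padd add0r.
have [e e0 he] : exists2 e, 0 < e & forall x, ball 1 (fun=> 0) e x -> `|h x - h (fun=> 0)| < `|h (fun=> 0)|.
  by apply: anat_cont ah; rewrite normr_gt0.
exists (Num.min e 2); first by rewrite lt_min e0 ltr0Sn.
move=> s; rewrite lt_min => /and3P[s0 se s2].
have -> : f (fun i => q i + s * (y i - q i)) = F (axis 0 s) by rewrite /F /axis.
rewrite E; last by case=> //= _; rewrite /axis /= ltW.
rewrite big1 ?add0r => [|k _]; last first.
  by rewrite (pseries_local (y := fun=> 0) (hg k)) ?g0 ?mul0r.
rewrite {1}/axis eqxx mulf_neq0 ?expf_neq0 -?normr_gt0 //.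
have := he (axis 0 s) _; rewrite /ball; have bb : forall i, (i < 1)%N -> `|axis 0 s i - 0| < e.
  by case=> //= _; rewrite subr0.
move=> /(_ bb); rewrite distrC => h1.
have := ler_normB (h (fun=> 0)) (h (fun=> 0) - h (axis 0 s)); rewrite subKr.
rewrite normr_gt0 => _; apply: contraTneq h1 => ->; rewrite subr0 ltxx //.
Qed.

Lemma anat_sign n p f : anat n p f -> f p != 0 ->
  exists2 d, 0 < d & forall x, ball n p d x -> 0 < f p * f x.
Proof.
move=> hf fp; have ap : 0 < `|f p| by rewrite normr_gt0.
have [d d0 h] := anat_cont ap hf; exists d => // x /h {}h.
have h2 : `|f p * (f x - f p)| < f p * f p.
  by rewrite normrM -[ltRHS]ger0_norm ?normrM ?ltr_pM2l // -expr2 sqr_ge0.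
by move: h2 => /ltr_normlP[]; rewrite mulrBr; lra.
Qed.

Definition nzgerm n p f := forall e, 0 < e -> exists2 x, ball n p e x & f x != 0.

Lemma ballD n p q d e x : ball n p d q -> ball n q e x -> ball n p (d + e) x.
Proof.
move=> b b' i ni; have := b i ni; have := b' i ni.
have := ler_normD (x i - q i) (q i - p i); rewrite addrA subrK; lra.
Qed.

Lemma ball_sym n p d x : ball n p d x -> ball n x d p.
Proof. by move=> b i ni; rewrite distrC; exact: b. Qed.

(** Identity theorem: join a nearby point [q] to one point [y] where [f] is nonzero; on that line
    the zero of [f] at [q], if any, is isolated. *)
Lemma nzgerm_nbhd n p f : anat n p f -> nzgerm n p f ->
  exists2 d, 0 < d & forall q, ball n p d q -> nzgerm n q f.
Proof.
move=> [d [M [d0 hf]]] nz; have d8 : 0 < d / 8 by lra.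
exists (d / 8) => // q bq e e0; have [y by_ fy] := nz _ d8.
have bqy : ball n q (d / 4) y.
  by apply: ball_le (ballD (ball_sym bq) by_); lra.
have [i ni|c c0 hc] := line_nonzero d0 hf _ fy (q := q).
  by have := bq i ni; have := bqy i ni; lra.
pose s := Num.min (c / 2) (e / (d / 4)).
have s0 : 0 < s by rewrite lt_min !divr_gt0.
have sc : `|s| < c by rewrite gtr0_norm // gt_min; apply/orP; left; lra.
exists (fun i => q i + s * (y i - q i)); last by apply: hc; rewrite sc andbT gtr0_norm.
move=> i ni; rewrite addrC addKr normrM gtr0_norm //.
apply: lt_le_trans (_ : s * (d / 4) <= e).
  by rewrite ltr_pM2l //; exact: bqy.
have d4 : 0 < d / 4 by lra.
by rewrite -ler_pdivlMr // ge_min lexx orbT.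
Qed.

(** The points where the first functions are nonzero form an open set, inside which a small move
    makes the next one nonzero as well. *)
Lemma nzgerm_all n p s (F : nat -> (nat -> R) -> R) :
  (forall k, (k < s)%N -> anat n p (F k) /\ nzgerm n p (F k)) ->
  forall e, 0 < e -> exists2 y, ball n p e y & forall k, (k < s)%N -> F k y != 0.
Proof.
elim: s => [|s IH] h e e0; first by exists p => //; exact: ball_center.
have hk k : (k < s)%N -> anat n p (F k) /\ nzgerm n p (F k).
  by move=> ks; apply: h; exact: ltnW.
have [an nz] := h s (leqnn _).
have [d d0 hd] := nzgerm_nbhd an nz.
have [c c0 hc] : exists2 c, 0 < c & forall k, (k < s)%N -> forall c', 0 < c' <= c ->
    forall x, ball n p c' x -> anat n x (F k).
  apply: unif_radius => k ks; have [[c c0 hc] _] := (anat_nbhd (proj1 (hk k ks)), tt).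
  by exists c => // c' /andP[_ le] x b; apply: hc; exact: ball_le b.
pose e' := Num.min e (Num.min d c).
have e'0 : 0 < e' by rewrite !lt_min e0 d0.
have [y by_ Fy] := IH hk e' e'0.
have [be [bd bc]] : ball n p e y /\ ball n p d y /\ ball n p c y.
  by split; [|split]; apply: ball_le by_; rewrite !ge_min lexx ?orbT.
have [r r0 hr] := ball_open be.
have [c' c'0 hc'] : exists2 c, 0 < c & forall k, (k < s)%N -> forall c', 0 < c' <= c ->
    forall x, ball n y c' x -> F k x != 0.
  apply: unif_radius => k ks.
  have cc : 0 < c <= c by rewrite c0 lexx.
  have [c1 c10 hc1] := anat_sign (hc k ks c cc y bc) (Fy k ks).
  exists c1 => // c' /andP[_ le] x b; have := hc1 x (ball_le le b).
  by apply: contraTneq => ->; rewrite mulr0 ltxx.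
have m0 : 0 < Num.min r c' by rewrite lt_min r0.
have [x bx Fx] := hd y bd _ m0.
exists x; first by apply: hr; apply: ball_le bx; rewrite ge_min lexx.
move=> k; rewrite ltnS leq_eqVlt => /orP[/eqP->//|ks].
apply: (hc' k ks c'); first by rewrite c'0 lexx.
by apply: ball_le bx; rewrite ge_min lexx orbT.
Qed.

(** One line through [p] must serve all the functions at once, since a single linear change of
    coordinates will prepare them together. *)
Lemma good_direction n p s (F : nat -> (nat -> R) -> R) :
  (forall k, (k < s)%N -> anat n.+1 p (F k) /\ nzgerm n.+1 p (F k)) ->
  exists2 v : nat -> R, v n = 1 & forall k, (k < s)%N -> forall e, 0 < e ->
    exists2 z, `|z| < e & F k (fun i => p i + z * v i) != 0.
Proof.
move=> h.
(* The extra function [x n - p n] keeps the point [y] off the hyperplane through [p], so that the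
   direction can be normalised to [v n = 1]. *)
pose G k := if (k < s)%N then F k else fun x => x n - p n.
have hG k : (k < s.+1)%N -> anat n.+1 p (G k) /\ nzgerm n.+1 p (G k).
  rewrite /G => _; case: ifP => [/h //|_]; split.
    by apply: anat_sub; [exact: anat_coord | exact: anat_const].
  move=> e e0; exists (padd p (axis n (e / 2))).
    move=> i ni; rewrite /padd addrC addKr /axis; case: ifP => _; rewrite ?normr0 //.
    by rewrite gtr0_norm; lra.
  by rewrite /padd addrC addKr /axis eqxx; apply/eqP; lra.
have [d d0 hd] : exists2 d, 0 < d & forall k, (k < s)%N -> forall d', 0 < d' <= d ->
    exists M, pseries n.+1 (fun=> d') M (fun x => F k (padd p x)).
  apply: unif_radius => k ks; have [[d [M [d0 hf]]] _] := h k ks.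
  exists d => // d' /andP[d'0 le]; exists M; apply: pseries_sub hf => i _.
  by rewrite gtr0_norm.
have d2 : 0 < d / 2 by lra.
have [y by_ hy] := nzgerm_all hG d2.
have zy : y n - p n != 0 by have := hy s (leqnn _); rewrite /G ltnn.
exists (fun i => (y i - p i) / (y n - p n)); first by rewrite divff.
move=> k ks e e0; have Fy : F k y != 0 by have := hy k (ltnW ks); rewrite /G ks.
have dd : 0 < d <= d by rewrite d0 lexx.
have [M hM] := hd k ks d dd.
have [i ni|c c0 hc] := line_nonzero d0 hM _ Fy (q := p).
  by rewrite subrr normr0 add0r; have := by_ i ni; lra.
have az : 0 < `|y n - p n| by rewrite normr_gt0.
pose t := Num.min (c / 2) (e / 2 / `|y n - p n|).
have t0 : 0 < t by rewrite lt_min !divr_gt0.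
exists (t * (y n - p n)).
  rewrite normrM gtr0_norm // -ltr_pdivlMr // gt_min; apply/orP; right.
  by rewrite ltr_pM2r ?invr_gt0 //; lra.
have -> : (fun i => p i + t * (y n - p n) * ((y i - p i) / (y n - p n))) =
          (fun i => p i + t * (y i - p i)).
  by apply/funext => i; field.
apply: hc; rewrite gtr0_norm // t0 /= gt_min; apply/orP; left; lra.
Qed.

(** Weierstrass preparation around an arbitrary point. The constant [c] records the sign of the unit
    [u], which is constant on the box; signs of [f] can thus be read on the polynomial. *)
Lemma wp_germ n p f : anat n.+1 p f ->
  (forall e, 0 < e -> exists2 z, `|z| < e & f (padd p (axis n z)) != 0) ->
  exists d c b (u : (nat -> R) -> R) (a : nat -> (nat -> R) -> R), [/\ 0 < d,
    forall j y, ball n p d y -> anat n y (a j) &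
    forall x, ball n.+1 p d x -> 0 < c * u x /\
      u x * f x = (x n - p n) ^+ b + \sum_(j < b) a j x * (x n - p n) ^+ j].
Proof.
move=> [d [M [d0 hf]]] nz.
have d2 : 0 < d / 2 by lra.
have [z /ltW zd fz] := nz _ d2.
have [b [g [h [Mg [Mh [hg hh E g0 h0]]]]]] := order_split d0 hf zd fz.
have [e [q [M' [a [/andP[e0 _] ha hq]]]]] := weierstrass d0 (fun k _ => hg k) hh E g0 h0.
have [e' e'0 he'] : exists2 e', 0 < e' & forall j, (j < b)%N -> forall d', 0 < d' <= e' ->
    forall y, ball n p d' y -> anat n y (fun x => a j (fun i => x i - p i)).
  apply: unif_radius => j jb.
  have aj : anat n p (fun x => a j (fun i => x i - p i)).
    exists e, (M' j); split=> //; apply: eq_pseries (ha j) => x _; congr (a j).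
    by apply/funext => i; rewrite /padd addrC addKr.
  have [c c0 hc] := anat_nbhd aj; exists c => // c' /andP[_ le] y b'.
  by apply: hc; exact: ball_le b'.
(* Coefficients of index at least [b] are replaced by 0, so that [a j] is analytic for every [j]. *)
exists (Num.min e e'), (h (fun=> 0)), b, (fun x => q (fun i => x i - p i)),
  (fun j => if (j < b)%N then (fun x => a j (fun i => x i - p i)) else fun=> 0); split.
- by rewrite lt_min e0.
- move=> j y by_; case: ifP => jb; last exact: anat_const.
  apply: (he' j jb e'); first by rewrite e'0 lexx.
  by apply: ball_le by_; rewrite ge_min lexx orbT.
move=> x bx.
have [i ni|h1 h2] := hq (fun i => x i - p i).
  by have := bx i ni; rewrite lt_min => /andP[/ltW].
split=> //; rewrite paddB in h2; rewrite h2; congr (_ + _).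
by apply: eq_bigr => j _; rewrite ltn_ord.
Qed.

Definition upd x j v : nat -> R := fun i => if i == j then v else x i.

(** A partial derivative with a quadratic remainder: analytic functions satisfy this bound, and it
    makes vanishing derivatives usable by plain subdivision. *)
Definition deriv_at f j x D := exists C d, 0 < d /\ forall h, `|h| <= d ->
  `|f (upd x j (x j + h)) - f x - D * h| <= C * h ^+ 2.

(** Add a new variable to the coordinate [j] and expand in it to order two: the coefficient of
    degree one is the derivative, and it is analytic by construction. *)
Lemma anat_deriv n p f j : anat n p f -> (j < n)%N ->
  exists d C (g : (nat -> R) -> R), 0 < d /\ forall x, ball n p d x -> anat n x g /\
    forall h, `|h| <= d -> `|f (upd x j (x j + h)) - f x - g x * h| <= C * h ^+ 2.
Proof.
move=> [d [M [d0 hf]]] jn.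
have d2 : 0 < d / 2 by lra.
pose G (u : nat -> R) := f (padd p (fun i => u i + (if i == j then u n else 0))).
have hG : pseries n.+1 (fun=> d / 2) M G.
  apply: (pseries_comp hf (g := fun u i => u i + (if i == j then u n else 0))) => i ni.
  have E : d / 2 + d / 2 <= d by lra.
  apply: pseries_le E _; apply: pseries_add.
    by apply: (@pseries_coord R _ (fun=> d / 2)); [exact: ltnW | exact: ltW].
  case: (i == j); first by apply: (@pseries_coord R _ (fun=> d / 2)) => //; exact: ltW.
  have := @pseries_const R n.+1 (fun=> d / 2) 0; rewrite normr0; apply: pseries_le; exact: ltW.
have [g [hg /(_ 2%N)[t [ht E]]]] := pseries_split d2 hG.
pose g1 x := g 1%N (fun i => x i - p i).
have ag1 : anat n p g1.
  exists (d / 2), (M / (d / 2) ^+ 1); split=> //; apply: eq_pseries (hg 1%N) => x _; congr (g _).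
  by apply/funext => i; rewrite /padd addrC addKr.
have [e e0 he] := anat_nbhd ag1.
exists (Num.min (d / 2) e), (M / (d / 2) ^+ 2), g1; split; first by rewrite lt_min d2.
move=> x bx; split; first by apply: he; apply: ball_le bx; rewrite ge_min lexx orbT.
move=> h; rewrite le_min => /andP[hd _].
pose u h i := if i == n then h else x i - p i.
have bu h' : `|h'| <= d / 2 -> inbox n.+1 (fun=> d / 2) (u h').
  move=> h'd i; rewrite ltnS leq_eqVlt /u; case: eqP => //= _ ni.
  by have := bx i ni; rewrite lt_min => /andP[/ltW].
have gu k h' : `|h'| <= d / 2 -> g k (u h') = g k (fun i => x i - p i).
  move=> h'd; apply: pseries_local (hg k) (inboxS (bu h' h'd)) _ => i ni.
  by rewrite /u ltn_eqF.
have Gu h' : `|h'| <= d / 2 -> G (u h') = f (upd x j (x j + h')).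
  move=> h'd; rewrite /G.
  have B : inbox n (fun=> d) (fun i => u h' i + (if i == j then u h' n else 0)).
    move=> i ni; have := bu h' h'd i (ltnW ni); have := bu h' h'd n (leqnn _).
    case: ifP => _; last by rewrite addr0; lra.
    by have := ler_normD (u h' i) (u h' n); lra.
  rewrite (pseries_local (y := fun i => upd x j (x j + h') i - p i) hf B) ?paddB //.
  move=> i ni; rewrite /u /upd eqxx (ltn_eqF ni); case: eqP => [->|_]; first by ring.
  by rewrite addr0.
have hd0 : `|0 : R| <= d / 2 by rewrite normr0 ltW.
have E0 : f x = g 0%N (fun i => x i - p i).
  have := Gu 0 hd0; rewrite E; last exact: bu.
  rewrite addr0 (_ : upd x j (x j) = x); last first.
    by apply/funext => i; rewrite /upd; case: eqP => // ->.
  by rewrite !big_ord_recr big_ord0 /= /u eqxx !gu // => <-; ring.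
rewrite -Gu // E; last exact: bu.
rewrite !big_ord_recr big_ord0 /= !gu // {1 2 3}/u eqxx E0 /g1.
set A := g 0%N _; set B := g 1%N _.
have -> : 0 + A * h ^+ 0 + B * h ^+ 1 + h ^+ 2 * t (u h) - A - B * h = t (u h) * h ^+ 2 by ring.
rewrite normrM [`|h ^+ 2|]ger0_norm ?sqr_ge0 // ler_wpM2r ?sqr_ge0 //.
exact: pseries_bound (bu h hd).
Qed.

End Analytic.

(** * Implicit functions, Lipschitz bounds and changes of coordinates *)

Section Implicit.
Variable R : realType.
Implicit Types (n : nat) (p q x y : nat -> R) (f : (nat -> R) -> R).

(** The case [b = 1] of Weierstrass preparation: the prepared polynomial has degree one, and its
    only root is the implicit function. *)
Lemma implicit n p f D : anat n.+1 p f -> f p = 0 -> deriv_at f n p D -> D != 0 ->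
  exists d z, [/\ 0 < d, forall y, ball n p d y -> anat n y z, z p = p n &
    forall x, ball n.+1 p d x -> (f x = 0) <-> (x n = z x)].
Proof.
move=> [d [M [d0 hf]]] fp [C [c [c0 hD]]] D0.
have [g [hg /(_ 1%N)[h [hh E]]]] := pseries_split d0 hf.
have in0 : inbox n.+1 (fun=> d) (fun=> 0) by move=> i _; rewrite normr0 ltW.
have g0 : g 0%N (fun=> 0) = 0.
  by have := E _ in0; rewrite padd0 fp big_ord1 expr0 mulr1 expr1 mul0r addr0.
have ah : anat n.+1 (fun=> 0) h.
  exists d, (M / d ^+ 1); split=> //; apply: eq_pseries hh => x _; congr h.
  by apply/funext => i; rewrite /padd add0r.
(* Two first-order expansions of [f] along the last axis, from the power series and from [deriv_at],
   have the same slope. *)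
have h0 : h (fun=> 0) = D.
  apply: eps_eq => e e0; have e2 : 0 < e / 2 by lra.
  have [r r0 hr] := anat_cont e2 ah.
  pose C' := `|C| + 1; have C'0 : 0 < C' by rewrite ltr_pwDr.
  pose z := Num.min (Num.min c (r / 2)) (Num.min d (e / 2 / C')).
  have z0 : 0 < z by rewrite !lt_min c0 d0 !divr_gt0.
  have [zc zr zd ze] : [/\ z <= c, z <= r / 2, z <= d & z <= e / 2 / C'].
    by rewrite /z; split; rewrite !ge_min lexx ?orbT.
  have bz : inbox n.+1 (fun=> d) (axis n z).
    by move=> i _; rewrite /axis; case: ifP => _; rewrite ?normr0 ?gtr0_norm // ltW.
  have Ez : f (upd p n (p n + z)) = z * h (axis n z).
    have -> : upd p n (p n + z) = padd p (axis n z).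
      apply/funext => i; rewrite /upd /padd /axis; case: eqP => [->//|_].
      by rewrite addr0.
    rewrite E // big_ord1 (pseries_local (y := fun=> 0) (hg 0%N) (inboxS bz)) ?g0.
      by rewrite mul0r add0r expr1 /axis eqxx.
    by move=> i ni; rewrite /axis ltn_eqF.
  have := hD z; rewrite gtr0_norm // => /(_ zc); rewrite Ez fp subr0.
  have -> : z * h (axis n z) - D * z = z * (h (axis n z) - D) by ring.
  rewrite normrM gtr0_norm // expr2 mulrCA ler_pM2l // => h1.
  have h2 : `|h (axis n z) - h (fun=> 0)| < e / 2.
    apply: hr => i _; rewrite subr0 /axis; case: ifP => _; rewrite ?normr0 ?gtr0_norm //; lra.
  have h3 : C * z <= e / 2.
    apply: le_trans (_ : C' * z <= _); last by rewrite mulrC -ler_pdivlMr.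
    by rewrite ler_wpM2r ?ltW // /C'; have := ler_norm C; lra.
  move: h1 h2 h3; abs_lra.
have h0' : h (fun=> 0) != 0 by rewrite h0.
have g0' k : (k < 1)%N -> g k (fun=> 0) = 0 by case: k.
have [e [u [M' [a [/andP[e0 ed] ha hq]]]]] := weierstrass d0 (fun k (_ : (k < 1)%N) => hg k) hh
   E g0' h0'.
pose z x := p n - a 0%N (fun i => x i - p i).
have az : anat n p z.
  apply: anat_sub; first exact: anat_const.
  exists e, (M' 0%N); split=> //; apply: eq_pseries (ha 0%N) => x _; congr (a _).
  by apply/funext => i; rewrite /padd addrC addKr.
have [r r0 hr] := anat_nbhd az.
exists (Num.min e r), z; split.
- by rewrite lt_min e0.
- by move=> y by_; apply: hr; apply: ball_le by_; rewrite ge_min lexx orbT.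
- have be : inbox n.+1 (fun=> e) (fun=> 0) by move=> i _; rewrite normr0 ltW.
  have [_] := hq _ be; rewrite padd0 fp mulr0 big_ord1 expr1 expr0 mulr1 add0r /z => h1.
  have -> : (fun i => p i - p i) = (fun=> 0) by apply/funext => i; rewrite subrr.
  by rewrite -h1 subr0.
move=> x bx.
have [i ni|] := hq (fun i => x i - p i).
  by have := bx i ni; rewrite lt_min => /andP[/ltW].
rewrite paddB big_ord1 expr1 expr0 mulr1 /z => u0 h1.
have unz : u (fun i => x i - p i) != 0 by apply: contraTneq u0 => ->; rewrite mulr0 ltxx.
split=> h2; first by move: h1; rewrite h2 mulr0; lra.
by apply: (mulfI unz); rewrite h1 mulr0; lra.
Qed.

(** In [N] equal steps the total variation is at most [N * (C / N ^ 2) = C / N], which tends to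
    0. *)
Lemma deriv0_cst (psi : R -> R) C d : 0 < d ->
  (forall t h, 0 <= t <= 1 -> 0 <= t + h <= 1 -> `|h| <= d ->
     `|psi (t + h) - psi t| <= C * h ^+ 2) -> psi 0 = psi 1.
Proof.
move=> d0 H; apply: eps_eq => e e0; rewrite distrC.
pose N := (Num.bound (d^-1 + (`|C| + 1) / e)).+1.
have N0 : (0 : R) < N%:R by rewrite ltr0n.
have hb : d^-1 + (`|C| + 1) / e < N%:R.
  apply: lt_trans (archi_boundP _) _; first by rewrite addr_ge0 ?divr_ge0 ?invr_ge0 ?addr_ge0 // ltW.
  by rewrite ltr_nat.
have di0 : 0 < d^-1 by rewrite invr_gt0.
have ce0 : 0 < (`|C| + 1) / e by rewrite divr_gt0 // ltr_pwDr.
have Nd : N%:R^-1 <= d.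
  by rewrite -[d]invrK lef_pV2 ?posrE //; lra.
have Ce : C / N%:R < e.
  rewrite ltr_pdivrMr // mulrC -ltr_pdivrMr //; apply: le_lt_trans (_ : _ <= (`|C| + 1) / e) _.
    by rewrite ler_wpM2r ?invr_ge0 ?ltW //; have := ler_norm C; lra.
  lra.
have step k : (k <= N)%N -> `|psi (k%:R / N%:R) - psi 0| <= k%:R * (C / N%:R ^+ 2).
  elim: k => [|k IH] kN; first by rewrite mul0r subrr normr0 mul0r.
  have := IH (ltnW kN).
  have := H (k%:R / N%:R) (N%:R^-1).
  have -> : k%:R / N%:R + N%:R^-1 = k.+1%:R / N%:R :> R by rewrite -natr1 mulrDl mul1r.
  have Ni : 0 <= (N%:R : R)^-1 by rewrite invr_ge0 ltW.
  rewrite (ger0_norm Ni).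
  have k1 (j : nat) : (j <= N)%N -> 0 <= (j%:R / N%:R : R) <= 1.
    by move=> jN; rewrite divr_ge0 // ler_pdivrMr // mul1r ler_nat.
  move=> /(_ (k1 _ (ltnW kN)) (k1 _ kN) Nd).
  have -> : C * N%:R^-1 ^+ 2 = C / N%:R ^+ 2 by rewrite exprVn.
  set A := psi (k.+1%:R / _); set B := psi (k%:R / _) => h1 h2.
  have := ler_normD (A - B) (B - psi 0); rewrite addrA subrK -natr1 mulrDl mul1r; lra.
have := step N (leqnn _); rewrite divff ?gt_eqF // => h; apply: le_lt_trans h _.
have -> : N%:R * (C / N%:R ^+ 2) = C / N%:R by field; rewrite gt_eqF.
exact: Ce.
Qed.

Lemma deriv0_indep n p f j d C : 0 < d -> (j < n)%N ->
  (forall x, ball n p d x -> forall h, `|h| <= d ->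
     `|f (upd x j (x j + h)) - f x| <= C * h ^+ 2) ->
  forall x v, ball n p d x -> `|v - p j| < d -> f (upd x j v) = f x.
Proof.
move=> d0 jn H x v bx vd.
pose psi t := f (upd x j (x j + t * (v - x j))).
have xj := bx j jn.
have hpsi t : 0 <= t <= 1 -> ball n p d (upd x j (x j + t * (v - x j))).
  move=> /andP[t0 t1] i ni; rewrite /upd; case: eqP => [->|_]; last exact: bx.
  have -> : x j + t * (v - x j) - p j = (1 - t) * (x j - p j) + t * (v - p j) by ring.
  apply: le_lt_trans (ler_normD _ _) _; rewrite !normrM (ger0_norm t0) ger0_norm; last lra.
  have [->|tn] := eqVneq t 0; first by rewrite subr0 mul1r mul0r addr0.
  have tp : 0 < t by rewrite lt_neqAle eq_sym tn.
  have : t * `|v - p j| < t * d by rewrite ltr_pM2l.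
  have : (1 - t) * `|x j - p j| <= (1 - t) * d by rewrite ler_wpM2l ?(ltW xj) //; lra.
  lra.
have := @deriv0_cst psi (C * (v - x j) ^+ 2) (d / (`|v - x j| + 1)).
rewrite /psi mul0r addr0 mul1r [x j + _]addrC subrK.
have -> : upd x j (x j) = x by apply/funext => i; rewrite /upd; case: eqP => // ->.
move=> -> //; first by rewrite divr_gt0 // ltr_pwDr.
move=> t h t01 th01 hd.
have := H _ (hpsi t t01) (h * (v - x j)).
have -> : upd (upd x j (x j + t * (v - x j))) j (upd x j (x j + t * (v - x j)) j + h * (v - x j)) =
     upd x j (x j + (t + h) * (v - x j)).
  by apply/funext => i; rewrite /upd eqxx; case: eqP => // _; ring.
rewrite exprMn [h ^+ 2 * _]mulrC mulrA; apply.
move: hd; rewrite normrM ler_pdivlMr ?ltr_pwDr //.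
by have := normr_ge0 h; nra.
Qed.

(** For [s] larger than the radius, the bound [2 M] on differences is enough. For smaller [s],
    restrict [f] to the line from [y] towards [x], scaled so that [x] is reached at parameter [s];
    shrinking that one-variable series gains the factor [s]. *)
Lemma anat_lip n p f : anat n p f -> exists d L, [/\ 0 < d, 0 <= L &
  forall x y s, 0 < s -> ball n p d x -> ball n p d y ->
    (forall i, (i < n)%N -> `|x i - y i| <= s) -> `|f x - f y| <= L * s].
Proof.
move=> [d [M [d0 hf]]]; have M0 := pseries_ge0 hf.
have d2 : 0 < d / 2 by lra.
exists (d / 2), (4 * M / d); split=> //; first by rewrite divr_ge0 ?mulr_ge0 // ltW.
move=> x y s sp bx by_ xs.
have fb w : ball n p (d / 2) w -> `|f w| <= M.
  move=> bw; rewrite -(paddB p w).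
  have B : inbox n (fun=> d) (fun i => w i - p i) by move=> i ni; have := bw i ni; lra.
  exact: pseries_bound hf B.
have [sd|ds] := leP s (d / 2); last first.
  apply: le_trans (ler_normB _ _) _; have := fb x bx; have := fb y by_ => h1 h2.
  have : 2 * M <= 4 * M / d * s; last lra.
  by rewrite mulrAC ler_pdivlMr //; nra.
pose F (u : nat -> R) := f (fun i => y i + u 0%N * ((x i - y i) / s)).
have hF : pseries 1 (fun=> d / 2) M F.
  have E u : F u = f (padd p (fun i => (y i - p i) + (x i - y i) / s * u 0%N)).
    by rewrite /F; congr f; apply/funext => i; rewrite /padd; ring.
  apply: eq_pseries (fun x _ => esym (E x)) _.
  apply: (pseries_comp hf (g := fun u i => (y i - p i) + (x i - y i) / s * u 0%N)) => i ni.
  have h1 : `|y i - p i| + `|(x i - y i) / s| * (d / 2) <= d.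
    have := by_ i ni => h1; have : `|(x i - y i) / s| <= 1.
      by rewrite normrM normfV (gtr0_norm sp) ler_pdivrMr // mul1r xs.
    by move=> h2; have := ler_wpM2r (ltW d2) h2; lra.
  apply: pseries_le h1 _; apply: pseries_add; first exact: pseries_const.
  apply: pseries_scale; apply: (@pseries_coord R 1 (fun=> d / 2)) => //; exact: ltW.
have t01 : 0 <= s / (d / 2) <= 1.
  by apply/andP; split; [apply: divr_ge0; exact: ltW | rewrite ler_pdivrMr ?mul1r].
have h := pseries_shrink t01 (fun _ _ => ltW d2) hF.
have B : inbox 1 (fun=> s / (d / 2) * (d / 2)) (axis 0 s).
  by case=> // _; rewrite /axis /= divfK ?gt_eqF // gtr0_norm.
have := pseries_bound h B.
have -> : F (axis 0 s) = f x.
  by rewrite /F /axis eqxx; congr f; apply/funext => i; field; rewrite gt_eqF.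
have -> : F (fun=> 0) = f y.
  by rewrite /F; congr f; apply/funext => i; rewrite mul0r addr0.
move=> h1; apply: le_trans h1 _.
have -> : s / (d / 2) * M = 2 * (M / d * s) by field; rewrite gt_eqF.
have -> : 4 * M / d * s = 4 * (M / d * s) by ring.
have : 0 <= M / d * s by rewrite !mulr_ge0 ?invr_ge0 // ltW.
lra.
Qed.

Lemma updK x j : upd x j (x j) = x.
Proof. by apply/funext => i; rewrite /upd; case: eqP => // ->. Qed.

(* The analytic change of coordinates replacing [x j] by [H x]. *)
Lemma coord_change d q (H : (nat -> R) -> R) j D e : anat d q H -> (j < d)%N ->
  deriv_at H j q D -> D != 0 -> 0 < e ->
  exists z r r', [/\ 0 < r, 0 < r',
    forall y, ball d (upd q j (H q)) r y ->
      [/\ anat d y z, H (upd y j (z y)) = y j & ball d q e (upd y j (z y))] &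
    forall x, ball d q r' x ->
      ball d (upd q j (H q)) r (upd x j (H x)) /\ z (upd x j (H x)) = x j].
Proof.
move=> hH jd [C [c [c0 hD]]] D0 e0.
(* In [K], the entry [u j] is the prescribed value of [H], and the extra variable [u d] is the
   unknown coordinate [j]. Solving [K u = 0] for [u d] inverts the change of coordinates. *)
pose s (u : nat -> R) : nat -> R := fun i => if i == j then u d else if (i < d)%N then u i else q i.
pose K u := H (s u) - u j.
pose y0 := upd q j (H q).
pose u0 := upd y0 d (q j).
have jd' : (j == d) = false by rewrite ltn_eqF.
have su0 : s u0 = q.
  apply/funext => i; rewrite /s /u0 /y0 /upd eqxx; case: (eqVneq i j) => [->//|ij].
  by case: ifP => // id; rewrite (ltn_eqF id).
have aK : anat d.+1 u0 K.
  apply: anat_sub; last by apply: anat_coord; exact: ltnW.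
  apply: (anat_comp (n := d) (g := s)); first by rewrite su0.
  move=> i id; rewrite /s id; case: (i == j); apply: anat_coord => //; exact: ltnW.
have Ku0 : K u0 = 0 by rewrite /K su0 /u0 /y0 /upd jd' eqxx subrr.
have dK : deriv_at K d u0 D.
  exists C, c; split=> // h hc.
  have -> : K (upd u0 d (u0 d + h)) - K u0 = H (upd q j (q j + h)) - H q.
    have E : forall i, s (upd u0 d (u0 d + h)) i = upd q j (q j + h) i.
      move=> i; rewrite /s /u0 /y0 /upd eqxx; case: (eqVneq i j) => [//|ij].
      by case: ifP => // id; rewrite (ltn_eqF id).
    rewrite /K (funext E) su0 (_ : upd u0 d (u0 d + h) j = u0 j); last by rewrite /upd jd'.
    have -> : u0 j = H q by rewrite /u0 /y0 /upd jd' eqxx.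
    by rewrite subrr subr0.
  exact: hD.
have [r1 [z [r10 az zu0 hz]]] := implicit aK Ku0 dK D0.
have {}zu0 : z u0 = q j by rewrite zu0 /u0 /upd eqxx.
have [eta eta0 Hdep] := anat_dep hH.
have by0 r y : ball d y0 r y -> ball d u0 r y.
  by move=> b i id; have := b i id; rewrite /u0 [upd y0 _ _ _]/upd ltn_eqF.
have zdep y u : ball d y0 r1 y -> (forall i, (i < d)%N -> y i = u i) -> z y = z u.
  move=> /by0/az/anat_dep[c' c'0 h] yu; apply: (h y u) => //; exact: ball_center.
pose e' := Num.min (Num.min e eta) r1.
have e'0 : 0 < e' by rewrite !lt_min e0 eta0.
have [e'e e'eta e'r1] : [/\ e' <= e, e' <= eta & e' <= r1].
  by rewrite /e'; split; rewrite !ge_min lexx ?orbT.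
clearbody e'.
have [r2 r20 hr2] := anat_cont e'0 (az u0 (@ball_center _ _ _ _ r10)).
pose r := Num.min r2 e'.
have r0 : 0 < r by rewrite lt_min r20.
have [rr2 re'] : r <= r2 /\ r <= e' by rewrite /r; split; rewrite ge_min lexx ?orbT.
clearbody r.
have [r3 r30 hr3] := anat_cont r0 hH.
pose r' := Num.min (Num.min r3 r) e'.
have [r'r3 r'r r'e'] : [/\ r' <= r3, r' <= r & r' <= e'].
  by rewrite /r'; split; rewrite !ge_min lexx ?orbT.
exists z, r, r'; split => //; first by rewrite !lt_min r30 r0.
- move=> y by_.
  have hzy : `|z y - q j| < e'.
    by rewrite -zu0; apply: hr2; apply: ball_le rr2 _; exact: by0.
  have Bq : ball d q e' (upd y j (z y)).
    move=> i id; rewrite /upd; case: (eqVneq i j) => [->//|ij].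
    have := by_ i id; rewrite /upd (negbTE ij) => h; exact: lt_le_trans re'.
  have By : ball d y0 r1 y by apply: ball_le by_; lra.
  split; [by apply: az; exact: by0 | | exact: ball_le Bq].
  pose u := upd y d (z y).
  have yu i : (i < d)%N -> y i = u i by move=> id; rewrite /u /upd ltn_eqF.
  have Bu : ball d.+1 u0 r1 u.
    move=> i; rewrite ltnS leq_eqVlt => /orP[/eqP->|id]; last first.
      by rewrite -yu //; exact: by0 By i id.
    by rewrite /u /u0 /upd eqxx; exact: lt_le_trans e'r1.
  have : K u = 0 by apply/hz => //; rewrite -(zdep y u) // /u /upd eqxx.
  move=> /eqP; rewrite subr_eq0 => /eqP E.
  have uj : u j = y j by rewrite -yu.
  rewrite -uj -E; apply: Hdep; first exact: ball_le Bq.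
  move=> i id; rewrite /s /u /upd eqxx id; case: ifP => // _.
  by rewrite (ltn_eqF id).
- move=> x bx.
  have Bx : ball d y0 r (upd x j (H x)).
    move=> i id; rewrite /y0 /upd; case: (eqVneq i j) => [_|ij].
      by apply: hr3; exact: ball_le bx.
    by apply: lt_le_trans (bx i id) _.
  split=> //.
  have Bx1 : ball d y0 r1 (upd x j (H x)) by apply: ball_le Bx; lra.
  pose u := upd (upd x j (H x)) d (x j).
  have yu i : (i < d)%N -> upd x j (H x) i = u i by move=> id; rewrite /u {2}/upd ltn_eqF.
  have Bu : ball d.+1 u0 r1 u.
    move=> i; rewrite ltnS leq_eqVlt => /orP[/eqP->|id]; last first.
      by rewrite -yu //; exact: by0 Bx1 i id.
    rewrite /u /u0 {1}/upd {2}/upd eqxx; apply: lt_le_trans (bx j jd) _; lra.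
  rewrite (zdep _ u) //.
  have ud : u d = x j by rewrite /u /upd eqxx.
  have uj : u j = H x by rewrite -yu // /upd eqxx.
  rewrite -ud; apply/esym/hz => //.
  rewrite /K uj; apply/eqP; rewrite subr_eq0; apply/eqP.
  apply/esym/Hdep; first by apply: ball_le bx; lra.
  move=> i id; rewrite /s id /u /upd eqxx; case: (eqVneq i j) => [->//|ij].
  by rewrite (ltn_eqF id).
Qed.

End Implicit.

(** * Decomposition into analytic graphs *)

Section Cunion.
Variable R : realType.
Implicit Types (n : nat) (p q x y : nat -> R) (f : (nat -> R) -> R).
Local Notation pset := ((nat -> R) -> Prop).
Implicit Types (P : pset -> Prop) (X Y S : pset).

(** Empty members are allowed beside those in [P], so that finite and empty unions count without [P]
    having to contain the empty set. *)
Definition cunion P X := exists Xk : nat -> pset,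
  (forall k, P (Xk k) \/ forall v, ~ Xk k v) /\ forall v, X v <-> exists k, Xk k v.

Lemma cunion_ext P X Y : (forall v, X v <-> Y v) -> cunion P X -> cunion P Y.
Proof.
by move=> XY [Xk [h1 h2]]; exists Xk; split=> // v; rewrite -XY.
Qed.

Lemma cunion1 P X : P X -> cunion P X.
Proof.
move=> PX; exists (fun=> X); split; first by left.
by move=> v; split=> [Xv|[_ //]]; exists 0%N.
Qed.

Lemma cunion_count (K : countType) P (Y : K -> pset) :
  (forall k, cunion P (Y k)) -> cunion P (fun v => exists k, Y k v).
Proof.
move=> /choice[F hF].
pose Z (m : nat) : pset := oapp (fun p : K * nat => F p.1 p.2) (fun=> False) (pickle_inv m).
exists Z; split.
  move=> m; rewrite /Z; case: pickle_inv => [[k j]|] /=; last by right=> v [].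
  by have [h _] := hF k; exact: h.
move=> v; split.
  move=> [k]; have [_ E] := hF k; move=> /E[j hj]; exists (pickle (k, j)).
  by rewrite /Z pickleK_inv.
move=> [m]; rewrite /Z; case: pickle_inv => //= -[k j] /= h.
by exists k; have [_ E] := hF k; apply/E; exists j.
Qed.

Lemma cunionU P X Y : cunion P X -> cunion P Y -> cunion P (fun v => X v \/ Y v).
Proof.
move=> hX hY; have := @cunion_count bool P (fun b => if b then X else Y).
move=> /(_ (fun b => if b return cunion P (if b then X else Y) then hX else hY)).
apply: cunion_ext => v; split=> [[[]]|[]] h; [by left|by right|by exists true|by exists false].
Qed.

Lemma cunion0 P X : (forall v, ~ X v) -> cunion P X.
Proof.
move=> h; exists (fun=> X); split; first by right.
by move=> v; split=> [/h|[_ /h]].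
Qed.

Lemma rat_between (a b : R) : a < b -> exists q : rat, a < ratr q < b.
Proof.
by move=> /rat_in_itvoo[q]; rewrite in_itv => h; exists q.
Qed.

(** There are countably many rational boxes. To each one contained in some [ball n p (rad p)] with
    [p] in [S] a single such [p] is attached, and [None] to the others; a small rational box around
    [x] leads to a centre whose ball contains [x]. *)
Lemma lindelof n S (rad : (nat -> R) -> R) : (forall p, S p -> 0 < rad p) ->
  exists pt : nat -> option (nat -> R), (forall k p, pt k = Some p -> S p) /\
    forall x, S x -> exists k p, pt k = Some p /\ ball n p (rad p) x.
Proof.
move=> rad0.
pose B (c : seq rat * rat) : pset := ball n (fun i => ratr (nth 0 c.1 i)) (ratr c.2).
pose Q (c : seq rat * rat) (o : option (nat -> R)) :=
  (forall p, o = Some p -> S p /\ forall x, B c x -> ball n p (rad p) x) /\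
  (o = None -> forall p, S p -> ~ forall x, B c x -> ball n p (rad p) x).
have /choice[F hF] : forall c, exists o, Q c o.
  move=> c.
  have [[p [Sp hp]]|nex] := pselect (exists p, S p /\ forall x, B c x -> ball n p (rad p) x).
    by exists (Some p); split=> // p' [<-].
  by exists None; split=> // _ p Sp h; apply: nex; exists p.
exists (fun m => obind F (pickle_inv m)); split.
  move=> k p; case: pickle_inv => //= c Fc.
  by have [/(_ _ Fc)[]] := hF c.
move=> x Sx; have r0 := rad0 x Sx.
have [c2 /andP[c2l c2r]] : exists q : rat, rad x / 4 < ratr q < rad x / 2.
  by apply: rat_between; lra.
have hc i : exists q : rat, x i - rad x / 4 < ratr q < x i + rad x / 4.
  by apply: rat_between; lra.
have [c1 hc1] := choice hc.
pose c := (mkseq c1 n, c2).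
have Bx : B c x.
  move=> i ni; rewrite /= nth_mkseq //; have /andP[] := hc1 i => h1 h2.
  by apply/ltr_normlP; split; lra.
have Bsub y : B c y -> ball n x (rad x) y.
  move=> By i ni; have /= h1 := By i ni; have /= h2 := Bx i ni.
  move: h1 h2; rewrite /= nth_mkseq //; have /andP[] := hc1 i.
  by abs_lra.
exists (pickle c).
have [h1 h2] := hF c; rewrite pickleK_inv /=.
case E: (F c) => [p|]; last by case: (h2 E x Sx).
by exists p; split=> //; have [_] := h1 _ E; apply.
Qed.

(** The local set [Y] is only squeezed: it contains the image of [S] near [p] and lies in the whole
    image. This leaves room for charts that do not match the ball around [p] exactly. *)
Lemma cunion_local n P S (r : (nat -> R) -> (nat -> R) -> Prop) :
  (forall p, S p -> exists rho Y, [/\ 0 < rho, cunion P Y,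
      forall v, Y v -> exists x, S x /\ r x v &
      forall x v, S x -> ball n p rho x -> r x v -> Y v]) ->
  cunion P (fun v => exists x, S x /\ r x v).
Proof.
move=> H.
have /choice[F hF] : forall p, exists y : R * pset, S p -> [/\ 0 < y.1, cunion P y.2,
      forall v, y.2 v -> exists x, S x /\ r x v &
      forall x v, S x -> ball n p y.1 x -> r x v -> y.2 v].
  move=> p; have [Sp|nS] := pselect (S p); last by exists (1, S).
  by have [rho [Y h]] := H p Sp; exists (rho, Y).
have [|pt [pt1 pt2]] := @lindelof n S (fun p => (F p).1).
  by move=> p /hF[].
pose Y m := if pt m is Some p then (F p).2 else (fun=> False).
have := @cunion_count nat P Y; move=> /(_ _) hY.
apply: cunion_ext (hY _) => [v|m]; last first.
  rewrite /Y; case E: (pt m) => [p|]; last by apply: cunion0 => v [].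
  by have [] := hF p (pt1 _ _ E).
split=> [[m]|[x [Sx rx]]].
  rewrite /Y; case E: (pt m) => [p|//]; have [_ _ h _] := hF p (pt1 _ _ E).
  exact: h.
have [m [p [E b]]] := pt2 x Sx; exists m; rewrite /Y E.
by have [_ _ _ h] := hF p (pt1 _ _ E); exact: h b rx.
Qed.

End Cunion.

(** * Zero sets of analytic functions *)

Section Pieces.
Variable R : realType.
Implicit Types (p q x y : nat -> R) (f : (nat -> R) -> R).
Local Notation pset := ((nat -> R) -> Prop).

Definition opn n (O : pset) := forall x, O x -> exists2 e, 0 < e & forall y, ball n x e y -> O y.

Definition img n (phi : nat -> (nat -> R) -> R) x (v : nat -> R) :=
  forall i, (i < n)%N -> v i = phi i x.

(* An analytic graph over [l] of the [n] coordinates. *)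
Definition gpiece n l (X : pset) := exists c rho (psi : nat -> (nat -> R) -> R) (I : nat -> nat) L,
  [/\ 0 < rho, forall u, ball l c rho u -> forall i, (i < n)%N -> anat l u (psi i),
      forall i, (i < l)%N -> (I i < n)%N /\ forall u, ball l c rho u -> psi (I i) u = u i,
      forall u u' s, 0 < s -> ball l c rho u -> ball l c rho u' ->
        (forall k, (k < l)%N -> `|u k - u' k| <= s) ->
        forall i, (i < n)%N -> `|psi i u - psi i u'| <= L * s &
      forall v, X v <-> exists u, ball l c rho u /\ img n psi u v].

Definition gpieces n := cunion (fun X => exists l, gpiece n l X).

Lemma ball_opn n p d : opn n (ball n p d).
Proof. by move=> x /ball_open[e e0 h]; exists e. Qed.

Lemma fin_bound n (w : nat -> R) : exists2 W, 0 <= W & forall i, (i < n)%N -> `|w i| <= W.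
Proof.
exists (\sum_(i < n) `|w i|); first exact: sumr_ge0.
move=> i ni; rewrite (bigD1 (Ordinal ni)) //= lerDl; exact: sumr_ge0.
Qed.

(** Near [p] the functions ignore the entries beyond [n], so those of the direction can be set to 0.
    Later computations along it then become equalities of whole sequences. *)
Lemma good_direction0 n p s (F : nat -> (nat -> R) -> R) :
  (forall k, (k < s)%N -> anat n.+1 p (F k) /\ nzgerm n.+1 p (F k)) ->
  exists v : nat -> R, [/\ v n = 1, forall i, (n < i)%N -> v i = 0 &
   forall k, (k < s)%N -> forall e, 0 < e ->
    exists2 z, `|z| < e & F k (fun i => p i + z * v i) != 0].
Proof.
move=> h; have [v vn hv] := good_direction h.
exists (fun i => if (i <= n)%N then v i else 0); split.
- by rewrite leqnn.
- by move=> i; rewrite ltnNge => /negbTE ->.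
move=> k ks e e0; have [/anat_dep[c c0 hc] _] := h k ks.
have [V V0 hV] := fin_bound n.+1 v.
have m0 : 0 < Num.min e (c / (V + 1)) by rewrite lt_min e0 divr_gt0 // ltr_pwDr.
have [z] := hv k ks _ m0; rewrite lt_min => /andP[ze zc] Fz.
exists z => //; rewrite -(hc (fun i => p i + z * v i)) // => [i ni|i ni].
  rewrite addrC addKr normrM; apply: le_lt_trans (ler_wpM2l (normr_ge0 z) (hV i ni)) _.
  move: zc; rewrite ltr_pdivlMr ?ltr_pwDr //; have := normr_ge0 z; nra.
by rewrite -ltnS ni.
Qed.

Lemma poly_taylor (P : {poly R}) (w : R) : exists C, forall h, `|h| <= 1 ->
  `|P.[w + h] - P.[w] - P^`().[w] * h| <= C * h ^+ 2.
Proof.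
elim/poly_ind: P => [|P c [C hC]].
  by exists 0 => h _; rewrite deriv0 !horner0; rewrite !subrr mul0r subrr normr0 mul0r.
exists (C * (`|w| + 1) + `|P^`().[w]|) => h h1.
rewrite derivD derivC addr0 derivM derivX mulr1 !hornerD !hornerM !hornerX !hornerC.
have -> : P.[w + h] * (w + h) + c - (P.[w] * w + c) - (P^`().[w] * w + P.[w]) * h =
  (P.[w + h] - P.[w] - P^`().[w] * h) * (w + h) + P^`().[w] * h ^+ 2 by ring.
have hh := hC h h1.
apply: le_trans (ler_normD _ _) _; rewrite !normrM mulrDl lerD //; last first.
  by rewrite ler_wpM2l // -normrM -expr2 ger0_norm ?sqr_ge0.
have h2 : `|w + h| <= `|w| + 1 by apply: le_trans (ler_normD _ _) _; rewrite lerD2l.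
rewrite mulrAC; apply: ler_pM => //.
Qed.

Lemma anat_muln n p f k : anat n p f -> anat n p (fun x => f x *+ k).
Proof.
move=> hf; have -> : (fun x => f x *+ k) = fun x => k%:R * f x.
  by apply/funext => x; rewrite mulr_natl.
by apply: anat_mul => //; exact: anat_const.
Qed.

(** The coefficient of index [b] is overwritten by 1: the polynomial is monic whatever [a b] is. *)
Definition weier b (a : nat -> (nat -> R) -> R) x : {poly R} :=
  \poly_(i < b.+1) (if i == b then 1 else a i x).

Lemma weierE b a x w : (weier b a x).[w] = w ^+ b + \sum_(j < b) a j x * w ^+ j.
Proof.
rewrite horner_poly big_ord_recr /= eqxx mul1r addrC; congr (_ + _).
by apply: eq_bigr => i _; rewrite ltn_eqF.
Qed.

Lemma anat_weier n p b a k g : (forall j, anat n p (a j)) -> anat n p g ->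
  anat n p (fun x => ((weier b a x)^`(k)).[g x]).
Proof.
move=> ha hg.
have -> : (fun x => ((weier b a x)^`(k)).[g x]) = fun x => \sum_(i < b.+1)
    ((if (k + i < b.+1)%N then (if (k + i == b)%N then 1 else a (k + i)%N x) else 0)
      *+ (k + i) ^_ k) * g x ^+ i.
  apply/funext => x; rewrite (@horner_coef_wide _ b.+1).
    by apply: eq_bigr => i _; rewrite coef_derivn coef_poly.
  by apply/leq_sizeP => j bj; rewrite coef_derivn coef_poly ltnNge (leq_trans bj) ?leq_addl //= mul0rn.
apply: anat_sum => i; apply: anat_mul; last exact: anat_exp.
apply: anat_muln; case: (k + i < b.+1)%N; last exact: anat_const.
by case: (k + i == b)%N => //; exact: anat_const.
Qed.

Lemma weier_derivn b a x w : ((weier b a x)^`(b)).[w] != 0.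
Proof.
have -> : (weier b a x)^`(b) = (b`!%:R)%:P.
  apply/polyP => i; rewrite coef_derivn coef_poly coefC; case: i => [|i].
    by rewrite addn0 ltnSn eqxx ffactnn.
  by rewrite addnS ltnS ltnNge leq_addr mul0rn.
by rewrite hornerC pnatr_eq0 -lt0n fact_gt0.
Qed.

(** The decomposition theorem for sources of dimension [d], named because the induction passes it
    from one dimension to the next. Image map and equation are treated together, since each chart
    changes both. *)
Definition pieces_dim n d := forall (O : pset) f phi, opn d O ->
  (forall x, O x -> anat d x f /\ forall i, (i < n)%N -> anat d x (phi i)) ->
  gpieces n (fun v => exists x, (O x /\ f x = 0) /\ img n phi x v).

Lemma simple_deriv (P : {poly R}) w b : P.[w] = 0 -> P^`(b).[w] != 0 ->
  exists2 k, (k < b)%N & P^`(k).[w] = 0 /\ P^`(k.+1).[w] != 0.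
Proof.
move=> P0 Pb.
have ex : exists k, P^`(k).[w] != 0 by exists b.
have [[|k] hk kmin] := ex_minnP ex; first by rewrite derivn0 P0 eqxx in hk.
exists k; first exact: kmin.
split=> //; apply/eqP; apply: contraT => h; by have := kmin _ h; rewrite ltnn.
Qed.

(** After a shear and preparation, a zero of [F] is a root of a monic polynomial in the last
    variable. Its [b]-th derivative is a nonzero constant, so at each root some [k]-th derivative
    vanishes while the next one does not. Where this holds for a given [k], the last coordinate is
    an implicit function of the others, and the problem drops to [d] variables. *)
Lemma zero_set_charts n d : pieces_dim n d -> forall p r0 F f phi, 0 < r0 ->
  (forall x, ball d.+1 p r0 x ->
     [/\ anat d.+1 x F, anat d.+1 x f & forall i, (i < n)%N -> anat d.+1 x (phi i)]) ->
  nzgerm d.+1 p F ->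
  exists rho Y, [/\ 0 < rho, gpieces n Y,
    forall v, Y v -> exists x, [/\ ball d.+1 p r0 x, F x = 0, f x = 0 & img n phi x v] &
    forall x v, ball d.+1 p rho x -> F x = 0 -> f x = 0 -> img n phi x v -> Y v].
Proof.
move=> IH p r0 F f phi r00 an nz.
have pb : ball d.+1 p r0 p by exact: ball_center.
have [aF _ _] := an p pb.
have [v [vd v0 hv]] := good_direction0 (s := 1) (F := fun=> F) (fun k _ => conj aF nz).
pose w i := if (i < d)%N then v i else 0.
have [W W0 hW] := fin_bound d.+1 w.
(* Shear carrying the last axis through [p] onto the line along which [F] is not identically
   zero. *)
pose Phi x : nat -> R := fun i => x i + w i * (x d - p d).
pose Psi x : nat -> R := fun i => x i - w i * (x d - p d).
have wd : w d = 0 by rewrite /w ltnn.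
have PhiK x : Phi (Psi x) = x.
  by apply/funext => i; rewrite /Phi /Psi wd mul0r subr0 subrK.
have W1 : 0 < W + 1 by rewrite ltr_pwDr.
have bd (s : R) x r : `|s| <= 1 -> ball d.+1 p (r / (W + 1)) x ->
     ball d.+1 p r (fun i => x i + s * (w i * (x d - p d))).
  move=> s1 b i ni.
  have := b i ni; have := b d (leqnn _); rewrite !ltr_pdivlMr // => h1 h2.
  have -> : x i + s * (w i * (x d - p d)) - p i = (x i - p i) + s * (w i * (x d - p d)) by ring.
  apply: le_lt_trans (ler_normD _ _) _; rewrite !normrM.
  have h3 := hW i ni; have h4 := normr_ge0 (x d - p d); have h5 := normr_ge0 (w i).
  have h6 : `|s| * (`|w i| * `|x d - p d|) <= W * `|x d - p d|.
    apply: le_trans (_ : _ <= 1 * (W * `|x d - p d|)) _; last by rewrite mul1r.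
    apply: ler_pM => //; first exact: mulr_ge0.
    exact: ler_wpM2r.
  have [le|le] := leP (`|x i - p i|) (`|x d - p d|); nra.
have PhiB x r : ball d.+1 p (r / (W + 1)) x -> ball d.+1 p r (Phi x).
  move=> b i ni; have := @bd 1 x r _ b i ni; rewrite mul1r; apply; by rewrite normr1.
have PsiB x r : ball d.+1 p (r / (W + 1)) x -> ball d.+1 p r (Psi x).
  move=> b i ni; have := @bd (-1) x r _ b i ni; rewrite mulN1r; apply; by rewrite normrN1.
have aPhi x i : (i < d.+1)%N -> anat d.+1 x (fun x => Phi x i).
  move=> id; apply: anat_add; first exact: anat_coord.
  apply: anat_mul; first exact: anat_const.
  by apply: anat_sub; [exact: anat_coord | exact: anat_const].
pose F1 x := F (Phi x).
have Phip : Phi p = p by apply/funext => i; rewrite /Phi subrr mulr0 addr0.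
have aF1 : anat d.+1 p F1.
  by apply: (anat_comp (n := d.+1) (g := Phi)); [rewrite Phip | exact: aPhi].
have nz1 e : 0 < e -> exists2 z, `|z| < e & F1 (padd p (axis d z)) != 0.
  move=> e0; have [z ze Fz] := hv 0%N isT e e0; exists z => //.
  rewrite /F1 (_ : Phi (padd p (axis d z)) = fun i => p i + z * v i) //.
  apply/funext => i; rewrite /Phi /padd /axis eqxx /w; case: (ltngtP i d) => id.
  - by ring.
  - by rewrite v0 //; ring.
  - by rewrite id vd; ring.
have [r1 [c [b [u [a [r10 ha hq]]]]]] := wp_germ aF1 nz1.
pose r2 := Num.min r1 (r0 / (W + 1)).
have r20 : 0 < r2 by rewrite lt_min r10 divr_gt0.
have [r2r1 r2r0] : r2 <= r1 /\ r2 <= r0 / (W + 1) by rewrite /r2; split; rewrite ge_min lexx ?orbT.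
clearbody r2.
have PhiB2 x : ball d.+1 p r2 x -> ball d.+1 p r0 (Phi x).
  by move=> b'; apply: PhiB; exact: ball_le b'.
pose G k x := ((weier b a x)^`(k)).[x d - p d].
have F1G x : ball d.+1 p r2 x -> F1 x = 0 -> G 0%N x = 0.
  move=> bx F1x; have [_] := hq x (ball_le r2r1 bx).
  by rewrite F1x mulr0 /G derivn0 weierE.
have aa x j : ball d.+1 p r2 x -> anat d x (a j).
  move=> bx; apply: ha; exact: ball_le r2r1 (ball_dim (leqnSn d) bx).
have aG x k : ball d.+1 p r2 x -> anat d.+1 x (G k).
  move=> bx; apply: anat_weier; first by move=> j; apply: anat_dim (leqnSn d) _; exact: aa.
  by apply: anat_sub; [exact: anat_coord | exact: anat_const].
have dG x k : ball d.+1 p r2 x -> deriv_at (G k) d x (G k.+1 x).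
  move=> bx; have [C hC] := poly_taylor ((weier b a x)^`(k)) (x d - p d).
  exists C, 1; split=> // h h1.
  have -> : G k (upd x d (x d + h)) = ((weier b a x)^`(k)).[(x d - p d) + h].
    rewrite /G; have -> : weier b a (upd x d (x d + h)) = weier b a x.
      apply/polyP => i; rewrite !coef_poly; case: ifP => // _; case: ifP => // _.
      have [e e0 he] := anat_dep (aa x i bx).
      apply/esym/he; first exact: ball_center.
      by move=> k' k'd; rewrite /upd ltn_eqF.
    by rewrite /upd eqxx; congr (_.[_]); ring.
  by rewrite /G derivnS; exact: hC.
pose S k x := [/\ ball d.+1 p r2 x, F1 x = 0, f (Phi x) = 0 & G k x = 0 /\ G k.+1 x != 0].
have HS k : gpieces n (fun v => exists x, S k x /\ img n (fun i x => phi i (Phi x)) x v).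
  apply: (@cunion_local R d.+1) => x0 [bx0 F1x0 fx0 [G0 G1]].
  have [r3 [z [r30 az zx0 hz]]] := implicit (aG x0 k bx0) G0 (dG x0 k bx0) G1.
  have [e1 e10 he1] := ball_open bx0.
  have [e2 e20 he2] := anat_sign (aG x0 k.+1 bx0) G1.
  pose e := Num.min (Num.min e1 e2) r3.
  have e0 : 0 < e by rewrite !lt_min e10 e20.
  have [ee1 ee2 er3] : [/\ e <= e1, e <= e2 & e <= r3].
    by rewrite /e; split; rewrite !ge_min lexx ?orbT.
  clearbody e.
  have [r4 r40 hr4] := anat_cont e0 (az x0 (@ball_center _ _ _ _ r30)).
  pose rr := Num.min r4 e.
  have rr0 : 0 < rr by rewrite lt_min r40.
  have [rrr4 rre] : rr <= r4 /\ rr <= e by rewrite /rr; split; rewrite ge_min lexx ?orbT.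
  clearbody rr.
  pose ch y := upd y d (z y).
  have chB y : ball d x0 rr y -> ball d.+1 x0 e (ch y).
    move=> by_ i; rewrite ltnS leq_eqVlt /ch /upd => /orP[/eqP->|id].
      by rewrite eqxx -zx0; apply: hr4; exact: ball_le by_.
    by rewrite (ltn_eqF id); apply: lt_le_trans rre; exact: by_.
  have azy y : ball d x0 rr y -> anat d y z by move=> by_; apply: az; apply: ball_le by_; lra.
  have ach y i : ball d x0 rr y -> (i < d.+1)%N -> anat d y (fun y => ch y i).
    move=> by_; rewrite ltnS leq_eqVlt /ch /upd => /orP[/eqP->|id].
      by rewrite eqxx; exact: azy.
    by rewrite (ltn_eqF id); exact: anat_coord.
  have aPch y i : ball d x0 rr y -> (i < d.+1)%N -> anat d y (fun y => Phi (ch y) i).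
    move=> by_ id; apply: (anat_comp (g := ch) (aPhi (ch y) i id)) => j jd.
    exact: ach.
  have chB2 y : ball d x0 rr y -> ball d.+1 p r2 (ch y).
    by move=> by_; apply: he1; apply: ball_le ee1 _; exact: chB.
  have acomp y g : ball d x0 rr y -> anat d.+1 (Phi (ch y)) g -> anat d y (fun y => g (Phi (ch y))).
    by move=> by_ hg; apply: (anat_comp (g := fun y => Phi (ch y)) hg) => i id; exact: aPch.
  (* On the chart only the [k]-th derivative is known to vanish; [F1] and [f] must still be imposed,
     and a sum of squares makes them one equation. *)
  pose f2 y := F1 (ch y) ^+ 2 + f (Phi (ch y)) ^+ 2.
  exists rr, (fun v => exists y, (ball d x0 rr y /\ f2 y = 0) /\ img n (fun i y => phi i (Phi (ch y))) y v).
  split => //.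
  - apply: IH; first exact: ball_opn.
    move=> y by_; have [aF' af aphi] := an _ (PhiB2 _ (chB2 y by_)).
    split; first by apply: anat_add; apply: anat_exp; exact: acomp.
    by move=> i ni; apply: acomp => //; exact: aphi.
  - move=> v' [y [[by_ f2y] im]]; exists (ch y); split=> //.
    have [F1c fc] : F1 (ch y) = 0 /\ f (Phi (ch y)) = 0.
      move: f2y => /eqP; rewrite /f2 paddr_eq0 ?sqr_ge0 // !sqrf_eq0.
      by move=> /andP[/eqP ? /eqP].
    split=> //; first exact: chB2.
    split; last first.
      have := he2 (ch y) (ball_le ee2 (chB y by_)).
      by apply: contraTneq => ->; rewrite mulr0 ltxx.
    apply/hz; first exact: ball_le (chB y by_).
    have [e3 e30 he3] := anat_dep (azy y by_).
    rewrite -(he3 y (ch y)) ?/ch ?/upd ?eqxx //; first exact: ball_center.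
    by move=> i id; rewrite ltn_eqF.
  - move=> x v' [bx F1x fx [Gx _]] bxr im; exists x.
    have Ex : ch x = x.
      rewrite /ch; have <- : x d = z x.
        by apply/hz => //; apply: ball_le bxr; lra.
      exact: updK.
    split; last by move=> i ni; rewrite Ex; exact: im.
    split; first exact: ball_dim bxr.
    by rewrite /f2 Ex F1x fx expr0n /= addr0.
exists (r2 / (W + 1)), (fun v => exists k, exists x, S k x /\ img n (fun i x => phi i (Phi x)) x v).
split.
- by rewrite divr_gt0.
- exact: (@cunion_count R nat).
- move=> v' [k [x [[bx F1x fx _] im]]]; exists (Phi x); split=> //.
  exact: PhiB2.
- move=> x v' bx Fx fx im.
  have bP : ball d.+1 p r2 (Psi x) by exact: PsiB.
  have F1P : F1 (Psi x) = 0 by rewrite /F1 PhiK.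
  have G0 := F1G _ bP F1P; rewrite /G derivn0 in G0.
  have [k _ hk] := simple_deriv G0 (weier_derivn b a _ _).
  exists k, (Psi x); split; last by move=> i ni; rewrite PhiK; exact: im.
  by split=> //; rewrite PhiK.
Qed.

End Pieces.

(** * Analytic images as graphs *)

Section Straighten.
Variable R : realType.
Implicit Types (p q x y : nat -> R) (f : (nat -> R) -> R).
Local Notation pset := ((nat -> R) -> Prop).

Definition swp l j y : nat -> R := fun i => if i == l then y j else if i == j then y l else y i.

Lemma swpK l j y : swp l j (swp l j y) = y.
Proof.
apply/funext => i; rewrite /swp eqxx; case: (eqVneq i l) => [->|il].
  by case: (eqVneq j l) => [->|].
by case: (eqVneq i j) => [->|]; rewrite ?eqxx.
Qed.

Lemma ball_swp n l j p d y : (l < n)%N -> (j < n)%N ->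
  ball n p d y -> ball n (swp l j p) d (swp l j y).
Proof.
by move=> ln jn b i ni; rewrite /swp; case: (i == l); [|case: (i == j)]; exact: b.
Qed.

(* Near a point where [phi i0] depends on [x j], use [phi i0] as the [l]-th coordinate. *)
Lemma straighten n d l j i0 (O : pset) phi (I : nat -> nat) q g :
  opn d O -> (forall x, O x -> forall i, (i < n)%N -> anat d x (phi i)) ->
  (forall i, (i < l)%N -> (I i < n)%N /\ forall x, O x -> phi (I i) x = x i) ->
  (i0 < n)%N -> (l <= j < d)%N -> O q -> deriv_at (phi i0) j q g -> g != 0 ->
  exists (c : (nat -> R) -> nat -> R) (O3 : pset) y0 r I3 r',
  [/\ 0 < r' /\ 0 < r, [/\ forall y, O3 y <-> ball d y0 r y, forall y, O3 y -> O (c y) &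
        forall y y', O3 y -> O3 y' -> (forall i, (i < d)%N -> c y i = c y' i) ->
          forall i, (i < d)%N -> y i = y' i],
      forall y i, O3 y -> (i < d)%N -> anat d y (fun y => c y i),
      forall i, (i < l.+1)%N -> (I3 i < n)%N /\ forall y, O3 y -> phi (I3 i) (c y) = y i &
      forall x, ball d q r' x -> exists2 y, O3 y & c y = x].
Proof.
move=> oO an hI i0n /andP[lj jd] Oq dg gn0.
have [e e0 he] := oO q Oq.
have [z [r [r' [r0 r'0 hz1 hz2]]]] := coord_change (an q Oq i0 i0n) jd dg gn0 e0.
have ld : (l < d)%N by exact: leq_ltn_trans jd.
pose y0 := upd q j (phi i0 q).
pose c y := upd (swp l j y) j (z (swp l j y)).
pose O3 : pset := ball d (swp l j y0) r.
have O3y y : O3 y -> ball d y0 r (swp l j y).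
  by move=> b; rewrite -(swpK l j y0); exact: ball_swp.
pose I3 i := if i == l then i0 else I i.
exists c, O3, (swp l j y0), r, I3, r'; split => //.
- split=> // [y /O3y/hz1[_ _] b|y y' Oy Oy' cc i id]; first exact: he.
  have [il|il] := eqVneq i l.
    have hy w : O3 w -> phi i0 (c w) = w l.
      move=> /O3y/hz1[_ E _]; rewrite /c E /swp; case: (eqVneq j l) => [->|jl] //.
      by rewrite eqxx.
    have Oc : O (c y) by apply: he; have [] := hz1 _ (O3y y Oy).
    have [e3 e30 he3] := anat_dep (an _ Oc i0 i0n).
    by rewrite il -!hy //; apply: he3 => //; exact: ball_center.
  pose i' := if i == j then l else i.
  have i'd : (i' < d)%N by rewrite /i'; case: ifP.
  have ci w : c w i' = w i.
    rewrite /c /upd /swp /i'; case: (eqVneq i j) => [ij|ij].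
      by rewrite -{1}ij eq_sym (negbTE il) eqxx ij.
    by rewrite (negbTE ij) (negbTE il).
  by have := cc i' i'd; rewrite !ci.
- move=> y i Oy id; have [az _ _] := hz1 _ (O3y y Oy).
  have asw k : (k < d)%N -> anat d y (fun y => swp l j y k).
    move=> kd; rewrite /swp; case: (k == l); first exact: anat_coord.
    by case: (k == j); exact: anat_coord.
  rewrite /c /upd; case: (i == j); last exact: asw.
  exact: (anat_comp (g := swp l j) az).
- move=> i; rewrite ltnS leq_eqVlt /I3 => /orP[/eqP->|il].
    rewrite eqxx; split=> // y Oy; have [_ E _] := hz1 _ (O3y y Oy).
    rewrite /c E /swp; case: (eqVneq j l) => [->|jl] //.
    by rewrite eqxx.
  have [h1 h2] := hI i il; rewrite (ltn_eqF il); split=> // y Oy.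
  rewrite h2; last by apply: he; have [] := hz1 _ (O3y y Oy).
  have ij : (i < j)%N by exact: leq_trans lj.
  by rewrite /c /upd /swp (ltn_eqF ij) (ltn_eqF il).
move=> x /hz2[b zx]; exists (swp l j (upd x j (phi i0 x))).
  by apply: ball_swp.
rewrite /c swpK zx; apply/funext => i; rewrite /upd.
by case: (eqVneq i j) => [->|].
Qed.

Lemma opn_ext n (O O' : pset) : (forall y, O y <-> O' y) -> opn n O -> opn n O'.
Proof.
move=> E h x /E/h[e e0 he]; exists e => // y /he; by rewrite E.
Qed.

(** Base case: if no component depends on the coordinates from [l] on, these can be frozen at [p],
    and the first [l] coordinates, which are themselves components of [phi], parametrise the image
    as a graph. *)
Lemma gpieces_const n d l p r phi I : 0 < r -> (l <= d)%N ->
  (forall x, ball d p r x -> forall i, (i < n)%N -> anat d x (phi i)) ->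
  (forall i, (i < l)%N -> (I i < n)%N /\ forall x, ball d p r x -> phi (I i) x = x i) ->
  (forall i j, (i < n)%N -> (l <= j < d)%N -> exists2 e, 0 < e &
     forall x v, ball d p e x -> `|v - p j| < e -> phi i (upd x j v) = phi i x) ->
  exists rho X, [/\ 0 < rho <= r, gpiece n l X &
    forall v, X v <-> exists x, ball d p rho x /\ img n phi x v].
Proof.
move=> r0 ld an hI hc.
pose s (u : nat -> R) : nat -> R := fun j => if (j < l)%N then u j else p j.
have pb : ball d p r p by exact: ball_center.
have [e1 e10 he1] : exists2 e, 0 < e & forall i, (i < n)%N -> forall e', 0 < e' <= e ->
    forall j, (l <= j < d)%N -> forall x v, ball d p e' x -> `|v - p j| < e' -> phi i (upd x j v) = phi i x.
  apply: unif_radius => i ni.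
  have [e e0 he] : exists2 e, 0 < e & forall j, (j < d)%N -> forall e', 0 < e' <= e ->
      (l <= j)%N -> forall x v, ball d p e' x -> `|v - p j| < e' -> phi i (upd x j v) = phi i x.
    apply: unif_radius => j jd; have [lj|jl] := leqP l j; last by exists 1.
    have ljd : (l <= j < d)%N by rewrite lj.
    have [e e0 he] := hc i j ni ljd; exists e => // e' /andP[_ le] _ x v b h.
    by apply: he; [exact: ball_le b | exact: lt_le_trans le].
  by exists e => // e' hle j /andP[lj jd]; exact: he.
pose psi i u := phi i (s u).
have aps u i : ball d p r (s u) -> (i < n)%N -> anat l u (psi i).
  move=> bs ni; apply: (anat_comp (g := s) (an _ bs i ni)) => k kd.
  rewrite /s; case: ltnP => kl; [exact: anat_coord | exact: anat_const].
have sp : s p = p by apply/funext => k; rewrite /s; case: ifP.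
have [e2 e20 he2] : exists2 e, 0 < e & forall i, (i < n)%N -> forall e', 0 < e' <= e ->
    (exists L, 0 <= L /\ forall x y s, 0 < s -> ball l p e' x -> ball l p e' y ->
    (forall i, (i < l)%N -> `|x i - y i| <= s) -> `|psi i x - psi i y| <= L * s).
  apply: unif_radius => i ni.
  have ap : anat l p (psi i) by apply: aps ni; rewrite sp.
  have [e [L [e0 L0 hL]]] := anat_lip ap; exists e => // e' /andP[_ le].
  exists L; split=> // x y t t0 bx by_; apply: hL => //; exact: ball_le le _.
have [e3 e30 he3] : exists2 e, 0 < e & forall i, (i < n)%N -> forall e', 0 < e' <= e ->
    forall x y, ball d p e' x -> (forall k, (k < d)%N -> x k = y k) -> phi i x = phi i y.
  apply: unif_radius => i ni; have [e e0 he] := anat_dep (an p pb i ni).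
  by exists e => // e' /andP[_ le] x y b; apply: he; exact: ball_le b.
pose rho := Num.min (Num.min r e1) (Num.min e2 e3).
have rho0 : 0 < rho by rewrite !lt_min r0 e10 e20.
have [rr r1 r2 r3] : [/\ rho <= r, rho <= e1, rho <= e2 & rho <= e3].
  by rewrite /rho; split; rewrite !ge_min lexx ?orbT.
clearbody rho.
have hr k : rho <= k -> 0 < rho <= k by move=> ->; rewrite rho0.
have sb u : ball l p rho u -> ball d p rho (s u).
  move=> b k kd; rewrite /s; case: ltnP => kl; first exact: b.
  by rewrite subrr normr0.
have phis x i : ball d p rho x -> (i < n)%N -> phi i x = psi i x.
  move=> bx ni.
  (* Independence is known for one coordinate at a time, so the coordinates from [l] on are moved to
     those of [p] one after another. *)
  pose tr m : nat -> R := fun k => if (l <= k < m)%N then p k else x k.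
  have trb m : ball d p rho (tr m).
    by move=> k kd; rewrite /tr; case: ifP => _; [rewrite subrr normr0 | exact: bx].
  have trE m : (m <= d)%N -> phi i (tr m) = phi i x.
    elim: m => [|m IH] md.
      by congr (phi i _); apply/funext => k; rewrite /tr ltn0 andbF.
    rewrite -(IH (ltnW md)); have [lm|ml] := leqP l m; last first.
      congr (phi i _); apply/funext => k; rewrite /tr.
      have [lk|//] := leqP l k; have mk := leq_trans ml lk.
      by rewrite ltnS leqNgt mk ltnNge (ltnW mk).
    have -> : tr m.+1 = upd (tr m) m (p m).
      apply/funext => k; rewrite /tr /upd ltnS [(k <= m)%N]leq_eqVlt.
      by case: (eqVneq k m) => [->|km] /=; rewrite ?lm ?andbT.
    apply: (he1 i ni rho (hr _ r1)); first by rewrite lm.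
      exact: trb.
    by rewrite subrr normr0.
  rewrite -(trE d) // /psi; apply: (he3 i ni rho (hr _ r3)); first exact: trb.
  by move=> k kd; rewrite /tr /s kd andbT; case: leqP.
have [L hL] : exists L, forall i, (i < n)%N -> forall x y s, 0 < s -> ball l p rho x -> ball l p rho y ->
    (forall i, (i < l)%N -> `|x i - y i| <= s) -> `|psi i x - psi i y| <= L * s.
  have : forall i, exists L, 0 <= L /\ ((i < n)%N -> forall x y s, 0 < s -> ball l p rho x -> ball l p rho y ->
    (forall i, (i < l)%N -> `|x i - y i| <= s) -> `|psi i x - psi i y| <= L * s).
    move=> i; have [ni|_] := ltnP i n; last by exists 0.
    have [L [L0 h]] := he2 i ni rho (hr _ r2); by exists L.
  move=> /choice[Lf hLf]; have [W W0 hW] := fin_bound n Lf.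
  exists W => i ni x y t t0 bx by_ h; have [Li0 hi] := hLf i.
  apply: le_trans (hi ni x y t t0 bx by_ h) _; rewrite ler_wpM2r ?(ltW t0) //.
  by apply: le_trans (hW i ni); exact: ler_norm.
have psib u : ball l p rho u -> ball d p r (s u).
  by move=> b; exact: ball_le rr (sb u b).
exists rho, (fun v => exists x, ball d p rho x /\ img n phi x v); split => //; first by rewrite rho0.
exists p, rho, psi, I, L; split => //.
- by move=> u b i; apply: aps; exact: psib.
- move=> i il; have [h1 h2] := hI i il; split=> // u b.
  by rewrite /psi h2 ?/s ?il //; exact: psib.
- by move=> u u' t t0 b b' h i ni; exact: hL.
move=> v; split=> [[x [bx im]]|[u [bu im]]].
  exists x; split; first exact: ball_dim bx.
  by move=> i ni; rewrite im // phis.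
by exists (s u); split; [exact: sb | move=> i ni; rewrite im].
Qed.

(** Either some derivative in a coordinate not yet straightened is a nonzero germ, or all of them
    vanish near [p] and [deriv0_indep] applies. *)
Lemma dichotomy n d l p r phi : 0 < r ->
  (forall x, ball d p r x -> forall i, (i < n)%N -> anat d x (phi i)) ->
  (exists i j g r1, [/\ (i < n)%N, (l <= j < d)%N, 0 < r1 <= r /\ nzgerm d p g &
      forall x, ball d p r1 x -> anat d x g /\ deriv_at (phi i) j x (g x)]) \/
  (forall i j, (i < n)%N -> (l <= j < d)%N -> exists2 e, 0 < e &
     forall x v, ball d p e x -> `|v - p j| < e -> phi i (upd x j v) = phi i x).
Proof.
move=> r0 an; have [h|h] := pselect (exists i j g r1, [/\ (i < n)%N, (l <= j < d)%N, 0 < r1 <= r /\ nzgerm d p g &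
      forall x, ball d p r1 x -> anat d x g /\ deriv_at (phi i) j x (g x)]); [by left | right].
move=> i j ni ljd; have jd : (j < d)%N by case/andP: ljd.
have pb : ball d p r p by exact: ball_center.
have [e [C [g [e0 hg]]]] := anat_deriv (an p pb i ni) jd.
have hnz : ~ nzgerm d p g.
  move=> nz; apply: h; exists i, j, g, (Num.min r e); split=> //.
    by split=> //; rewrite lt_min r0 e0 ge_min lexx.
  move=> x bx; have [|ag dg] := hg x; first by apply: ball_le bx; rewrite ge_min lexx orbT.
  by split=> //; exists C, e.
have [c c0 hc] : exists2 c, 0 < c & forall x, ball d p c x -> g x = 0.
  apply: contrapT => nex; apply: hnz => c c0; apply: contrapT => nx; apply: nex.
  exists c => // x bx; apply/eqP/negPn/negP => gx; apply: nx; by exists x.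
exists (Num.min c e); first by rewrite lt_min c0.
have m0 : 0 < Num.min c e by rewrite lt_min c0.
apply: (deriv0_indep (C := C) m0 jd) => x bx h'.
rewrite le_min => /andP[_ h'e].
have [|_ /(_ h' h'e)] := hg x; first by apply: ball_le bx; rewrite ge_min lexx orbT.
rewrite hc ?mul0r ?subr0 //; apply: ball_le bx; by rewrite ge_min lexx.
Qed.

Lemma not_nzgerm n p f : ~ nzgerm n p f -> exists2 c, 0 < c & forall x, ball n p c x -> f x = 0.
Proof.
move=> hnz; apply: contrapT => nex; apply: hnz => c c0; apply: contrapT => nx; apply: nex.
exists c => // x bx; apply/eqP/negPn/negP => gx; apply: nx; by exists x.
Qed.

(** Inner induction on the number [k] of coordinates not yet straightened, inside an induction on
    [d]. If [f] is a nonzero germ, its zero set has charts with one variable fewer. If [f] vanishes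
    near [p], either [gpieces_const] concludes, or some derivative [g] is a nonzero germ: where [g]
    is nonzero a further coordinate is straightened, and the zeros of [g] have charts with one
    variable fewer. *)
Lemma pieces_step n d l : (forall d', d = d'.+1 -> @pieces_dim R n d') ->
  forall k, (l + k)%N = d -> forall (O : pset) f phi I, opn d O ->
  (forall x, O x -> anat d x f /\ forall i, (i < n)%N -> anat d x (phi i)) ->
  (forall i, (i < l)%N -> (I i < n)%N /\ forall x, O x -> phi (I i) x = x i) ->
  gpieces n (fun v => exists x, (O x /\ f x = 0) /\ img n phi x v).
Proof.
move=> IH k; elim: k l => [|k IHk] l lk O f phi I oO an hI.
all: have ld : (l <= d)%N by rewrite -lk leq_addr.
all: apply: (@cunion_local R d) => p [Op fp].
all: have [r r0 hr] := oO p Op.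
all: have [af aphi] := an p Op.
all: have anb x : ball d p r x -> forall i, (i < n)%N -> anat d x (phi i) by move=> /hr/an[].
all: have [nz|/not_nzgerm[c c0 hc]] := pselect (nzgerm d p f).
1,3: destruct d as [|d'].
1,3: by have [x _] := nz 1 ltr01; have [e e0 he] := anat_dep af;
    rewrite -(he p x) ?fp ?eqxx //; exact: ball_center.
1,2: have anr x : ball d'.+1 p r x -> [/\ anat d'.+1 x f, anat d'.+1 x f &
       forall i, (i < n)%N -> anat d'.+1 x (phi i)] by move=> /hr/an[].
1,2: have [rho [Y [rho0 hY h1 h2]]] := zero_set_charts (IH d' erefl) r0 anr nz.
1,2: exists rho, Y; split => //;
    [ by move=> v /h1[x [bx fx _ im]]; exists x; split=> //; split=> //; exact: hr
    | by move=> x v [Ox fx] bx im; exact: h2 im].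
- pose m := Num.min r c.
  have m0 : 0 < m by rewrite lt_min r0.
  have [mr mc] : m <= r /\ m <= c by rewrite /m; split; rewrite ge_min lexx ?orbT.
  clearbody m.
  have [||i j|rho [X [/andP[rho0 rhom] hX XE]]] := @gpieces_const n d l p m phi I m0 ld.
  + by move=> x b; apply: anb; exact: ball_le b.
  + move=> i il; have [h1 h2] := hI i il; split=> // x b; apply: h2; apply: hr; exact: ball_le b.
  + by move=> _ /andP[]; rewrite -lk addn0 => /leq_ltn_trans h /h; rewrite ltnn.
  exists rho, X; split => //.
  + by apply: cunion1; exists l.
  + move=> v /XE[x [bx im]]; exists x; split=> //; split; last by apply: hc; apply: ball_le bx; lra.
    by apply: hr; apply: ball_le bx; lra.
  + by move=> x v _ bx im; apply/XE; exists x.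
pose m := Num.min r c.
have m0 : 0 < m by rewrite lt_min r0.
have [mr mc] : m <= r /\ m <= c by rewrite /m; split; rewrite ge_min lexx ?orbT.
clearbody m.
have anm x : ball d p m x -> forall i, (i < n)%N -> anat d x (phi i).
  by move=> b; apply: anb; exact: ball_le b.
have hIm i : (i < l)%N -> (I i < n)%N /\ forall x, ball d p m x -> phi (I i) x = x i.
  by move=> il; have [h1 h2] := hI i il; split=> // x b; apply: h2; apply: hr; exact: ball_le b.
have inO x : ball d p m x -> O x /\ f x = 0.
  by move=> b; split; [apply: hr; exact: ball_le b | apply: hc; exact: ball_le b].
have [[i0 [j [g [r1 [i0n ljd [/andP[r10 r1m] nzg] hg]]]]]|hcst] := @dichotomy n d l p m phi m0 anm.
  pose O2 : pset := fun x => ball d p r1 x /\ g x != 0.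
  have oO2 : opn d O2.
    move=> x [bx gx]; have [e e0 he] := ball_open bx.
    have [e' e'0 he'] := anat_sign (proj1 (hg x bx)) gx.
    exists (Num.min e e'); first by rewrite lt_min e0.
    move=> y by_; split; first by apply: he; apply: ball_le by_; rewrite ge_min lexx.
    have := he' y (ball_le _ by_); rewrite ge_min lexx orbT => /(_ isT).
    by apply: contraTneq => ->; rewrite mulr0 ltxx.
  have O2m x : O2 x -> ball d p m x by move=> [bx _]; exact: ball_le bx.
  have anO2 x : O2 x -> forall i, (i < n)%N -> anat d x (phi i) by move=> /O2m/anm.
  have hIO2 i : (i < l)%N -> (I i < n)%N /\ forall x, O2 x -> phi (I i) x = x i.
    by move=> il; have [h1 h2] := hIm i il; split=> // x /O2m/h2.
  have hY2 : gpieces n (fun v => exists x, O2 x /\ img n phi x v).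
    apply: (@cunion_local R d) => q O2q.
    have [bq gq] := O2q; have [_ dq] := hg q bq.
    have [ch [O3 [y0 [r3 [I3 [r' [[r'0 r30] [O3E O3c O3i] ach hI3 hsurj]]]]]]] :=
      straighten oO2 anO2 hIO2 i0n ljd O2q dq gq.
    exists r', (fun v => exists y, (O3 y /\ (0 : R) = 0) /\ img n (fun i y => phi i (ch y)) y v).
    split=> //.
    - apply: (IHk l.+1 _ O3 (fun=> 0) (fun i y => phi i (ch y)) I3).
      + by rewrite addSnnS.
      + by apply: opn_ext (ball_opn (n := d) (p := y0) (d := r3)) => y; rewrite O3E.
      + move=> y Oy; split; first exact: anat_const.
        move=> i ni; apply: (anat_comp (g := ch) (anO2 _ (O3c y Oy) i ni)) => k' k'd.
        exact: ach.
      + exact: hI3.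
    - by move=> v [y [[Oy _] im]]; exists (ch y); split=> //; exact: O3c.
    - move=> x v _ bx im; have [y Oy E] := hsurj x bx; exists y; split=> // i ni.
      by rewrite E; exact: im.
  destruct d as [|d'']; first by case/andP: ljd.
  have anr x : ball d''.+1 p r1 x -> [/\ anat d''.+1 x g, anat d''.+1 x (fun=> 0) &
       forall i, (i < n)%N -> anat d''.+1 x (phi i)].
    move=> b; split; [by have [] := hg x b | exact: anat_const |].
    by apply: anm; exact: ball_le b.
  have [rho [Y [rho0 hY h1 h2]]] := zero_set_charts (IH d'' erefl) r10 anr nzg.
  have q0 : 0 < Num.min rho r1 by rewrite lt_min rho0.
  exists (Num.min rho r1), (fun v => Y v \/ exists x, O2 x /\ img n phi x v); split=> //.
  - exact: cunionU.
  - move=> v [/h1[x [bx gx _ im]]|[x [O2x im]]]; exists x; split=> //; apply: inO.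
      exact: ball_le bx.
    exact: O2m.
  - move=> x v _ bx im.
    have bx1 : ball d''.+1 p r1 x by apply: ball_le bx; rewrite ge_min lexx orbT.
    have [gx|gx] := eqVneq (g x) 0; last by right; exists x.
    by left; apply: (h2 x) => //; apply: ball_le bx; rewrite ge_min lexx.
have [rho [X [/andP[rho0 rhom] hX XE]]] := @gpieces_const n d l p m phi I m0 ld anm hIm hcst.
exists rho, X; split => //.
- by apply: cunion1; exists l.
- move=> v /XE[x [bx im]]; exists x; split=> //; apply: inO; exact: ball_le bx.
- by move=> x v _ bx im; apply/XE; exists x.
Qed.

Lemma pieces n d : @pieces_dim R n d.
Proof.
elim: d => [|d IH] O f phi oO an.
  by apply: (@pieces_step n 0 0 _ 0 _ O f phi (fun=> 0%N)).
by apply: (@pieces_step n d.+1 0 _ d.+1 _ O f phi (fun=> 0%N)) => // d' [<-].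
Qed.

(** Only one piece is wanted, so the centre may be moved to a point where the derivative is nonzero.
    Injectivity excludes stopping before all [d] coordinates are straightened: moving the coordinate
    [l] alone would not change [phi]. *)
Lemma injective_piece n d l : forall k, (l + k)%N = d -> forall p r phi I, 0 < r ->
  (forall x, ball d p r x -> forall i, (i < n)%N -> anat d x (phi i)) ->
  (forall i, (i < l)%N -> (I i < n)%N /\ forall x, ball d p r x -> phi (I i) x = x i) ->
  (forall x y, ball d p r x -> ball d p r y -> (forall i, (i < n)%N -> phi i x = phi i y) ->
     forall i, (i < d)%N -> x i = y i) ->
  exists X, gpiece n d X /\ forall v, X v -> exists x, ball d p r x /\ img n phi x v.
Proof.
move=> k; elim: k l => [|k IHk] l lk p r phi I r0 an hI inj.
all: have ld : (l <= d)%N by rewrite -lk leq_addr.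
  have [i j|rho [X [/andP[rho0 rhor] hX XE]]] := @gpieces_const n d l p r phi I r0 ld an hI.
    by move=> _ /andP[]; rewrite -lk addn0 => /leq_ltn_trans h /h; rewrite ltnn.
  exists X; split; first by rewrite -lk addn0.
  by move=> v /XE[x [bx im]]; exists x; split=> //; exact: ball_le bx.
have [[i0 [j [g [r1 [i0n ljd [/andP[r10 r1r] nzg] hg]]]]]|hcst] := @dichotomy n d l p r phi r0 an.
  have [q bq gq] := nzg r1 r10.
  have [_ dq] := hg q bq.
  have bqr : ball d p r q by exact: ball_le bq.
  have [ch [O3 [y0 [r3 [I3 [r' [[r'0 r30] [O3E O3c O3i] ach hI3 hsurj]]]]]]] :=
      straighten (ball_opn (n := d) (p := p) (d := r)) an hI i0n ljd bqr dq gq.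
  have O3b y : ball d y0 r3 y -> O3 y by move=> /O3E.
  have lk' : (l.+1 + k)%N = d by rewrite addSnnS.
  have [|||X [hX XE]] := IHk l.+1 lk' y0 r3 (fun i y => phi i (ch y)) I3 r30.
  - move=> y /O3b Oy i ni; apply: (anat_comp (g := ch) (an _ (O3c y Oy) i ni)) => k' k'd.
    exact: ach.
  - by move=> i il; have [h1 h2] := hI3 i il; split=> // y /O3b/h2.
  - move=> y y' /O3b Oy /O3b Oy' pp; apply: O3i => //.
    exact: inj (O3c y Oy) (O3c y' Oy') pp.
  - by exists X; split=> // v /XE[y [/O3b Oy im]]; exists (ch y); split=> //; exact: O3c.
have ld' : (l < d)%N by rewrite -lk addnS ltnS leq_addr.
have lld : (l <= l < d)%N by rewrite leqnn.
have [e e0 he] : exists2 e, 0 < e & forall i, (i < n)%N -> forall e', 0 < e' <= e ->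
   forall x v, ball d p e' x -> `|v - p l| < e' -> phi i (upd x l v) = phi i x.
  apply: unif_radius => i ni; have [e e0 he] := hcst i l ni lld; exists e => // e' /andP[_ le] x v b h.
  by apply: he; [exact: ball_le b | exact: lt_le_trans le].
pose m := Num.min e r.
have m0 : 0 < m by rewrite lt_min e0.
have [me mr] : m <= e /\ m <= r by rewrite /m; split; rewrite ge_min lexx ?orbT.
have b2 : ball d p m (upd p l (p l + m / 2)).
  move=> i id; rewrite /upd; case: (eqVneq i l) => [->|_]; last by rewrite subrr normr0.
  by rewrite addrC addKr gtr0_norm; lra.
have := inj (upd p l (p l + m / 2)) p (ball_le mr b2) (@ball_center _ _ _ _ r0).
move=> /(_ _ l ld'); rewrite /upd eqxx => H.
have : p l + m / 2 = p l; last lra.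
apply: H => i ni; apply: (he i ni m); [by rewrite m0 | exact: ball_center |].
by rewrite addrC addKr gtr0_norm; lra.
Qed.

End Straighten.

(** * Quantifier elimination over analytic coefficients *)

Section SignDetermined.
Import ordered_qelim qe_rcf.
Variable R : realType.
Implicit Types (p q x y : nat -> R) (f : (nat -> R) -> R).
Local Notation pset := ((nat -> R) -> Prop).
Implicit Types (D X Y : pset).

Definition signs s (F : nat -> (nat -> R) -> R) x : seq R :=
  mkseq (fun k => Num.sg (F k x)) s.

(* The trace of [X] on [D] depends only on the signs of finitely many analytic
   functions: a semianalytic set, with one description valid on all of [D]. *)
Definition SA D n X := exists s (F : nat -> (nat -> R) -> R) (chi : seq R -> Prop),
  (forall x, D x -> forall k, (k < s)%N -> anat n x (F k)) /\
  forall x, D x -> (X x <-> chi (signs s F x)).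

Lemma SA_ext D n X Y : (forall x, D x -> (X x <-> Y x)) -> SA D n X -> SA D n Y.
Proof.
move=> XY [s [F [chi [h1 h2]]]]; exists s, F, chi; split=> // x Dx.
by rewrite -XY // h2.
Qed.

Lemma SA_sub D D' n X : (forall x, D' x -> D x) -> SA D n X -> SA D' n X.
Proof.
move=> sub [s [F [chi [h1 h2]]]]; exists s, F, chi; split=> x /sub; [exact: h1|exact: h2].
Qed.

Lemma SA_not D n X : SA D n X -> SA D n (fun x => ~ X x).
Proof.
move=> [s [F [chi [h1 h2]]]]; exists s, F, (fun v => ~ chi v); split=> // x Dx.
by rewrite h2.
Qed.

Lemma SA_and D n X Y : SA D n X -> SA D n Y -> SA D n (fun x => X x /\ Y x).
Proof.
move=> [s [F [chi [h1 h2]]]] [s' [F' [chi' [h1' h2']]]].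
exists (s + s')%N, (fun k => if (k < s)%N then F k else F' (k - s)%N),
  (fun v => chi (take s v) /\ chi' (drop s v)); split.
  move=> x Dx k; case: (ltnP k s) => ks kss; first exact: h1.
  by apply: h1' => //; rewrite ltn_subLR.
move=> x Dx; rewrite h2 // h2' //.
have -> : signs (s + s') (fun k => if (k < s)%N then F k else F' (k - s)%N) x =
   signs s F x ++ signs s' F' x.
  rewrite /signs /mkseq iotaD map_cat; congr (_ ++ _).
    by apply/eq_in_map => k; rewrite mem_iota add0n /= => ->.
  rewrite add0n -[s in iota s s']addn0 iotaDl -map_comp; apply: eq_map => k /=.
  by rewrite ltnNge leq_addr /= addKn.
by rewrite take_size_cat ?drop_size_cat // size_mkseq.
Qed.

Lemma SA_or D n X Y : SA D n X -> SA D n Y -> SA D n (fun x => X x \/ Y x).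
Proof.
move=> hX hY; have := SA_not (SA_and (SA_not hX) (SA_not hY)).
apply: SA_ext => x _; split=> [h|[h|h] [h1 h2] //].
by have [Xx|nX] := pselect (X x); [left | right; apply: contrapT => nY; apply: h].
Qed.

Lemma SA_const D n (c : Prop) : SA D n (fun=> c).
Proof. by exists 0%N, (fun _ _ => 0), (fun=> c). Qed.

Lemma SA_pos D n f : (forall x, D x -> anat n x f) -> SA D n (fun x => 0 < f x).
Proof.
move=> h; exists 1%N, (fun=> f), (fun v => nth 0 v 0 = 1); split=> [x Dx _ _|x _]; first exact: h.
by rewrite /=; split=> [/gtr0_sg//|/eqP]; rewrite sgr_cp0.
Qed.

Lemma SA_eq0 D n f : (forall x, D x -> anat n x f) -> SA D n (fun x => f x = 0).
Proof.
move=> h; exists 1%N, (fun=> f), (fun v => nth 0 v 0 = 0); split=> [x Dx _ _|x _]; first exact: h.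
by rewrite /=; split=> [->|/eqP]; rewrite ?sgr0 // sgr_eq0 => /eqP.
Qed.

Lemma SA_comp D D' n k (g : (nat -> R) -> nat -> R) X : SA D n X ->
  (forall x, D' x -> D (g x) /\ forall i, (i < n)%N -> anat k x (fun x => g x i)) ->
  SA D' k (fun x => X (g x)).
Proof.
move=> [s [F [chi [h1 h2]]]] hg; exists s, (fun k x => F k (g x)), chi; split.
  move=> x /hg[Dg ag] j js; exact: anat_comp (h1 _ Dg j js) ag.
by move=> x /hg[Dg _]; rewrite h2.
Qed.

Section Tarski.
Variables (D : pset) (n N : nat) (c : nat -> (nat -> R) -> R).
Hypothesis ac : forall x, D x -> forall k, (k < N)%N -> anat n x (c k).
Let env x := mkseq (fun k => c k x) N.

Lemma anat_eval (t : GRing.term R) x : D x -> GRing.rterm t ->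
  anat n x (fun x => GRing.eval (env x) t).
Proof.
move=> Dx; elim: t => //=.
- move=> i _; have [iN|Ni] := ltnP i N.
    have -> : (fun x => (env x)`_i) = c i by apply/funext => y; rewrite nth_mkseq.
    exact: ac.
  have -> : (fun x => (env x)`_i) = fun=> 0.
    by apply/funext => y; rewrite nth_default // size_mkseq.
  exact: anat_const.
- by move=> a _; exact: anat_const.
- by move=> a _; exact: anat_const.
- by move=> t1 h1 t2 h2 /andP[/h1 + /h2]; exact: anat_add.
- by move=> t h /h; exact: anat_opp.
- by move=> t h k /h; exact: anat_muln.
- by move=> t1 h1 t2 h2 /andP[/h1 + /h2]; exact: anat_mul.
- by move=> t h k /h; exact: anat_exp.
Qed.

Lemma SA_qf (phi : ord.formula R) : ord.qf_form phi && ord.rformula phi ->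
  SA D n (fun x => ord.qf_eval (env x) phi).
Proof.
elim: phi => //=.
- by move=> b _; exact: SA_const.
- move=> t1 t2 /andP[r1 r2]; apply: (@SA_ext _ _ (fun x => GRing.eval (env x) t1 - GRing.eval (env x) t2 = 0)).
    by move=> x _; split=> [/eqP|/eqP->]; rewrite ?subrr // subr_eq0.
  by apply: SA_eq0 => x Dx; apply: anat_sub; exact: anat_eval.
- move=> t1 t2 /andP[r1 r2]; apply: (@SA_ext _ _ (fun x => 0 < GRing.eval (env x) t2 - GRing.eval (env x) t1)).
    by move=> x _; rewrite subr_gt0.
  by apply: SA_pos => x Dx; apply: anat_sub; exact: anat_eval.
- move=> t1 t2 /andP[r1 r2]; apply: (@SA_ext _ _ (fun x => ~ 0 < GRing.eval (env x) t1 - GRing.eval (env x) t2)).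
    by move=> x _; rewrite subr_gt0 leNgt; split=> /negP.
  by apply: SA_not; apply: SA_pos => x Dx; apply: anat_sub; exact: anat_eval.
- move=> f1 h1 f2 h2; rewrite andbACA => /andP[/h1 k1 /h2 k2].
  by apply: SA_ext (SA_and k1 k2) => x _; split=> [[-> ->]|/andP].
- move=> f1 h1 f2 h2; rewrite andbACA => /andP[/h1 k1 /h2 k2].
  by apply: SA_ext (SA_or k1 k2) => x _; split=> /orP.
- move=> f1 h1 f2 h2; rewrite andbACA => /andP[/h1 k1 /h2 k2].
  apply: SA_ext (SA_or (SA_not k1) k2) => x _; split=> [[/negP/negbTE->|->]|]; rewrite ?implybT //.
  by move=> /implyP h; have [f1x|nf] := boolP (ord.qf_eval (env x) f1); [right; exact: h | left; exact/negP].
- move=> f1 h1 /h1 k1; apply: SA_ext (SA_not k1) => x _.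
  by split=> /negP.
Qed.

(* Tarski: a first-order condition on the values of analytic functions is sign-determined. *)
Lemma SA_holds (phi : ord.formula R) : SA D n (fun x => ord.holds (env x) phi).
Proof.
pose psi := ord.quantifier_elim (@wproj R) (ord.to_rform phi).
have wf : ord.qf_form psi && ord.rformula psi.
  by apply: ord.quantifier_elim_wf; [exact: wf_QE_wproj | exact: ord.to_rform_rformula].
apply: SA_ext (SA_qf wf) => x _.
by split=> [h|/rcf_satP]; [apply/rcf_satP|].
Qed.

End Tarski.

(** Closure rules for this predicate spare writing formulas by hand. *)
Definition dfn (P : seq R -> Prop) := exists phi : ord.formula R, forall e, P e <-> ord.holds e phi.

Lemma dfn_and P Q : dfn P -> dfn Q -> dfn (fun e => P e /\ Q e).
Proof. by move=> [f hf] [g hg]; exists (ord.And f g) => e; rewrite hf hg. Qed.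

Lemma dfn_or P Q : dfn P -> dfn Q -> dfn (fun e => P e \/ Q e).
Proof. by move=> [f hf] [g hg]; exists (ord.Or f g) => e; rewrite hf hg. Qed.

Lemma dfn_not P : dfn P -> dfn (fun e => ~ P e).
Proof. by move=> [f hf]; exists (ord.Not f) => e; rewrite hf. Qed.

Lemma dfn_ex P i : dfn P -> dfn (fun e => exists z, P (set_nth 0 e i z)).
Proof.
by move=> [f hf]; exists (ord.Exists i f) => e /=; split=> -[z /hf h]; exists z.
Qed.

Lemma dfn_const (c : Prop) : dfn (fun=> c).
Proof.
have [h|h] := pselect c; [exists (ord.Bool true)|exists (ord.Bool false)] => e /=; split=> //.
Qed.

Lemma dfn_lt (t1 t2 : GRing.term R) : dfn (fun e => GRing.eval e t1 < GRing.eval e t2).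
Proof. by exists (ord.Lt t1 t2) => e. Qed.

Lemma dfn_le (t1 t2 : GRing.term R) : dfn (fun e => GRing.eval e t1 <= GRing.eval e t2).
Proof. by exists (ord.Le t1 t2) => e. Qed.

Lemma dfn_eq (t1 t2 : GRing.term R) : dfn (fun e => GRing.eval e t1 = GRing.eval e t2).
Proof. by exists (ord.Equal t1 t2) => e. Qed.

Lemma dfn_ext P Q : (forall e, P e <-> Q e) -> dfn P -> dfn Q.
Proof. by move=> PQ [f hf]; exists f => e; rewrite -PQ. Qed.

(** An arbitrary condition [chi] on a sign vector is definable because there are finitely many
    vectors; the induction splits on the last sign. *)
Lemma dfn_signs s (t : nat -> GRing.term R) (chi : seq R -> Prop) :
  dfn (fun e => chi (mkseq (fun k => Num.sg (GRing.eval e (t k))) s)).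
Proof.
elim: s chi => [|s IH] chi; first exact: (dfn_const (chi [::])).
pose z : GRing.term R := GRing.NatConst R 0.
apply: (@dfn_ext (fun e => ((GRing.eval e z < GRing.eval e (t s) /\
     chi (rcons (mkseq (fun k => Num.sg (GRing.eval e (t k))) s) 1)) \/
   (GRing.eval e (t s) < GRing.eval e z /\
     chi (rcons (mkseq (fun k => Num.sg (GRing.eval e (t k))) s) (-1)))) \/
   (GRing.eval e (t s) = GRing.eval e z /\
     chi (rcons (mkseq (fun k => Num.sg (GRing.eval e (t k))) s) 0)))); last first.
  apply: dfn_or; [apply: dfn_or|]; apply: dfn_and.
  - exact: dfn_lt.
  - exact: (IH (fun v => chi (rcons v 1))).
  - exact: dfn_lt.
  - exact: (IH (fun v => chi (rcons v (-1)))).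
  - exact: dfn_eq.
  - exact: (IH (fun v => chi (rcons v 0))).
move=> e; have -> : mkseq (fun k => Num.sg (GRing.eval e (t k))) s.+1 =
  rcons (mkseq (fun k => Num.sg (GRing.eval e (t k))) s) (Num.sg (GRing.eval e (t s))).
  by rewrite /mkseq -addn1 iotaD map_cat cats1.
rewrite /z /=; split=> [[[[/gtr0_sg->]|[/ltr0_sg->]]|[-> ]]|]; rewrite ?sgr0 //.
by case: sgrP => h; [right|left;left|left;right].
Qed.

Section PolyElim.
Variables (D : pset) (n s B : nat) (cf : nat -> nat -> (nat -> R) -> R).
Hypothesis acf : forall x, D x -> forall i j, (i < s)%N -> anat n x (cf i j).

Definition pev i x z := \sum_(j < B) cf i j x * z ^+ j.

Let N := (s * B)%N.
Let c k := cf (k %/ B) (k %% B).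
Let env x := mkseq (fun k => c k x) N.

Let ac x : D x -> forall k, (k < N)%N -> anat n x (c k).
Proof.
move=> Dx k kN; apply: acf => //; rewrite ltn_divLR //.
by have [B0|//] := posnP B; move: kN; rewrite /N B0 muln0.
Qed.

(** The coefficient [j] of the polynomial [i] is the variable [i * B + j] of the environment. The
    variables [N] and [N.+1], the first ones past the coefficients, are quantified over. *)
Fixpoint polyT (i m v : nat) : GRing.term R :=
  if m is m'.+1 then GRing.Add (polyT i m' v)
    (GRing.Mul (GRing.Var R (i * B + m')) (GRing.Exp (GRing.Var R v) m'))
  else GRing.NatConst R 0.

Lemma polyTE i v e x : (i < s)%N -> (forall k, (k < N)%N -> e`_k = c k x) ->
  GRing.eval e (polyT i B v) = pev i x e`_v.
Proof.
move=> is_ he; rewrite /pev; suff H m : (m <= B)%N -> GRing.eval e (polyT i m v) = \sum_(j < m) cf i j x * e`_v ^+ j.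
  exact: H.
elim: m => [|m IH] mB /=; first by rewrite big_ord0.
rewrite big_ord_recr /= IH 1?ltnW // (he (i * B + m)%N); last first.
  have : (i.+1 * B <= s * B)%N by rewrite leq_mul2r is_ orbT.
  by apply: leq_trans; rewrite mulSn addnC ltn_add2r.
rewrite /c divnMDl ?(leq_ltn_trans _ mB) // divn_small // addn0.
by rewrite modnMDl modn_small.
Qed.

Lemma SA_dfn P : dfn P -> SA D n (fun x => P (env x)).
Proof.
move=> [phi h]; apply: SA_ext (SA_holds ac phi) => x _; by rewrite h.
Qed.

Lemma env_set x z k : (k < N)%N -> (set_nth 0 (env x) N z)`_k = c k x.
Proof. by move=> kN; rewrite nth_set_nth /= ltn_eqF // nth_mkseq. Qed.

Lemma env_set2 x z z' k : (k < N)%N -> (set_nth 0 (set_nth 0 (env x) N z) N.+1 z')`_k = c k x.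
Proof. by move=> kN; rewrite nth_set_nth /= ltn_eqF ?env_set // ltnW. Qed.

(** Elimination of the last variable: for polynomials in [z] with analytic coefficients, the
    existence of a height with prescribed signs is again a sign condition on analytic functions of
    the other variables. *)
Lemma SA_exists_root a b (chi : seq R -> Prop) :
  SA D n (fun x => exists z, a < z < b /\ chi (mkseq (fun i => Num.sg (pev i x z)) s)).
Proof.
pose P e := exists z, ((GRing.eval (set_nth 0 e N z) (GRing.Const a) < GRing.eval (set_nth 0 e N z) (GRing.Var R N) /\
   GRing.eval (set_nth 0 e N z) (GRing.Var R N) < GRing.eval (set_nth 0 e N z) (GRing.Const b)) /\
   chi (mkseq (fun k => Num.sg (GRing.eval (set_nth 0 e N z) (polyT k B N))) s)).
have dP : dfn P.
  apply: (dfn_ex (P := fun e => ((GRing.eval e (GRing.Const a) < GRing.eval e (GRing.Var R N) /\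
   GRing.eval e (GRing.Var R N) < GRing.eval e (GRing.Const b)) /\
   chi (mkseq (fun k => Num.sg (GRing.eval e (polyT k B N))) s)))).
  apply: dfn_and; first by apply: dfn_and; exact: dfn_lt.
  exact: dfn_signs.
apply: SA_ext (SA_dfn dP) => x _; rewrite /P.
have E z : mkseq (fun k => Num.sg (GRing.eval (set_nth 0 (env x) N z) (polyT k B N))) s =
    mkseq (fun i => Num.sg (pev i x z)) s.
  apply/eq_in_map => k; rewrite mem_iota add0n => /= ks.
  by rewrite (polyTE _ ks (env_set _ _)) nth_set_nth /= eqxx.
have Ez z : (set_nth 0 (env x) N z)`_N = z by rewrite nth_set_nth /= eqxx.
split=> -[z].
  by rewrite /= Ez E => -[h1 h2]; exists z; split=> //; apply/andP.
by move=> [/andP h1 h2]; exists z; rewrite /= Ez E.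
Qed.

Lemma SA_unique_root a b :
  SA D n (fun x => forall z z', a <= z <= b -> a <= z' <= b ->
    forall i j, (i < s)%N -> (j < s)%N -> pev i x z = 0 -> pev j x z' = 0 -> z = z').
Proof.
pose chi (v : seq R) := 0 \in v.
pose rng e v := GRing.eval e (GRing.Const a) <= GRing.eval e (GRing.Var R v) /\
   GRing.eval e (GRing.Var R v) <= GRing.eval e (GRing.Const b).
pose rt e v := chi (mkseq (fun k => Num.sg (GRing.eval e (polyT k B v))) s).
pose P1 e := (rng e N /\ rng e N.+1) /\ ((rt e N /\ rt e N.+1) /\
  ~ (GRing.eval e (GRing.Var R N) = GRing.eval e (GRing.Var R N.+1))).
have dP1 : dfn P1.
  apply: dfn_and; first by apply: dfn_and; apply: dfn_and; exact: dfn_le.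
  apply: dfn_and; first by apply: dfn_and; [exact: (dfn_signs s (fun k => polyT k B N) chi) | exact: (dfn_signs s (fun k => polyT k B N.+1) chi)].
  by apply: dfn_not; exact: dfn_eq.
have dP := dfn_not (dfn_ex N (dfn_ex N.+1 dP1)).
apply: SA_ext (SA_dfn dP) => x _.
have E z z' v : mkseq (fun k => Num.sg (GRing.eval (set_nth 0 (set_nth 0 (env x) N z) N.+1 z') (polyT k B v))) s =
    mkseq (fun i => Num.sg (pev i x (set_nth 0 (set_nth 0 (env x) N z) N.+1 z')`_v)) s.
  apply/eq_in_map => k; rewrite mem_iota add0n => /= ks.
  by rewrite (polyTE _ ks (env_set2 _ _ _)).
have v1 z z' : (set_nth 0 (set_nth 0 (env x) N z) N.+1 z')`_N = z.
  by rewrite nth_set_nth /= ltn_eqF // nth_set_nth /= eqxx.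
have v2 z z' : (set_nth 0 (set_nth 0 (env x) N z) N.+1 z')`_N.+1 = z'.
  by rewrite nth_set_nth /= eqxx.
have chiE z : chi (mkseq (fun i => Num.sg (pev i x z)) s) <-> exists2 i, (i < s)%N & pev i x z = 0.
  rewrite /chi; split=> [/mapP[i]|[i is_ h]].
    by rewrite mem_iota add0n => is_ /esym/eqP; rewrite sgr_eq0 => /eqP h; exists i.
  by apply/mapP; exists i; rewrite ?mem_iota // h sgr0.
split.
  move=> h z z' hz hz' i j is_ js hi hj; apply: contrapT => zz'; apply: h.
  exists z, z'; rewrite /P1 /rng /rt !E /= !v1 !v2.
  split; first by split; apply/andP.
  by split=> //; split; apply/chiE; [exists i|exists j].
move=> h [z [z']]; rewrite /P1 /rng /rt !E /= !v1 !v2.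
move=> [[/andP hz /andP hz'] [[/chiE[i is_ hi] /chiE[j js hj]] zz']].
by apply: zz'; exact: (h _ _ hz hz' i j).
Qed.

End PolyElim.
End SignDetermined.

(** * Countable unions of analytic images of analytic sets *)

Section SigmaAnalytic.
Variable R : realType.
Implicit Types (p q x y : nat -> R) (f : (nat -> R) -> R).
Local Notation pset := ((nat -> R) -> Prop).
Implicit Types (D X Y : pset).

(** A single equation is enough, since several can be merged into a sum of squares. *)
Definition bas n X := exists d (O : pset) f phi, [/\ opn d O,
  forall x, O x -> anat d x f /\ forall i, (i < n)%N -> anat d x (phi i) &
  forall v, X v <-> exists x, (O x /\ f x = 0) /\ img n phi x v].

(* This class replaces that of subanalytic sets: it needs no finiteness. *)
Definition Sig n := cunion (bas n).

Lemma Sig_ext n X Y : (forall v, X v <-> Y v) -> Sig n X -> Sig n Y.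
Proof. exact: cunion_ext. Qed.

Lemma cunion_map P Q (T : pset -> pset) :
  (forall X, P X -> cunion Q (T X)) -> (forall X, (forall v, ~ X v) -> forall v, ~ T X v) ->
  (forall (Y : nat -> pset) v, T (fun v => exists k, Y k v) v <-> exists k, T (Y k) v) ->
  (forall X Y, (forall v, X v <-> Y v) -> forall v, T X v <-> T Y v) ->
  forall X, cunion P X -> cunion Q (T X).
Proof.
move=> h1 h2 h3 h4 X [Xk [hX XE]].
have := @cunion_count R nat Q (fun k => T (Xk k)); move=> /(_ _) h.
apply: cunion_ext (h _) => [v|k]; first by rewrite -h3; apply: h4 => w; rewrite XE.
by have [/h1//|/h2 hn] := hX k; exact: cunion0.
Qed.

Lemma Sig_pieces n X : Sig n X -> gpieces n X.
Proof.
apply: (@cunion_map _ _ (fun X => X)) => // {}X [d [O [f [phi [oO an XE]]]]].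
by apply: cunion_ext (pieces oO an) => v; rewrite XE.
Qed.

Lemma opn_dep n (O : pset) x y : opn n O -> O x -> (forall i, (i < n)%N -> x i = y i) -> O y.
Proof. by move=> oO /oO[e e0 h] xy; apply: h => i ni; rewrite xy // subrr normr0. Qed.

Lemma opn_le n m (O : pset) : (n <= m)%N -> opn n O -> opn m O.
Proof. by move=> nm oO x /oO[e e0 h]; exists e => // y b; apply: h; exact: ball_dim b. Qed.

Lemma anat_point_dep n x y f : anat n x f -> (forall i, (i < n)%N -> x i = y i) -> f x = f y.
Proof. by move=> /anat_dep[e e0 h] xy; apply: h => //; exact: ball_center. Qed.

(** Fibre product: put the two sources side by side, and add to the two equations the squares of the
    differences of the two maps. *)
Lemma bas_inter n X Y : bas n X -> bas n Y -> bas n (fun v => X v /\ Y v).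
Proof.
move=> [d [O [f [phi [oO an XE]]]]] [d' [O' [f' [phi' [oO' an' YE]]]]].
pose sh x : nat -> R := fun i => x (d + i)%N.
have ash x i : (i < d')%N -> anat (d + d') x (fun x => sh x i).
  by move=> id; apply: anat_coord; rewrite ltn_add2l.
have al x g : anat d x g -> anat (d + d') x g by apply: anat_dim; exact: leq_addr.
have ar x g : anat d' (sh x) g -> anat (d + d') x (fun x => g (sh x)).
  by move=> h; apply: anat_comp h _ => i; exact: ash.
pose F x := f x ^+ 2 + f' (sh x) ^+ 2 + \sum_(i < n) (phi i x - phi' i (sh x)) ^+ 2.
exists (d + d')%N, (fun x => O x /\ O' (sh x)), F, phi; split.
- move=> x [Ox Ox']; have [e e0 h] := oO x Ox; have [e' e'0 h'] := oO' _ Ox'.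
  exists (Num.min e e'); first by rewrite lt_min e0.
  move=> y b; split.
    by apply: h; apply: ball_dim (leq_addr d' d) _; apply: ball_le b; rewrite ge_min lexx.
  apply: h' => i id; have := b (d + i)%N; rewrite ltn_add2l => /(_ id).
  by rewrite lt_min => /andP[].
- move=> x [Ox Ox']; have [af ap] := an x Ox; have [af' ap'] := an' _ Ox'; split; last first.
    by move=> i ni; apply: al; exact: ap.
  apply: anat_add; first by apply: anat_add; apply: anat_exp; [exact: al | exact: ar].
  by apply: anat_sum => i; apply: anat_exp; apply: anat_sub; [apply: al; exact: ap | apply: ar; exact: ap'].
move=> v; rewrite XE YE; split.
  move=> [[x [[Ox fx] im]] [x' [[Ox' fx'] im']]].
  pose z i := if (i < d)%N then x i else x' (i - d)%N.
  have xz i : (i < d)%N -> x i = z i by move=> id; rewrite /z id.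
  have xz' : sh z = x'.
    by apply/funext => i; rewrite /sh /z ltnNge leq_addr /= addKn.
  have imz : img n phi z v.
    by move=> i ni; rewrite im //; exact: anat_point_dep ((proj2 (an x Ox)) i ni) xz.
  exists z; split=> //; split; first by split; [exact: opn_dep xz | rewrite xz'].
  rewrite /F xz' fx' -(anat_point_dep (proj1 (an x Ox)) xz) fx expr0n /= !add0r.
  by apply: big1 => i _; rewrite -im' // imz // subrr expr0n.
move=> [x [[[Ox Ox'] /eqP]]]; rewrite /F !paddr_eq0 ?addr_ge0 ?sqr_ge0 ?sumr_ge0 //; last first.
  by move=> i _; rewrite sqr_ge0.
rewrite !sqrf_eq0 => /andP[/andP[/eqP fx /eqP fx'] H] im.
split; first by exists x.
exists (sh x); split=> // i ni; rewrite im //; apply/eqP; rewrite -subr_eq0 -sqrf_eq0.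
move: H; rewrite psumr_eq0; last by move=> j _; rewrite sqr_ge0.
by move=> /allP/(_ (Ordinal ni))/implyP; rewrite mem_index_enum; apply.
Qed.

Lemma Sig_inter n X Y : Sig n X -> Sig n Y -> Sig n (fun v => X v /\ Y v).
Proof.
move=> hX [Yk [hY YE]].
apply: Sig_ext (@cunion_count R nat (bas n) (fun k v => X v /\ Yk k v) _).
  by move=> v; rewrite YE; split=> [[k [? ?]]|[? [k ?]]]; [split=> //; exists k | exists k].
move=> k; have [bY|eY] := hY k; last by apply: cunion0 => v [_]; exact: eY.
apply: (@cunion_map (bas n) _ (fun X v => X v /\ Yk k v)) hX.
- by move=> {}X bX; apply: cunion1; exact: bas_inter.
- by move=> {}X h v [/h].
- by move=> Z v; split=> [[[j ?] ?]|[j [? ?]]]; [exists j | split=> //; exists j].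
- by move=> X1 X2 E v; rewrite E.
Qed.

Lemma bas_cyl n X : bas n X -> bas n.+1 X.
Proof.
move=> [d [O [f [phi [oO an XE]]]]].
exists d.+1, O, f, (fun i => if (i < n)%N then phi i else fun x => x d); split.
- by apply: opn_le oO.
- move=> x Ox; have [af ap] := an x Ox; split; first by apply: anat_dim af.
  move=> i _; case: ifP => ni; first by apply: anat_dim (ap i ni).
  exact: anat_coord.
move=> v; rewrite XE; split.
  move=> [x [[Ox fx] im]].
  have xz i : (i < d)%N -> x i = upd x d (v n) i by move=> id; rewrite /upd ltn_eqF.
  exists (upd x d (v n)); split.
    split; first exact: opn_dep xz.
    by rewrite -(anat_point_dep (proj1 (an x Ox)) xz).
  move=> i; rewrite ltnS leq_eqVlt => /orP[/eqP->|ni]; first by rewrite ltnn /upd eqxx.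
  by rewrite ni im //; exact: anat_point_dep ((proj2 (an x Ox)) i ni) xz.
move=> [x [h im]]; exists x; split=> // i ni.
by rewrite im ?ni // ltnW.
Qed.

Lemma Sig_cyl n X : Sig n X -> Sig n.+1 X.
Proof.
apply: (@cunion_map _ _ (fun X => X)) => // {}X bX; apply: cunion1; exact: bas_cyl.
Qed.

Lemma Sig_img n n' X Phi : (forall x i, (i < n')%N -> anat n x (Phi i)) ->
  Sig n X -> Sig n' (fun v => exists u, X u /\ img n' Phi u v).
Proof.
move=> aP; apply: (@cunion_map _ _ (fun X v => exists u, X u /\ img n' Phi u v)).
- move=> {}X [d [O [f [phi [oO an XE]]]]]; apply: cunion1.
  pose s x : nat -> R := fun i => if (i < n)%N then phi i x else 0.
  have as_ x i : O x -> (i < n)%N -> anat d x (fun x => s x i).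
    by move=> Ox ni; rewrite /s ni; exact: ((proj2 (an x Ox)) i ni).
  exists d, O, f, (fun i x => Phi i (s x)); split=> //.
    move=> x Ox; split; first by have [] := an x Ox.
    by move=> i ni; apply: anat_comp (aP _ i ni) _ => j; exact: as_.
  have E x u : O x -> img n phi x u -> forall i, (i < n')%N -> Phi i u = Phi i (s x).
    by move=> Ox im i ni; apply: (anat_point_dep (aP u i ni)) => j nj; rewrite /s nj im.
  move=> v; split.
    move=> [u [/XE[x [[Ox fx] im]] im']]; exists x; split=> // i ni.
    by rewrite im' // (E x u Ox im).
  move=> [x [[Ox fx] im]]; exists (s x); split=> //.
  by apply/XE; exists x; split=> // i ni; rewrite /s ni.
- by move=> {}X h v [u [/h]].
- move=> Y v; split=> [[u [[k Yu] im]]|[k [u [Yu im]]]].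
    by exists k, u.
  by exists u; split=> //; exists k.
- by move=> X1 X2 E v; split=> -[u [/E h im]]; exists u.
Qed.

(** Split according to the sign vector. For a fixed vector the strict conditions cut out an open
    set, and the vanishing ones form one sum of squares. *)
Lemma Sig_SA D n X : opn n D -> SA D n X -> Sig n (fun v => D v /\ X v).
Proof.
move=> oD [s [F [chi [aF XE]]]].
(* Sign vectors are coded by integers in order to be indexed by a countable type; codes other than
   signs give empty sets. *)
pose c (sg : seq int) k : R := (nth 0 sg k)%:~R.
pose Y (sg : seq int) v := chi (mkseq (c sg) s) /\ (D v /\ forall k, (k < s)%N -> Num.sg (F k v) = c sg k).
have hY sg : Sig n (Y sg).
  have [hc|nc] := pselect (chi (mkseq (c sg) s)); last by apply: cunion0 => v [].
  apply: cunion1.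
  pose O v := D v /\ forall k, (k < s)%N -> c sg k != 0 -> Num.sg (F k v) = c sg k.
  exists n, O, (fun v => \sum_(k < s | c sg k == 0) F k v ^+ 2), (fun i x => x i); split.
  - move=> x [Dx hx]; have [e e0 he] := oD x Dx.
    have [e' e'0 he'] : exists2 e, 0 < e & forall k, (k < s)%N -> forall e', 0 < e' <= e ->
        forall y, ball n x e' y -> c sg k != 0 -> Num.sg (F k y) = c sg k.
      apply: unif_radius => k ks; have [ck|ck] := eqVneq (c sg k) 0.
        by exists 1 => // e' _ y _; rewrite eqxx.
      have hk := hx k ks ck.
      have Fk : F k x != 0 by rewrite -sgr_eq0 hk.
      have [e' e'0 h] := anat_sign (aF x Dx k ks) Fk.
      exists e' => // e'' /andP[_ le] y b _; rewrite -hk.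
      have := h y (ball_le le b) => hp; have := gtr0_sg hp; rewrite sgrM => E.
      have := sgr_norm; move: E; case: (sgrP (F k x)) => hF; first by rewrite mul0r => /esym/eqP; rewrite oner_eq0.
        by rewrite mul1r.
      by rewrite mulN1r => /eqP; rewrite eqr_oppLR => /eqP.
    exists (Num.min e e'); first by rewrite lt_min e0.
    move=> y b; split; first by apply: he; apply: ball_le b; rewrite ge_min lexx.
    move=> k ks ck; apply: (he' k ks e') => //; first by rewrite e'0 lexx.
    by apply: ball_le b; rewrite ge_min lexx orbT.
  - move=> x [Dx _]; split; last by move=> i ni; exact: anat_coord.
    have -> : (fun v => \sum_(k < s | c sg k == 0) F k v ^+ 2) =
       fun v => \sum_(k < s) (if c sg k == 0 then F k v ^+ 2 else 0).
      by apply/funext => v; rewrite big_mkcond.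
    apply: anat_sum => k; case: (c sg k == 0); last exact: anat_const.
    by apply: anat_exp; exact: aF.
  - have sg0 x k : c sg k == 0 -> Num.sg (F k x) = c sg k <-> F k x = 0.
      by move=> /eqP->; split=> [/eqP|->]; rewrite ?sgr0 // sgr_eq0 => /eqP.
    move=> v; split.
      move=> [_ [Dv hv]]; exists v; split=> //; split; first by split=> // k ks _; exact: hv.
      by apply: big1 => k /sg0 E; have /E -> := hv k (ltn_ord k); rewrite expr0n.
    move=> [x [[[Dx hx] /eqP]]]; rewrite psumr_eq0; last by move=> k _; rewrite sqr_ge0.
    move=> /allP h0 im; have xv i : (i < n)%N -> x i = v i by move=> /im.
    split=> //; split; first exact: opn_dep xv.
    move=> k ks; rewrite -(anat_point_dep (aF x Dx k ks) xv).
    have [ck|ck] := eqVneq (c sg k) 0; last exact: hx.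
    apply/sg0; first exact/eqP.
    have := h0 (Ordinal ks); rewrite mem_index_enum => /(_ isT)/implyP/=.
    by rewrite ck eqxx sqrf_eq0 => /(_ isT)/eqP.
apply: Sig_ext (@cunion_count R (seq int) (bas n) Y hY) => v; split.
  move=> [sg [hc [Dv hs]]]; split=> //; apply/(XE v Dv).
  have -> : signs s F v = mkseq (c sg) s; last by [].
  by apply/eq_in_map => k; rewrite mem_iota add0n; exact: hs.
move=> [Dv Xv].
pose sg : seq int := mkseq (fun k => if F k v == 0 then 0 else if 0 < F k v then 1 else -1) s.
have hs k : (k < s)%N -> Num.sg (F k v) = c sg k.
  move=> ks; rewrite /c nth_mkseq //; case: sgrP => h //.
exists sg; split; last by split.
have <- : signs s F v = mkseq (c sg) s by apply/eq_in_map => k; rewrite mem_iota add0n; exact: hs.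
exact/XE.
Qed.

Lemma Sig_local n X : (forall p, X p -> exists2 rho, 0 < rho & Sig n (fun v => X v /\ ball n p rho v)) ->
  Sig n X.
Proof.
move=> h; apply: Sig_ext (@cunion_local R n (bas n) X (fun x v => x = v) _).
  by move=> v; split=> [[x [Xx <-]]//|Xv]; exists v.
move=> p /h[rho rho0 hs]; exists rho, (fun v => X v /\ ball n p rho v); split=> //.
  by move=> v [Xv _]; exists v.
by move=> x v Xx b <-.
Qed.

End SigmaAnalytic.

(** * Limits of semianalytic families *)

Section LimitSets.
Variable R : realType.
Implicit Types (p q x y : nat -> R) (f : (nat -> R) -> R).
Local Notation pset := ((nat -> R) -> Prop).
Implicit Types (G X : pset).

Definition scons (t : R) y : nat -> R := fun i => if i is j.+1 then y j else t.
Definition stail p : nat -> R := fun i => p i.+1.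

(* Coordinate 0 is the parameter [t]; limits are taken along [t > 0]. *)
Definition adh n G p := forall e, 0 < e -> exists x, [/\ G x, 0 < x 0%N & ball n p e x].

Definition SAat n p G := exists r X, [/\ 0 < r, SA (ball n p r) n X &
  forall x, ball n p r x -> 0 < x 0%N -> (G x <-> X x)].

Lemma scons_stail p : p 0%N = 0 -> scons 0 (stail p) = p.
Proof. by move=> p0; apply/funext => -[|i] //=. Qed.

(** Expand in powers of [t], the coordinate 0, and divide by the first power whose coefficient is
    not identically zero near the centre. What remains is a nonzero germ on [t = 0], so preparation
    will be possible with coefficients that still depend on [t]. *)
Lemma factor_t m p f : p 0%N = 0 -> anat m.+1 p f ->
  (exists2 r, 0 < r & forall x, ball m.+1 p r x -> f x = 0) \/
  (exists r e Ft, [/\ 0 < r, forall x, ball m.+1 p r x ->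
       anat m.+1 x Ft /\ f x = x 0%N ^+ e * Ft x &
     nzgerm m (stail p) (fun y => Ft (scons 0 y))]).
Proof.
move=> p0 [d [M [d0 hf]]]; have M0 := pseries_ge0 hf.
pose G (u : nat -> R) := f (padd p (fun i => if i is j.+1 then u j else u m)).
have hG : pseries m.+1 (fun=> d) M G.
  apply: (pseries_comp hf (g := fun u i => if i is j.+1 then u j else u m)) => -[|i] im.
    by apply: (@pseries_coord R _ (fun=> d)) => //; exact: ltW.
  by apply: (@pseries_coord R _ (fun=> d)); [exact: ltnW | exact: ltW].
have [g [hg hs]] := pseries_split d0 hG.
(* Moves [t] to the last place, where [pseries_split] expands, and centres the other variables. *)
pose un x : nat -> R := fun j => if j == m then x 0%N else x j.+1 - p j.+1.
have unm x : un x m = x 0%N by rewrite /un eqxx.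
have unB x r : ball m.+1 p r x -> inbox m.+1 (fun=> r) (un x).
  move=> b j; rewrite ltnS leq_eqVlt /un => /orP[/eqP->|jm].
    by rewrite eqxx; have := b 0%N isT; rewrite p0 subr0 => /ltW.
  by rewrite (ltn_eqF jm); exact/ltW/b.
have fG x : ball m.+1 p d x -> f x = G (un x).
  move=> b; rewrite /G -{1}(paddB p x); apply: (pseries_local hf).
    by move=> i im; exact/ltW/b.
  by move=> [|i] im; [rewrite unm p0 subr0 | rewrite /un ltn_eqF].
have d2 : 0 < d / 2 by lra.
have d2d : d / 2 <= d by lra.
pose P k := `[< exists2 y, inbox m (fun=> d / 2) y & g k y != 0 >].
have [exP|nexP] := pselect (exists k, P k); last first.
  left; exists (d / 2) => // x b.
  have bd : ball m.+1 p d x by exact: ball_le b.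
  rewrite fG //; apply: eps_eq => e e0; rewrite subr0.
  have x0d : `|x 0%N| < d / 2 by have := b 0%N isT; rewrite p0 subr0.
  have [||N0 hN] := @small_pow R (`|x 0%N| / d) (e / (M + 1)).
  - by apply/andP; split; [apply: divr_ge0 => //; exact: ltW | rewrite ler_pdivrMr //; lra].
  - by rewrite divr_gt0 // ltr_pwDr.
  have [h [hh ->]] := hs N0; last exact: unB.
  rewrite big1 ?add0r => [|k _]; last first.
    have -> : g k (un x) = 0; last by rewrite mul0r.
    apply/eqP/negPn/negP => gk; apply: nexP; exists k; apply/asboolP.
    by exists (un x) => //; exact: inboxS (unB _ _ b).
  have := hN _ (leqnn _); rewrite ltr_pdivlMr ?ltr_pwDr // => lt.
  have := pseries_bound hh (unB _ _ bd) => hb.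
  rewrite normrM normrX unm; apply: le_lt_trans lt.
  apply: le_trans (ler_wpM2l _ hb) _; first exact: exprn_ge0.
  rewrite expr_div_n mulrA mulrAC ler_wpM2l //; last lra.
  by rewrite divr_ge0 ?exprn_ge0 // ltW.
right; have [e /asboolP[y0 by0 ge0] emin] := ex_minnP exP.
have [h [hh E]] := hs e.+1.
pose H u := g e u + u m * h u.
have aH : anat m.+1 (fun=> 0) H.
  exists d, (M / d ^+ e + d * (M / d ^+ e.+1)); split=> //.
  have -> : (fun x => H (padd (fun=> 0) x)) = H.
    by apply/funext => x; congr H; apply/funext => i; rewrite /padd add0r.
  apply: pseries_add; first exact: pseries_lift (leqnSn m) (fun _ _ => ltW d0) (hg e).
  by apply: pseries_mul => //; apply: (@pseries_coord R _ (fun=> d)) => //; exact: ltW.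
have aun x i : (i < m.+1)%N -> anat m.+1 x (fun x => un x i).
  rewrite ltnS leq_eqVlt /un => /orP[/eqP->|im]; first by rewrite eqxx; exact: anat_coord.
  by rewrite (ltn_eqF im); apply: anat_sub; [exact: anat_coord | exact: anat_const].
pose Ft x := H (un x).
have aFt : anat m.+1 p Ft.
  apply: (anat_comp (g := un) (n := m.+1)); last by move=> i; exact: aun.
  suff -> : un p = fun=> 0 by [].
  by apply/funext => i; rewrite /un p0 subrr; case: ifP.
have [r r0 hr] := anat_nbhd aFt.
exists (Num.min r (d / 2)), e, Ft; split; first by rewrite lt_min r0.
  move=> x b; split; first by apply: hr; apply: ball_le b; rewrite ge_min lexx.
  have b2 : ball m.+1 p (d / 2) x by apply: ball_le b; rewrite ge_min lexx orbT.
  have bd : ball m.+1 p d x by exact: ball_le b2.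
  rewrite fG // E; last exact: unB.
  rewrite big_ord_recr /= big1 ?add0r => [|k _].
    by rewrite /Ft /H unm exprS; ring.
  have -> : g k (un x) = 0; last by rewrite mul0r.
  apply/eqP/negPn/negP => gk.
  have /emin : P k by [apply/asboolP; exists (un x) => //; exact: inboxS (unB _ _ b2)].
  by rewrite leqNgt ltn_ord.
move=> c c0.
have gp : pseries m (fun=> d) (M / d ^+ e) (fun x => g e (padd (fun=> 0) x)).
  by apply: eq_pseries (hg e) => x _; congr (g e); apply/funext => i; rewrite /padd add0r.
have [i im|e1 e10 he1] := line_nonzero d0 gp _ ge0 (q := fun=> 0).
  by rewrite !subr0 normr0 add0r; have := by0 i im; lra.
pose s := Num.min 1 (Num.min (e1 / 2) (c / d)).
have s0 : 0 < s by rewrite !lt_min ltr01 !divr_gt0.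
have sc : s * d <= c by rewrite -ler_pdivlMr // !ge_min lexx !orbT.
have s1 : s <= 1 by rewrite ge_min lexx.
have se : 0 < `|s| < e1 by rewrite gtr0_norm // s0 !gt_min; apply/orP; right; apply/orP; left; lra.
have sy i : (i < m)%N -> `|s * y0 i| <= s * (d / 2).
  by move=> im; rewrite normrM gtr0_norm // ler_pM2l //; exact: by0.
have gs := he1 s se; exists (fun i => stail p i + s * y0 i).
  move=> i im; rewrite addrC addKr; apply: le_lt_trans (sy i im) _.
  by have : 0 < s * d by [rewrite mulr_gt0]; lra.
rewrite /Ft /H unm mul0r addr0.
suff -> : g e (un (scons 0 (fun i => stail p i + s * y0 i))) = g e (fun i => 0 + s * (y0 i - 0)) by [].
apply/esym; apply: pseries_local (hg e) _ _ => i im; rewrite add0r subr0.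
  apply: le_trans (sy i im) _.
  by have : s * (d / 2) <= 1 * (d / 2) by [rewrite ler_wpM2r // ltW]; lra.
by rewrite /un (ltn_eqF im) /= /stail; ring.
Qed.

Lemma nzgerm1 n p : nzgerm n p (fun=> 1 : R).
Proof. by move=> e e0; exists p; [exact: ball_center | exact: oner_neq0]. Qed.

(** For [t > 0] a power of [t] does not change the sign, so each function is replaced by its
    quotient. Functions that vanish identically are marked by a boolean, their sign 0 being built
    into [chi]. *)
Lemma reduce m p G : p 0%N = 0 -> SAat m.+1 p G ->
  exists r s Ft chi, [/\ 0 < r, forall k, (k < s)%N -> (forall x, ball m.+1 p r x -> anat m.+1 x (Ft k)) /\
      nzgerm m (stail p) (fun y => Ft k (scons 0 y)) &
    forall x, ball m.+1 p r x -> 0 < x 0%N -> (G x <-> chi (signs s Ft x))].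
Proof.
move=> p0 [r [X [r0 [s [F [chi [aF XE]]]] GX]]].
have pb : ball m.+1 p r p by exact: ball_center.
have H k : exists y : bool * ((nat -> R) -> R), (k < s)%N ->
    nzgerm m (stail p) (fun z => y.2 (scons 0 z)) /\
    exists2 e, 0 < e & forall e', 0 < e' <= e -> forall x, ball m.+1 p e' x ->
      anat m.+1 x y.2 /\ (0 < x 0%N -> Num.sg (F k x) = if y.1 then 0 else Num.sg (y.2 x)).
  have [ks|_] := ltnP k s; last by exists (true, fun=> 0).
  have [[e e0 he]|[e [n [Ft [e0 he nz]]]]] := factor_t p0 (aF p pb k ks).
    exists (true, fun=> 1) => _; split; first exact: nzgerm1.
    exists e => // e' /andP[_ le] x b; split; first exact: anat_const.
    by move=> _; rewrite (he x (ball_le le b)) sgr0.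
  exists (false, Ft) => _; split=> //; exists e => // e' /andP[_ le] x b.
  have [aFt E] := he x (ball_le le b); split=> // x0.
  by rewrite E sgrM gtr0_sg ?exprn_gt0 // mul1r.
have [Y hY] := choice H.
have [e e0 he] : exists2 e, 0 < e & forall k, (k < s)%N -> forall e', 0 < e' <= e -> forall x, ball m.+1 p e' x ->
      anat m.+1 x (Y k).2 /\ (0 < x 0%N -> Num.sg (F k x) = if (Y k).1 then 0 else Num.sg ((Y k).2 x)).
  by apply: unif_radius => k ks; have [_] := hY k ks.
have m0 : 0 < Num.min e r by rewrite lt_min e0.
exists (Num.min e r), s, (fun k => (Y k).2),
  (fun v => chi (mkseq (fun k => if (Y k).1 then 0 else nth 0 v k) s)); split=> //.
  move=> k ks; split; last by have [] := hY k ks.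
  move=> x b; have [] := he k ks (Num.min e r) _ x b; by rewrite ?m0 ?ge_min ?lexx.
move=> x b x0; rewrite GX // ?XE //; last first.
- by apply: ball_le b; rewrite ge_min lexx orbT.
- by apply: ball_le b; rewrite ge_min lexx orbT.
suff -> : mkseq (fun k => if (Y k).1 then 0 else nth 0 (signs s (fun k => (Y k).2) x) k) s = signs s F x by [].
apply/eq_in_map => k; rewrite mem_iota add0n => /= ks.
have [|_ /(_ x0) ->] := he k ks (Num.min e r) _ x b; first by rewrite m0 ge_min lexx.
by rewrite nth_mkseq.
Qed.

(* Selection: a limit point at [t = 0] is approached along every small [t > 0]. *)
Definition LCa m G p := adh m.+1 G p -> forall e, 0 < e -> exists2 t0, 0 < t0 &
  forall t, 0 < t < t0 -> exists x, [/\ G x, x 0%N = t & ball m.+1 p e x].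

Definition LCb m G p := exists2 rho, 0 < rho &
  Sig m (fun y => ball m (stail p) rho y /\ adh m.+1 G (scons 0 y)).

Definition LC m := forall G p, p 0%N = 0 -> SAat m.+1 p G -> LCa m G p /\ LCb m G p.

Lemma Sig_ball m p r : Sig m (ball m p r).
Proof.
apply: Sig_ext (Sig_SA (@ball_opn R m p r) (SA_const _ m True)) => v.
by split=> [[]|].
Qed.

Lemma core_b m G (O : pset) : LC m -> opn m.+1 O ->
  (forall p, O p -> p 0%N = 0 -> SAat m.+1 p G) ->
  Sig m (fun y => O (scons 0 y) /\ adh m.+1 G (scons 0 y)).
Proof.
move=> lc oO hG; apply: Sig_local => y [Oy _].
have [_ [rho rho0 hs]] := lc G (scons 0 y) erefl (hG _ Oy erefl).
have [r r0 hr] := oO _ Oy.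
have m0 : 0 < Num.min rho r by rewrite lt_min rho0.
exists (Num.min rho r) => //.
apply: Sig_ext (Sig_inter (Sig_ball m y (Num.min rho r)) hs) => v; split.
  move=> [b [_ ad]]; split=> //; split=> //; apply: hr => -[|i] im /=.
    by rewrite subrr normr0.
  by apply: lt_le_trans (b i im) _; rewrite ge_min lexx orbT.
move=> [[_ ad] b]; split=> //; split=> //; apply: ball_le b.
by rewrite ge_min lexx.
Qed.

Lemma adh_dep n G p q : (forall i, (i < n)%N -> p i = q i) -> adh n G p -> adh n G q.
Proof.
move=> pq h e /h[x [Gx x0 b]]; exists x; split=> // i ni.
by rewrite -pq //; exact: b.
Qed.

(** In the variable [t] alone the reduced functions are nonzero at 0, so their signs are constant
    near 0 and [G] is all or nothing there. *)
Lemma LC0 : LC 0.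
Proof.
move=> G p p0 /(reduce p0)[r [s [Ft [chi [r0 hF hG]]]]].
have pb : ball 1 p r p by exact: ball_center.
have [e e0 he] : exists2 e, 0 < e & forall k, (k < s)%N -> forall e', 0 < e' <= e ->
    forall x, ball 1 p e' x -> Num.sg (Ft k x) = Num.sg (Ft k p).
  apply: unif_radius => k ks; have [aF nz] := hF k ks.
  have Fp : Ft k p != 0.
    have [y _] := nz 1 ltr01; rewrite (@anat_point_dep _ 1 p (scons 0 y)) //; first exact: aF.
    by case=> // _; rewrite p0.
  have [e e0 he] := anat_sign (aF p pb) Fp; exists e => // e' /andP[_ le] x b.
  have := gtr0_sg (he x (ball_le le b)); rewrite sgrM.
  case: (sgrP (Ft k p)) => h.
  - by rewrite mul0r => /esym/eqP; rewrite oner_eq0.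
  - by rewrite mul1r.
  - by rewrite mulN1r => /eqP; rewrite eqr_oppLR => /eqP.
pose c := Num.min e r.
have c0 : 0 < c by rewrite lt_min e0.
have [ce cr] : c <= e /\ c <= r by rewrite /c; split; rewrite ge_min lexx ?orbT.
clearbody c.
have Gc x : ball 1 p c x -> 0 < x 0%N -> (G x <-> chi (signs s Ft p)).
  move=> b x0; rewrite hG //; last exact: ball_le b.
  suff -> : signs s Ft x = signs s Ft p by [].
  apply/eq_in_map => k; rewrite mem_iota add0n => /= ks.
  by apply: (he k ks c) => //; rewrite c0.
have adhE : adh 1 G p <-> chi (signs s Ft p).
  split=> [/(_ c c0)[x [Gx x0 b]]|h e' e'0]; first by apply/(Gc x).
  pose t := Num.min c e' / 2.
  have t0 : 0 < t by rewrite divr_gt0 // lt_min c0.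
  have tc : t < c by rewrite ltr_pdivrMr // gt_min; apply/orP; left; lra.
  have te : t < e' by rewrite ltr_pdivrMr // gt_min; apply/orP; right; lra.
  exists (upd p 0 t).
  have b e1 : t < e1 -> ball 1 p e1 (upd p 0 t).
    by move=> te1; case=> // _; rewrite /upd /= p0 subr0 gtr0_norm.
  split; [by apply/(Gc _ (b c tc)); rewrite ?/upd | by rewrite /upd | exact: b].
split.
  move=> /adhE h e' e'0; exists (Num.min c e'); first by rewrite lt_min c0.
  move=> t /andP[t0]; rewrite lt_min => /andP[tc te].
  have b e1 : t < e1 -> ball 1 p e1 (upd p 0 t).
    by move=> te1; case=> // _; rewrite /upd /= p0 subr0 gtr0_norm.
  exists (upd p 0 t); split; [by apply/(Gc _ (b c tc)); rewrite ?/upd | by rewrite /upd | exact: b].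
exists 1 => //.
have hc : @Sig R 0 (fun=> chi (signs s Ft p)).
  have h0 : @opn R 0 (fun=> True) by move=> x _; exists 1.
  have := Sig_SA h0 (@SA_const R (fun=> True) 0 (chi (signs s Ft p))).
  apply: cunion_ext => v; by split=> [[]|].
apply: Sig_ext hc => v; rewrite -adhE; split=> [h|[_ h]].
  by split=> //; apply: adh_dep h => -[] // _; rewrite p0.
by apply: adh_dep h => -[] // _; rewrite p0.
Qed.

Lemma poly_isolated (Q : {poly R}) z : Q != 0 ->
  exists2 e, 0 < e & forall h, 0 < `|h| <= e -> Q.[z + h] != 0.
Proof.
have [n] := ubnP (size Q); elim: n Q => // n IH Q sQ Q0.
have [Qz|Qz] := eqVneq Q.[z] 0.
  have /factor_theorem[q E] : root Q z by apply/eqP.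
  have q0 : q != 0 by apply: contraNneq Q0 => q0; rewrite E q0 mul0r.
  have sq : (size q < n)%N.
    by move: sQ; rewrite E size_Mmonic ?monicXsubC // size_XsubC addn2 ltnS.
  have [e e0 he] := IH q sq q0; exists e => // h hh.
  rewrite E hornerM mulf_neq0 ?he // hornerXsubC addrC addKr -normr_gt0.
  by case/andP: hh.
have [C hC] := poly_taylor Q z.
have aQ : 0 < `|Q.[z]| by rewrite normr_gt0.
pose K := `|C| + `|Q^`().[z]| + 1.
have K0 : 0 < K by rewrite /K; have := normr_ge0 C; have := normr_ge0 (Q^`().[z]); lra.
exists (Num.min 1 (`|Q.[z]| / (2 * K))).
  by rewrite lt_min ltr01 divr_gt0 // mulr_gt0.
move=> h; rewrite le_min => /and3P[h0 h1 hK].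
have := hC h h1; set A := Q.[z + h].
move: hK; rewrite ler_pdivlMr ?mulr_gt0 // => hK hT.
apply/eqP => A0; rewrite A0 sub0r in hT.
have T1 : `|Q^`().[z] * h| <= `|Q^`().[z]| * `|h| by rewrite normrM.
have T2 : C * h ^+ 2 <= `|C| * `|h|.
  have -> : h ^+ 2 = `|h| ^+ 2 by rewrite -normrX ger0_norm ?sqr_ge0.
  apply: le_trans (_ : _ <= `|C| * `|h| ^+ 2) _.
    by rewrite ler_wpM2r ?exprn_ge0 // ler_norm.
  by rewrite ler_wpM2l // expr2 ler_piMl.
have T3 : `|Q.[z]| <= `|- Q.[z] - Q^`().[z] * h| + `|Q^`().[z] * h|.
  by rewrite -normrN -{1}(subrK (Q^`().[z] * h) (- Q.[z])); exact: ler_normD.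
have := normr_ge0 h; rewrite /K in hK; nra.
Qed.

End LimitSets.

(** * Limits of families that are polynomial in the last variable *)

Section LimitSetsStep.
Variable R : realType.
Implicit Types (p q x y : nat -> R) (f : (nat -> R) -> R).
Local Notation pset := ((nat -> R) -> Prop).
Implicit Types (G X : pset).

(** The point [eta] is the upper limit of the sets [S e] as [e] tends to 0. *)
Lemma cluster (lo hi : R) (S : R -> R -> Prop) : lo <= hi ->
  (forall e, 0 < e -> exists z, S e z) ->
  (forall e z, S e z -> lo <= z <= hi) ->
  (forall e e' z, e <= e' -> S e z -> S e' z) ->
  exists2 eta, lo <= eta <= hi & forall e d, 0 < e -> 0 < d -> exists2 z, S e z & `|z - eta| < d.
Proof.
move=> lohi ne bd mono.
pose E : set R := [set z | lo <= z <= hi /\ forall e, 0 < e -> exists2 z', S e z' & z <= z']%classic.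
have Elo : E lo.
  split; first by rewrite lexx.
  by move=> e /ne[z hz]; exists z => //; have /andP[] := bd e z hz.
have hE : has_sup E by split; [exists lo | exists hi => z [/andP[]]].
have h1 : lo <= sup E by exact: (ub_le_sup (proj2 hE)).
have h2 : sup E <= hi by apply: ge_sup; [exact: (proj1 hE) | move=> z [/andP[]]].
exists (sup E); first by rewrite h1.
move=> e d e0 d0.
have [z0 [_ hz0] ltz0] := sup_adherent d0 hE.
have [e1 e10 he1] : exists2 e1, 0 < e1 & forall z, S e1 z -> z < sup E + d.
  have [hd|hd] := leP (sup E + d) hi; last first.
    by exists 1 => // z /bd/andP[_ zh]; exact: le_lt_trans hd.
  apply: contrapT => nex.
  have : E (sup E + d).
    split; first by rewrite hd andbT; lra.
    move=> e' e'0; apply: contrapT => nz; apply: nex; exists e' => // z hz.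
    by rewrite ltNge; apply/negP => le; apply: nz; exists z.
  by move=> /(ub_le_sup (proj2 hE)); rewrite leNgt ltrDl d0.
have m0 : 0 < Num.min e e1 by rewrite lt_min e0.
have [z hz lez] := hz0 _ m0.
exists z; first by apply: mono hz; rewrite ge_min lexx.
have := he1 z; move=> /(_ _) h; have hz1 : S e1 z by apply: mono hz; rewrite ge_min lexx orbT.
have := h hz1; move=> h3; apply/ltr_normlP; split; lra.
Qed.

Lemma poly_sg_segment (Q : {poly R}) (u v : R) :
  (forall t, 0 <= t <= 1 -> Q.[u + t * (v - u)] != 0) -> Num.sg Q.[u] = Num.sg Q.[v].
Proof.
move=> h; pose q := Q \Po (u%:P + 'X * (v - u)%:P).
have qE t : q.[t] = Q.[u + t * (v - u)] by rewrite horner_comp !hornerE.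
have q0 : q.[0] = Q.[u] by rewrite qE mul0r addr0.
have q1 : q.[1] = Q.[v] by rewrite qE mul1r addrC subrK.
have nr t : 0 <= t <= 1 -> q.[t] != 0 by move=> ht; rewrite qE h.
have n0 : Q.[u] != 0 by rewrite -q0 nr // lexx ler01.
have n1 : Q.[v] != 0 by rewrite -q1 nr // lexx ler01.
case: (sgrP Q.[u]) n0 => // hu _; case: (sgrP Q.[v]) n1 => // hv _; exfalso.
  have [|t ht /eqP rt] := @poly_ivt R (- q) 0 1 ler01.
    by rewrite !hornerN q0 q1 oppr_le0 oppr_ge0 !ltW.
  by move: rt; rewrite hornerN; apply/eqP; rewrite oppr_eq0; apply: nr.
have [|t ht /eqP rt] := @poly_ivt R q 0 1 ler01; first by rewrite q0 q1 !ltW.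
by move: rt; apply/eqP; apply: nr.
Qed.

Lemma adh_closed n G p : (forall e, 0 < e -> exists2 q, ball n p e q & adh n G q) -> adh n G p.
Proof.
move=> h e e0; have e2 : 0 < e / 2 by lra.
have [q bq ad] := h _ e2; have [x [Gx x0 bx]] := ad _ e2.
by exists x; split=> //; apply: ball_le (ballD bq bx); lra.
Qed.

Section Poly.
Variables (m' : nat) (p : nat -> R) (rho : R) (s : nat) (b : nat -> nat)
  (a : nat -> nat -> (nat -> R) -> R) (chi : seq R -> Prop) (G : pset).
Let m := m'.+1.
Hypotheses (p0 : p 0%N = 0) (rho0 : 0 < rho)
  (aa : forall k j x, (k < s)%N -> ball m p rho x -> anat m x (a k j)).
Let Pk k x w := (weier (b k) (a k) x).[w].
Let sgP x w := mkseq (fun k => Num.sg (Pk k x w)) s.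
Hypothesis GE : forall x, ball m.+1 p rho x -> 0 < x 0%N -> (G x <-> chi (sgP x (x m - p m))).

(** Projection of the family along the last coordinate, with heights confined to a window. It is
    sign-determined by elimination and has one variable fewer, hence is within reach of the
    induction hypothesis. *)
Let E lo hi x := exists w, lo < w < hi /\ chi (sgP x w).

Let B := (\max_(k < s) b k).+1.
Let cf k j x := (weier (b k) (a k) x)`_j.

Let acf x : ball m p rho x -> forall k j, (k < s)%N -> anat m x (cf k j).
Proof.
move=> bx k j ks; have -> : cf k j = fun x => if (j < (b k).+1)%N then (if j == b k then 1 else a k j x) else 0.
  by apply/funext => y; rewrite /cf coef_poly.
case: (j < (b k).+1)%N; last exact: anat_const.
by case: (j == b k); [exact: anat_const | exact: aa].
Qed.

Let pevE k x w : (k < s)%N -> pev B cf k x w = Pk k x w.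
Proof.
move=> ks; rewrite /Pk (@horner_coef_wide _ B) //.
apply: leq_trans (size_poly _ _) _; rewrite ltnS.
exact: (leq_bigmax (Ordinal ks)).
Qed.

Let sgPE x w : mkseq (fun i => Num.sg (pev B cf i x w)) s = sgP x w.
Proof. by apply/eq_in_map => k; rewrite mem_iota add0n => /= ks; rewrite pevE. Qed.

Let SA_E lo hi : SA (ball m p rho) m (E lo hi).
Proof.
have := @SA_exists_root R (ball m p rho) m s B cf (fun x bx i j is_ => acf bx j is_) lo hi chi.
by apply: SA_ext => x _; split=> -[w [h1 h2]]; exists w; rewrite sgPE in h2 *.
Qed.

Let NR lo hi x := forall z z', lo <= z <= hi -> lo <= z' <= hi ->
    forall i j, (i < s)%N -> (j < s)%N -> Pk i x z = 0 -> Pk j x z' = 0 -> z = z'.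

Let SA_NR lo hi : SA (ball m p rho) m (NR lo hi).
Proof.
have := @SA_unique_root R (ball m p rho) m s B cf (fun x bx i j is_ => acf bx j is_) lo hi.
apply: SA_ext => x _; split=> h z z' hz hz' i j is_ js.
  by rewrite -!pevE //; exact: h.
by rewrite !pevE //; exact: h.
Qed.

Let Pk_dep k x y w : (k < s)%N -> ball m p rho x -> (forall i, (i < m)%N -> x i = y i) ->
  Pk k x w = Pk k y w.
Proof.
move=> ks bx xy; rewrite /Pk; congr (_.[_]); apply/polyP => i; rewrite !coef_poly.
case: ifP => // _; case: ifP => // _.
exact: anat_point_dep (aa i ks bx) xy.
Qed.

Let sgP_dep x y w : ball m p rho x -> (forall i, (i < m)%N -> x i = y i) -> sgP x w = sgP y w.
Proof.
move=> bx xy; apply/eq_in_map => k; rewrite mem_iota add0n => /= ks.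
by rewrite (Pk_dep w ks bx xy).
Qed.

Let upd_m x z i : (i < m)%N -> x i = upd x m z i.
Proof. by move=> im; rewrite /upd ltn_eqF. Qed.

Let ball_upd q e x z : ball m q e x -> `|z - q m| < e -> ball m.+1 q e (upd x m z).
Proof.
move=> bx hz i; rewrite ltnS leq_eqVlt /upd => /orP[/eqP->|im]; first by rewrite eqxx.
by rewrite (ltn_eqF im); exact: bx.
Qed.

Let SAat_E lo hi q : ball m p rho q -> SAat m q (E lo hi).
Proof.
move=> /ball_open[e e0 he]; exists e, (E lo hi); split=> //.
by apply: SA_sub (SA_E lo hi).
Qed.

Let GE_upd x w : ball m p rho x -> `|w| < rho -> 0 < x 0%N ->
  chi (sgP x w) -> G (upd x m (p m + w)).
Proof.
move=> bx hw x0 hc; apply/GE.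
- by apply: ball_upd => //; rewrite addrC addKr.
- by rewrite /upd.
by rewrite -(sgP_dep _ bx (@upd_m x (p m + w))) /upd eqxx addrC addKr.
Qed.

(** The projection of the heights in a small window adheres to [p], so by induction it has points
    over every small [t]; any height that witnesses such a point lies in the window, hence close to
    that of [p]. *)
Lemma LCa_poly : @LC R m' -> LCa m G p.
Proof.
move=> lc adp e e0.
pose e' := Num.min e rho.
have e'0 : 0 < e' by rewrite lt_min e0.
have [e'e e'r] : e' <= e /\ e' <= rho by rewrite /e'; split; rewrite ge_min lexx ?orbT.
clearbody e'.
have adE : adh m (E (- e') e') p.
  move=> e1 e10; have m0 : 0 < Num.min e1 e' by rewrite lt_min e10.
  have [x [Gx x0 bx]] := adp _ m0.
  have [b1 b2] : ball m.+1 p e1 x /\ ball m.+1 p e' x.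
    by split; apply: ball_le bx; rewrite ge_min lexx ?orbT.
  exists x; split=> //; last exact: ball_dim b1.
  exists (x m - p m); split; first by rewrite -ltr_norml; exact: b2.
  by apply/GE => //; exact: ball_le b2.
have [lca _] := lc _ p p0 (SAat_E (- e') e' (@ball_center _ _ _ _ rho0)).
have [t0 t00 ht] := lca adE _ e'0.
exists t0 => // t /[dup] /andP[tp _] /ht[x [[w [hw hc]] xt bx]].
rewrite -ltr_norml in hw.
exists (upd x m (p m + w)); split.
- apply: GE_upd => //; [exact: ball_le bx | lra | by rewrite xt].
- by rewrite /upd.
apply: ball_upd; first exact: ball_le bx.
by rewrite addrC addKr; lra.
Qed.

Let Q k x := Pk k x (x m - p m).

Let aQ k x : (k < s)%N -> ball m.+1 p rho x -> anat m.+1 x (Q k).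
Proof.
move=> ks bx; have := @anat_weier R m.+1 x (b k) (a k) 0 (fun x => x m - p m).
apply; last by apply: anat_sub; [exact: anat_coord | exact: anat_const].
move=> j; apply: anat_dim (leqnSn m) _; apply: aa => //; exact: ball_dim (leqnSn m) bx.
Qed.

(** Away from the roots all signs are constant around [x], so membership in the limit set is read
    from the signs at [x] itself. *)
Let nonroot x : ball m.+1 p rho x -> x 0%N = 0 -> (forall k, (k < s)%N -> Q k x != 0) ->
  (adh m.+1 G x <-> chi (sgP x (x m - p m))).
Proof.
move=> bx x0 nz.
have [e e0 he] : exists2 e, 0 < e & forall k, (k < s)%N -> forall e', 0 < e' <= e ->
    forall y, ball m.+1 x e' y -> Num.sg (Q k y) = Num.sg (Q k x).
  apply: unif_radius => k ks.
  have [e e0 he] := anat_sign (aQ ks bx) (nz k ks); exists e => // e' /andP[_ le] y b'.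
  have := gtr0_sg (he y (ball_le le b')); rewrite sgrM.
  case: (sgrP (Q k x)) => h.
  - by rewrite mul0r => /esym/eqP; rewrite oner_eq0.
  - by rewrite mul1r.
  - by rewrite mulN1r => /eqP; rewrite eqr_oppLR => /eqP.
have [r r0 hr] := ball_open bx.
pose d := Num.min e r.
have d0 : 0 < d by rewrite lt_min e0.
have [de dr] : d <= e /\ d <= r by rewrite /d; split; rewrite ge_min lexx ?orbT.
clearbody d.
have key y : ball m.+1 x d y -> 0 < y 0%N -> (G y <-> chi (sgP x (x m - p m))).
  move=> by_ y0; rewrite GE //; last by apply: hr; exact: ball_le by_.
  suff -> : sgP y (y m - p m) = sgP x (x m - p m) by [].
  apply/eq_in_map => k; rewrite mem_iota add0n => /= ks.
  by apply: (he k ks d) => //; rewrite d0.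
split=> [/(_ d d0)[y [Gy y0 by_]]|h c c0]; first by apply/(key y).
pose t := Num.min d c / 2.
have t0 : 0 < t by rewrite divr_gt0 // lt_min d0.
have td : t < d by rewrite ltr_pdivrMr // gt_min; apply/orP; left; lra.
have tc : t < c by rewrite ltr_pdivrMr // gt_min; apply/orP; right; lra.
have bb e1 : t < e1 -> ball m.+1 x e1 (upd x 0 t).
  move=> te i im; rewrite /upd; case: (eqVneq i 0%N) => [->|_]; first by rewrite x0 subr0 gtr0_norm.
  by rewrite subrr normr0; exact: lt_trans te.
exists (upd x 0 t); split; [by apply/(key _ (bb d td)); rewrite ?/upd | by rewrite /upd | exact: bb].
Qed.

(** The roots of the monic polynomials over [x] are isolated, so a window with rational ends can be
    chosen in which the height of [x] is the only root. *)
Let root_fwd x k0 : ball m.+1 p rho x -> x 0%N = 0 -> (k0 < s)%N -> Q k0 x = 0 -> adh m.+1 G x ->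
  exists lh : rat * rat, [/\ - rho < ratr lh.1 /\ ratr lh.2 < rho, ratr lh.1 < x m - p m < ratr lh.2,
     NR (ratr lh.1) (ratr lh.2) x & adh m (E (ratr lh.1) (ratr lh.2)) x].
Proof.
move=> bx x0 k0s Qx adx; pose w := x m - p m.
have wr : `|w| < rho by exact: bx.
have [e e0 he] : exists2 e, 0 < e & forall k, (k < s)%N -> forall e', 0 < e' <= e ->
    forall h, 0 < `|h| <= e' -> Pk k x (w + h) != 0.
  apply: unif_radius => k ks.
  have Pn0 : weier (b k) (a k) x != 0.
    apply/negP => /eqP P0; have := weier_derivn (b k) (a k) x 0.
    by rewrite P0 derivn_poly0 ?size_poly0 // horner0 eqxx.
  have [e e0 he] := poly_isolated w Pn0; exists e => // e' /andP[_ le] h /andP[h0 h1].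
  by apply: he; rewrite h0 (le_trans h1).
pose d := Num.min e (rho - `|w|).
have d0 : 0 < d by rewrite lt_min e0 subr_gt0.
have [de dr] : d <= e /\ d <= rho - `|w| by rewrite /d; split; rewrite ge_min lexx ?orbT.
clearbody d.
have [|lo /andP[lo1 lo2]] := @rat_between R (w - d) w; first lra.
have [|hi /andP[hi1 hi2]] := @rat_between R w (w + d); first lra.
have nr i z : (i < s)%N -> ratr lo <= z <= ratr hi -> Pk i x z = 0 -> z = w.
  move=> is_ /andP[z1 z2] Pz; apply/eqP; rewrite -subr_eq0 -normr_eq0; apply/negP => /negP nz.
  have ed : 0 < e <= e by rewrite e0 lexx.
  have Ez : w + (z - w) = z by ring.
  have := he i is_ e ed (z - w); rewrite Ez Pz eqxx.
  have h1 : 0 < `|z - w| by rewrite lt_neqAle eq_sym nz normr_ge0.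
  have h2 : `|z - w| <= e by apply/ler_normlP; split; lra.
  by rewrite h1 h2 => /(_ isT).
have lw := ler_norm w; have lw' := ler_norm (- w); rewrite normrN in lw'.
exists (lo, hi) => /=; split.
- by split; lra.
- by apply/andP.
- move=> z z' hz hz' i j is_ js Pz Pz'.
  by rewrite (nr i z) // (nr j z').
move=> e1 e10; pose c := Num.min (Num.min e1 (w - ratr lo)) (ratr hi - w).
have c0 : 0 < c by rewrite !lt_min e10 !subr_gt0 lo2.
have [c1 c2 c3] : [/\ c <= e1, c <= w - ratr lo & c <= ratr hi - w].
  by rewrite /c; split; rewrite !ge_min lexx ?orbT.
clearbody c.
have [r r0 hr] := ball_open bx.
have m0 : 0 < Num.min c r by rewrite lt_min c0.
have [y [Gy y0 by_]] := adx _ m0.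
have [b1 b2] : ball m.+1 x c y /\ ball m.+1 x r y.
  by split; apply: ball_le by_; rewrite ge_min lexx ?orbT.
exists y; split=> //; last exact: ball_dim (leqnSn m) (ball_le c1 b1).
exists (y m - p m); split; last by apply/GE => //; exact: hr.
have /ltr_normlP[] := b1 m (leqnn _); rewrite /w in c2 c3 *.
by move=> h1 h2; apply/andP; split; lra.
Qed.

(** The heights of points of the family over neighbours of [x] accumulate at some [eta] in the
    window. If [eta] is the height of [x], this concludes. Otherwise no root lies between [eta] and
    that height, the latter excluded, so the signs at [eta] persist along the segment; its points
    are then limits by [nonroot], and they tend to [x]. *)
Let root_bwd x k0 lo hi : ball m.+1 p rho x -> x 0%N = 0 -> (k0 < s)%N -> Q k0 x = 0 ->
  - rho < lo -> hi < rho -> lo < x m - p m < hi -> NR lo hi x -> adh m (E lo hi) x -> adh m.+1 G x.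
Proof.
move=> bx x0 k0s Qx hlo hhi hw nr adE; pose w := x m - p m; have Pw : Pk k0 x w = 0 := Qx.
have bxm : ball m p rho x by exact: ball_dim (leqnSn m) bx.
have lohi : lo <= hi by case/andP: hw => h1 h2; exact: ltW (lt_trans h1 h2).
have wr : lo <= w <= hi by case/andP: hw => h1 h2; rewrite !ltW.
pose S e z := lo < z < hi /\ exists y, [/\ 0 < y 0%N, ball m x e y, ball m p rho y & chi (sgP y z)].
have [r r0 hr] := ball_open bxm.
have [|||eta /andP[eta1 eta2] heta] := @cluster lo hi S lohi.
- move=> e e0; have m0 : 0 < Num.min e r by rewrite lt_min e0.
  have [y [[z [hz hc]] y0 by_]] := adE _ m0; exists z; split=> //; exists y; split=> //.
    by apply: ball_le by_; rewrite ge_min lexx.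
  by apply: hr; apply: ball_le by_; rewrite ge_min lexx orbT.
- by move=> e z [/andP[h1 h2] _]; rewrite !ltW.
- by move=> e e' z le [h1 [y [? h2 ? ?]]]; split=> //; exists y; split=> //; exact: ball_le h2.
pose xe z := upd x m (p m + z).
have xeb z : lo <= z <= hi -> ball m.+1 p rho (xe z).
  move=> /andP[z1 z2]; apply: ball_upd => //; rewrite addrC addKr.
  by apply/ltr_normlP; split; lra.
have xe0 z : xe z 0%N = 0 by rewrite /xe /upd.
have Qxe k z : (k < s)%N -> Q k (xe z) = Pk k x z.
  move=> ks; rewrite /Q /xe {2}/upd eqxx [p m + z]addrC addrK.
  by rewrite -(Pk_dep _ ks bxm (@upd_m x (z + p m))).
have xez z : sgP (xe z) (xe z m - p m) = sgP x z.
  by apply/eq_in_map => k; rewrite mem_iota add0n => /= ks; rewrite -Qxe.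
have ade : adh m.+1 G (xe eta).
  move=> e e0; have [z [hz [y [y0 by_ byp hc]]] ze] := heta e e e0 e0.
  exists (upd y m (p m + z)); split.
  - apply: GE_upd => //; case/andP: hz => h1 h2; apply/ltr_normlP; split; lra.
  - by rewrite /upd.
  move=> i; rewrite ltnS leq_eqVlt /xe /upd => /orP[/eqP->|im].
    by rewrite eqxx opprD addrACA subrr add0r.
  by rewrite (ltn_eqF im); exact: by_.
have xw : xe w = x.
  by apply/funext => i; rewrite /xe /upd /w; case: eqP => // ->; rewrite addrC subrK.
have [ew|ew] := eqVneq eta w; first by rewrite -xw -ew.
have nz z k : (k < s)%N -> lo <= z <= hi -> z != w -> Pk k x z != 0.
  move=> ks hz zw; apply/eqP => Pz; move/eqP: zw; apply.
  exact: (nr _ _ hz wr k k0).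
have etar : lo <= eta <= hi by rewrite eta1.
have chi_eta : chi (sgP x eta).
  rewrite -xez; apply/nonroot => //; first exact: xeb.
  by move=> k ks; rewrite Qxe // nz.
rewrite -xw; apply: adh_closed => e e0.
have aw : 0 < `|eta - w| by rewrite normr_gt0 subr_eq0.
(* Fraction of the way from [w] to [eta]: positive, to stay off the root [w], and small enough for
   the point to be within [e] of [x]. *)
pose t := Num.min 1 (e / 2 / `|eta - w|).
have t0 : 0 < t by rewrite lt_min ltr01 !divr_gt0.
have t1 : t <= 1 by rewrite ge_min lexx.
have te : t * `|eta - w| <= e / 2 by rewrite -ler_pdivlMr // ge_min lexx orbT.
pose xi := w + t * (eta - w).
have seg u : t <= u <= 1 -> lo <= w + u * (eta - w) <= hi /\ w + u * (eta - w) != w.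
  move=> /andP[u1 u2]; split; last first.
    rewrite -subr_eq0 addrC addKr mulf_neq0 ?subr_eq0 //; lra.
  by case/andP: wr => w1 w2; apply/andP; split; nra.
have tt1 : t <= t <= 1 by rewrite lexx.
have [xir xiw] := seg t tt1.
exists (xe xi).
  move=> i im; rewrite /xe /upd; case: eqP => _; last by rewrite subrr normr0.
  have -> : p m + xi - (p m + w) = t * (eta - w) by rewrite /xi; ring.
  by rewrite normrM gtr0_norm //; lra.
apply/nonroot => //; first exact: xeb.
  by move=> k ks; rewrite Qxe // nz.
rewrite xez; suff -> : sgP x xi = sgP x eta by [].
apply/eq_in_map => k; rewrite mem_iota add0n => /= ks.
apply: poly_sg_segment => u /andP[u0 u1].
have -> : xi + u * (eta - xi) = w + (t + u * (1 - t)) * (eta - w) by rewrite /xi; ring.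
have [h1 h2] : lo <= w + (t + u * (1 - t)) * (eta - w) <= hi /\ w + (t + u * (1 - t)) * (eta - w) != w.
  by apply: seg; apply/andP; split; nra.
exact: nz.
Qed.

(** The limit set is the union of its part off the roots, a sign condition, and of its parts at
    roots, one for each rational window. In a window, [root_fwd] and [root_bwd] replace the limit
    set of the family by that of its projection, which is in the class by induction and is extended
    as a cylinder. Rational windows keep the union countable. *)
Lemma LCb_poly : @LC R m' -> LCb m G p.
Proof.
move=> lc; exists rho => //.
pose D : pset := ball m (stail p) rho.
have oD : opn m D by exact: ball_opn.
have Sb y : D y -> ball m.+1 p rho (scons 0 y).
  by move=> Dy [|i] im /=; [rewrite p0 subrr normr0 | exact: Dy].
have Sbm y : D y -> ball m p rho (scons 0 y) by move=> /Sb; exact: ball_dim.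
pose F k y := Q k (scons 0 y).
have aF y : D y -> forall k, (k < s)%N -> anat m y (F k).
  move=> Dy k ks; apply: (anat_comp (g := scons 0) (aQ ks (Sb y Dy))) => -[|i] im /=.
    exact: anat_const.
  exact: anat_coord.
have SAF c : SA D m (fun y => c (signs s F y)) by exists s, F, c.
have FE y : signs s F y = sgP (scons 0 y) (y m' - p m) by [].
pose c1 v := (forall k, (k < s)%N -> nth 0 v k != 0) /\ chi v.
pose c2 (v : seq R) := exists2 k, (k < s)%N & nth 0 v k = 0.
have nthF y k : (k < s)%N -> (nth 0 (signs s F y) k == 0) = (F k y == 0).
  by move=> ks; rewrite nth_mkseq // sgr_eq0.
pose Y1 y := D y /\ c1 (signs s F y).
pose Y2 (lh : rat * rat) y := (D y /\ (c2 (signs s F y) /\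
   ((0 < (y m' - p m) - ratr lh.1 /\ 0 < ratr lh.2 - (y m' - p m)) /\
    (NR (ratr lh.1) (ratr lh.2) (scons 0 y) /\ (- rho < ratr lh.1 /\ ratr lh.2 < rho))))) /\
   (ball m p rho (scons 0 y) /\ adh m (E (ratr lh.1) (ratr lh.2)) (scons 0 y)).
have hY1 : Sig m Y1 by exact: Sig_SA (SAF c1).
have aym y : D y -> anat m y (fun y => y m' - p m).
  by move=> _; apply: anat_sub; [exact: anat_coord | exact: anat_const].
have hY2 lh : Sig m (Y2 lh).
  apply: Sig_inter; last first.
    apply: Sig_cyl; apply: core_b lc (@ball_opn R m p rho) _ => q bq _.
    exact: SAat_E.
  apply: Sig_SA => //; apply: SA_and; first exact: SAF.
  apply: SA_and; first apply: SA_and.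
  - by apply: SA_pos => y Dy; apply: anat_sub; [exact: aym | exact: anat_const].
  - by apply: SA_pos => y Dy; apply: anat_sub; [exact: anat_const | exact: aym].
  apply: SA_and; last exact: SA_const.
  apply: (SA_comp (g := scons 0) (SA_NR (ratr lh.1) (ratr lh.2))) => y Dy; split; first exact: Sbm.
  by move=> [|i] im /=; [exact: anat_const | apply: anat_coord; exact: ltnW].
have := cunionU hY1 (@cunion_count R (rat * rat)%type (bas m) Y2 hY2).
apply: cunion_ext => y; split.
  move=> [[Dy [nz hc]]|[lh [[Dy [[k ks Fk] [[lo hi] [nr [rl rh]]]]] [_ ad]]]].
    split=> //; apply/nonroot => //; first exact: Sb.
    by move=> k ks; rewrite -/(F k y) -nthF // nz.
  split=> //; apply: (root_bwd (Sb y Dy) _ ks _ rl rh _ nr ad) => //.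
    by move/eqP: Fk; rewrite nthF // => /eqP.
  by apply/andP; split; rewrite -subr_gt0.
move=> [Dy ad].
have [[k ks Fk]|nr] := pselect (exists2 k, (k < s)%N & F k y = 0); last first.
  left; split=> //.
  have nz k : (k < s)%N -> F k y != 0.
    by move=> ks; apply/eqP => Fk; apply: nr; exists k.
  split; first by move=> k ks; rewrite nthF // nz.
  by apply/nonroot => //; exact: Sb.
right; have [lh [[rl rh] /andP[lo hi] nr adE]] := root_fwd (Sb y Dy) erefl ks Fk ad.
exists lh; split; last by split=> //; exact: Sbm.
split=> //; split; first by exists k => //; apply/eqP; rewrite nthF // Fk.
by rewrite !subr_gt0.
Qed.

End Poly.
End LimitSetsStep.

(** * Limits of arbitrary sign-determined families *)

Section LimitSetsAll.
Variable R : realType.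
Implicit Types (p q x y w : nat -> R) (f : (nat -> R) -> R).
Local Notation pset := ((nat -> R) -> Prop).
Implicit Types (G X : pset).

Definition shear w d p x : nat -> R := fun i => x i + w i * (x d - p d).

Definition negw w : nat -> R := fun i => - w i.

Lemma shearK w d p x : w d = 0 -> shear (negw w) d p (shear w d p x) = x.
Proof.
by move=> wd; apply/funext => i; rewrite /shear /negw wd; ring.
Qed.

Lemma shearNK w d p x : w d = 0 -> shear w d p (shear (negw w) d p x) = x.
Proof.
by move=> wd; apply/funext => i; rewrite /shear /negw wd; ring.
Qed.

Lemma shear_id w d p : shear w d p p = p.
Proof. by apply/funext => i; rewrite /shear subrr mulr0 addr0. Qed.

Lemma shear_ball w d p q x W r : 0 <= W -> (forall i, (i < d.+1)%N -> `|w i| <= W) ->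
  ball d.+1 q (r / (W + 1)) x -> ball d.+1 (shear w d p q) r (shear w d p x).
Proof.
move=> W0 hW b i ni; have W1 : 0 < W + 1 by rewrite ltr_pwDr.
have := b i ni; have := b d (leqnn _); rewrite !ltr_pdivlMr // => h1 h2.
have -> : shear w d p x i - shear w d p q i = (x i - q i) + w i * (x d - q d) by rewrite /shear; ring.
apply: le_lt_trans (ler_normD _ _) _; rewrite normrM.
have h6 := ler_wpM2r (normr_ge0 (x d - q d)) (hW i ni).
have h4 := normr_ge0 (x d - q d).
have [le|le] := leP (`|x i - q i|) (`|x d - q d|); nra.
Qed.

Lemma anat_shear w d p x i : (i < d.+1)%N -> anat d.+1 x (fun x => shear w d p x i).
Proof.
move=> id; apply: anat_add; first exact: anat_coord.
apply: anat_mul; first exact: anat_const.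
by apply: anat_sub; [exact: anat_coord | exact: anat_const].
Qed.

(** The two vanishing entries of [w] matter: [w d = 0] makes the shear invertible by its opposite,
    and [w 0 = 0] keeps the parameter [t] unchanged. *)
Lemma adh_shear w d p G q : w d = 0 -> w 0%N = 0 ->
  adh d.+1 (fun x => G (shear w d p x)) q <-> adh d.+1 G (shear w d p q).
Proof.
move=> wd w0; have [W W0 hW] := fin_bound d.+1 w.
have W1 : 0 < W + 1 by rewrite ltr_pwDr.
have s0 u x : u 0%N = 0 -> shear u d p x 0%N = x 0%N by move=> u0; rewrite /shear u0 mul0r addr0.
split=> h e e0; have e1 : 0 < e / (W + 1) by rewrite divr_gt0.
  have [x [Gx x0 bx]] := h _ e1; exists (shear w d p x); split=> //; first by rewrite s0.
  exact: shear_ball W0 hW bx.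
have [x [Gx x0 bx]] := h _ e1; exists (shear (negw w) d p x); split.
- by rewrite shearNK.
- by rewrite s0 // /negw w0 oppr0.
rewrite -(shearK p q wd); apply: (@shear_ball (negw w) d p _ _ W) => // i id.
by rewrite /negw normrN hW.
Qed.

(** On [t = 0] the reduced functions are nonzero germs, so one shear makes them all regular in the
    last variable at once. Preparation then gives polynomials with analytic coefficients and units
    of constant sign, and the polynomial case applies. *)
Lemma LC_succ m' : LC R m' -> LC R m'.+1.
Proof.
move=> lc G p p0 hSA.
set m := m'.+1 in hSA *.
have [r [s [Ft [chi [r0 hF hG]]]]] := reduce p0 hSA.
have pb : ball m.+1 p r p by exact: ball_center.
have hF' k : (k < s)%N -> anat m'.+1 (stail p) (fun y => Ft k (scons 0 y)) /\
   nzgerm m'.+1 (stail p) (fun y => Ft k (scons 0 y)).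
  move=> ks; have [aF nz] := hF k ks; split=> //.
  apply: (anat_comp (g := scons 0) (n := m.+1)); first by rewrite scons_stail //; exact: aF.
  by move=> [|i] im /=; [exact: anat_const | exact: anat_coord].
have [v [vm v0 hv]] := good_direction0 hF'.
(* The good direction lives on the slice [t = 0], whence the shift of indices. The entries for [t]
   and for the last coordinate are 0. *)
pose w i : R := if i is j.+1 then (if (j < m')%N then v j else 0) else 0.
have wm : w m = 0 by rewrite /w /= ltnn.
have w0 : w 0%N = 0 by [].
have [W W0 hW] := fin_bound m.+1 w.
have W1 : 0 < W + 1 by rewrite ltr_pwDr.
pose Phi := shear w m p.
have Phip : Phi p = p by exact: shear_id.
have PhiB x e : ball m.+1 p (e / (W + 1)) x -> ball m.+1 p e (Phi x).
  by move=> b; rewrite -{1}Phip; exact: shear_ball W0 hW b.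
have Phi0 x : Phi x 0%N = x 0%N by rewrite /Phi /shear w0 mul0r addr0.
have axisE z : Phi (padd p (axis m z)) = scons 0 (fun i => stail p i + z * v i).
  apply/funext => -[|i]; first by rewrite Phi0 /padd /axis /= p0 addr0.
  rewrite /Phi /shear /padd /axis eqxx /= /stail /m eqSS; case: (ltngtP i m') => im.
  - by ring.
  - by rewrite v0 //; ring.
  - by rewrite im vm; ring.
have H k : exists y : R * nat * (nat -> (nat -> R) -> R), (k < s)%N -> y.1.1 != 0 /\
   exists2 e, 0 < e & forall e', 0 < e' <= e ->
     (forall j x, ball m p e' x -> anat m x (y.2 j)) /\
     forall x, ball m.+1 p e' x ->
       Num.sg (Ft k (Phi x)) = Num.sg y.1.1 * Num.sg (weier y.1.2 y.2 x).[x m - p m].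
  have [ks|_] := ltnP k s; last by exists (0, 0%N, fun _ _ => 0).
  have aF1 : anat m.+1 p (fun x => Ft k (Phi x)).
    apply: (anat_comp (g := Phi) (n := m.+1)); last by move=> i; exact: anat_shear.
    by rewrite Phip; have [aF _] := hF k ks; exact: aF.
  have [|d [c [b [u [a [d0 ha hq]]]]]] := wp_germ aF1.
    by move=> e /(hv k ks)[z ze Fz]; exists z => //; rewrite axisE.
  exists (c, b, a) => _ /=.
  have [cu _] := hq p (@ball_center _ _ _ _ d0).
  split; first by apply: contraTneq cu => ->; rewrite mul0r ltxx.
  exists d => // e' /andP[_ le]; split=> [j x b'|x b'].
    by apply: ha; exact: ball_le b'.
  have [cux E] := hq x (ball_le le b').
  rewrite weierE -E sgrM.
  have c0 : c != 0 by apply: contraTneq cux => ->; rewrite mul0r ltxx.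
  by have := gtr0_sg cux; rewrite sgrM mulrA => ->; rewrite mul1r.
have [Y hY] := choice H.
have [e e0 he] : exists2 e, 0 < e & forall k, (k < s)%N -> forall e', 0 < e' <= e ->
   (forall j x, ball m p e' x -> anat m x ((Y k).2 j)) /\
     forall x, ball m.+1 p e' x ->
       Num.sg (Ft k (Phi x)) = Num.sg (Y k).1.1 * Num.sg (weier (Y k).1.2 (Y k).2 x).[x m - p m].
  by apply: unif_radius => k ks; have [_] := hY k ks.
pose rho := Num.min e (r / (W + 1)).
have rho0 : 0 < rho by rewrite lt_min e0 divr_gt0.
have [re rr] : rho <= e /\ rho <= r / (W + 1) by rewrite /rho; split; rewrite ge_min lexx ?orbT.
clearbody rho.
have rhoe : 0 < rho <= e by rewrite rho0.
pose G1 x := G (Phi x).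
pose b k := (Y k).1.2; pose a k := (Y k).2.
(* The constant signs of the units are absorbed into the sign condition. *)
pose chi1 (l : seq R) := chi (mkseq (fun k => Num.sg (Y k).1.1 * nth 0 l k) s).
have aa k j x : (k < s)%N -> ball m p rho x -> anat m x (a k j).
  by move=> ks; have [ha _] := he k ks _ rhoe; exact: ha.
have GE x : ball m.+1 p rho x -> 0 < x 0%N ->
   (G1 x <-> chi1 (mkseq (fun k => Num.sg (weier (b k) (a k) x).[x m - p m]) s)).
  move=> bx x0; rewrite /G1 hG ?Phi0 //; last by apply: PhiB; exact: ball_le bx.
  rewrite /chi1; set l1 := signs _ _ _; set l2 := mkseq (fun k => _ * _) s.
  suff -> : l1 = l2 by [].
  apply/eq_in_map => k; rewrite mem_iota add0n => /= ks.
  by have [_ hs] := he k ks _ rhoe; rewrite nth_mkseq // hs.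
have lca := LCa_poly p0 rho0 aa GE lc.
have [rho1 rho10 hS] := LCb_poly p0 rho0 aa GE lc.
split.
  move=> adG e1 e10; have e2 : 0 < e1 / (W + 1) by rewrite divr_gt0.
  have adG1 : adh m.+1 G1 p by apply/(adh_shear p G p wm w0); rewrite shear_id.
  have [t0 t00 ht] := lca adG1 _ e2.
  exists t0 => // t /ht[x [Gx xt bx]]; exists (Phi x); split=> //; first by rewrite Phi0.
  exact: PhiB.
have r20 : 0 < rho1 / (W + 1) by rewrite divr_gt0.
exists (rho1 / (W + 1)) => //.
pose Phib i (u : nat -> R) := u i + w i.+1 * (u m' - p m).
have aPhib u i : (i < m)%N -> anat m u (Phib i).
  move=> im; apply: anat_add; first exact: anat_coord.
  apply: anat_mul; first exact: anat_const.
  by apply: anat_sub; [exact: anat_coord | exact: anat_const].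
have PhiS u : Phi (scons 0 u) = scons 0 (fun i => Phib i u).
  by apply/funext => -[|i]; [rewrite Phi0 | rewrite /Phi /shear /Phib].
apply: Sig_ext (Sig_inter (Sig_ball m (stail p) (rho1 / (W + 1))) (Sig_img aPhib hS)) => y; split.
  move=> [by_ [u [[bu ad] im]]]; split=> //.
  have ad' : adh m.+1 G (Phi (scons 0 u)) by apply/(adh_shear p G (scons 0 u) wm w0).
  apply: adh_dep ad'; rewrite PhiS => -[|i] // im' /=.
  by rewrite im.
move=> [by_ ad]; split=> //.
pose x := shear (negw w) m p (scons 0 y).
have xE : scons 0 (stail x) = x by apply: scons_stail; rewrite /x /shear /negw w0 oppr0 mul0r addr0.
have Phix : Phi x = scons 0 y by exact: shearNK.
have bx : ball m.+1 p rho1 x.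
  rewrite -(shear_id (negw w) m p); apply: (@shear_ball (negw w) m p _ _ W) => //.
    by move=> i im; rewrite /negw normrN hW.
  by move=> [|i] im /=; [rewrite p0 subrr normr0 | exact: by_].
exists (stail x); split.
  split; first by move=> i im; exact: bx.
  by rewrite xE; apply/(adh_shear p G x wm w0); rewrite -/(Phi x) Phix.
by move=> i im; have := congr1 (fun z => z i.+1) (PhiS (stail x)); rewrite xE Phix.
Qed.

Lemma LC_all m : LC R m.
Proof. by elim: m => [|m IH]; [exact: LC0 | exact: LC_succ]. Qed.

End LimitSetsAll.

(** * Comparison of dimensions *)

Section Porosity.
Variable R : realType.
Implicit Types (a q w : nat -> R).

Definition cball n a (r : R) q := forall i, (i < n)%N -> `|q i - a i| <= r.

(* [Rel] is the graph of a map with Lipschitz inverse from a subset of R^d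
   into a bounded box of R^d'. *)
Definition thin d d' (Rel : (nat -> R) -> (nat -> R) -> Prop) := exists T C,
  [/\ 0 < T, 0 < C, forall q w, Rel q w -> forall j, (j < d')%N -> `|w j| <= T &
   forall q q' w w' dl, 0 < dl -> Rel q w -> Rel q' w' ->
     (forall j, (j < d')%N -> `|w j - w' j| <= dl) -> cball d q (C * dl) q'].

Lemma truncn_eq_close (x y : R) : 0 <= x -> 0 <= y -> Num.truncn x = Num.truncn y -> `|x - y| <= 1.
Proof.
move=> x0 y0 E; have /andP[h1 h2] := truncn_itv x0; have /andP[h3 h4] := truncn_itv y0.
rewrite E -natr1 in h1 h2; rewrite -natr1 in h4.
by apply/ler_normlP; split; lra.
Qed.

(** Pigeonhole. If each of [N ^ d] separated small cubes contained a point of the domain, the images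
    would lie in [(K * N) ^ d'] boxes of side [dl]. Two images in one box force their sources within
    [4 s], whereas distinct cubes are at least [6 s] apart; so [N ^ d <= (K * N) ^ d'], which fails
    for large [N] as [d' < d]. *)
Lemma thin_hole d d' Rel a r : (d' < d)%N -> thin d d' Rel -> 0 < r ->
  exists b s, [/\ 0 < s, forall q, cball d b s q -> cball d a r q &
    forall q, cball d b s q -> ~ exists w, Rel q w].
Proof.
move=> d'd [T [C [T0 C0 hT hC]]] r0; apply: contrapT => nh.
(* An interval of length [2 T] is covered by [K * N] intervals of length [dl], because
   [2 T / dl = (2 T C / r) * N]. *)
pose K := (Num.bound (2 * T * C / r)).+1.
have hK : 2 * T * C / r < K%:R.
  apply: lt_trans (archi_boundP _) _; first by rewrite divr_ge0 ?mulr_ge0 // ltW.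
  by rewrite ltr_nat.
(* The count would give [N <= K ^ d.-1], which this value contradicts. *)
pose N := (K ^ d).+1.
have N0 : (0 : R) < N%:R by rewrite ltr0n.
pose dl := r / (C * N%:R).
have dl0 : 0 < dl by rewrite divr_gt0 // mulr_gt0.
(* The cell around each centre has half-width [4 s], so the cubes of radius [s] keep wide gaps
   between them. *)
pose s := r / (4 * N%:R).
have s0 : 0 < s by rewrite divr_gt0 // mulr_gt0.
pose gv (g : {ffun 'I_d -> 'I_N}) (i : nat) : nat := if insub i is Some j then val (g j) else 0%N.
pose ctr g i := a i - r + (2 * (gv g i)%:R + 1) * (r / N%:R).
have gvN g i : (gv g i < N)%N by rewrite /gv; case: insub => [j|//]; exact: ltn_ord.
have gvE g (i : 'I_d) : gv g i = val (g i) by rewrite /gv valK.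
have rN : r / N%:R = 4 * s by rewrite /s; field; rewrite gt_eqF.
have rNs : r = 4 * s * N%:R by rewrite -rN divfK ?gt_eqF.
have sub g q : cball d (ctr g) s q -> cball d a r q.
  move=> b i id; have := b i id; rewrite /ctr rN.
  have h1 : (gv g i)%:R + 1 <= N%:R :> R by rewrite natr1 ler_nat.
  have h2 : (0 : R) <= (gv g i)%:R by [].
  have h3 : ((gv g i)%:R + 1) * s <= N%:R * s by rewrite ler_wpM2r // ltW.
  have h4 : 0 <= (gv g i)%:R * s by rewrite mulr_ge0 // ltW.
  move=> /ler_normlP[k1 k2]; apply/ler_normlP; rewrite rNs in k1 k2 *; split; nra.
have hq g : exists qw : (nat -> R) * (nat -> R), cball d (ctr g) s qw.1 /\ Rel qw.1 qw.2.
  apply: contrapT => nq; apply: nh; exists (ctr g), s; split=> //; first exact: sub.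
  by move=> q b [w hw]; apply: nq; exists (q, w).
have [F hF] := choice hq.
pose cell g : {ffun 'I_d' -> 'I_(K * N)} :=
  [ffun j : 'I_d' => insubd (Ordinal (isT : (0 < K * N)%N)) (Num.truncn (((F g).2 j + T) / dl))].
have cinj : injective cell.
  move=> g g' E; apply/ffunP => i; apply: val_inj => /=; apply/eqP.
  have close j : (j < d')%N -> `|(F g).2 j - (F g').2 j| <= dl.
    move=> jd; have := congr1 (fun f : {ffun 'I_d' -> 'I_(K * N)} => val (f (Ordinal jd))) E.
    rewrite !ffunE !val_insubd /=.
    have bd h : 0 <= ((F h).2 j + T) / dl /\ (Num.truncn (((F h).2 j + T) / dl) < K * N)%N.
      have /ler_normlP[h1 h2] := hT _ _ (proj2 (hF h)) j jd.
      have p0 : 0 <= ((F h).2 j + T) / dl by rewrite divr_ge0 ?(ltW dl0) //; lra.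
      split=> //; rewrite -(ltr_nat R); have /andP[t1 _] := truncn_itv p0.
      apply: le_lt_trans t1 _; rewrite ltr_pdivrMr // natrM.
      have -> : K%:R * N%:R * dl = K%:R * r / C by rewrite /dl; field; rewrite !gt_eqF.
      rewrite ltr_pdivlMr //; move: hK; rewrite ltr_pdivrMr // => hK.
      have : ((F h).2 j + T) * C <= 2 * T * C by rewrite ler_wpM2r ?(ltW C0) //; lra.
      lra.
    have [p1 b1] := bd g; have [p2 b2] := bd g'; rewrite b1 b2 => Et.
    have := truncn_eq_close p1 p2 Et.
    have -> : ((F g).2 j + T) / dl - ((F g').2 j + T) / dl = ((F g).2 j - (F g').2 j) / dl.
      by field; rewrite gt_eqF.
    by rewrite normrM normfV (gtr0_norm dl0) ler_pdivrMr // mul1r.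
  have [bg Rg] := hF g; have [bg' Rg'] := hF g'.
  have := hC _ _ _ _ dl dl0 Rg Rg' close i (ltn_ord i).
  have -> : C * dl = 4 * s by rewrite -rN /dl; field; rewrite !gt_eqF.
  have := bg i (ltn_ord i); have := bg' i (ltn_ord i).
  rewrite /ctr rN !gvE => h1 h2 h3.
  set A := (F g).1 i in h2 h3; set B := (F g').1 i in h1 h3.
  rewrite eqn_leq; apply/andP; split; rewrite leqNgt; apply/negP => lt.
    have : (val (g' i))%:R + 1 <= (val (g i))%:R :> R by rewrite natr1 ler_nat.
    move=> h4; have := ler_wpM2r (ltW s0) h4.
    by move: h1 h2 h3 => /ler_normlP[? ?] /ler_normlP[? ?] /ler_normlP[? ?]; nra.
  have : (val (g i))%:R + 1 <= (val (g' i))%:R :> R by rewrite natr1 ler_nat.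
  move=> h4; have := ler_wpM2r (ltW s0) h4.
  by move: h1 h2 h3 => /ler_normlP[? ?] /ler_normlP[? ?] /ler_normlP[? ?]; nra.
have := leq_card cell cinj; rewrite !card_ffun !card_ord.
have d0 : (0 < d)%N by exact: leq_ltn_trans d'd.
have le1 : ((K * N) ^ d' <= (K * N) ^ d.-1)%N.
  by rewrite leq_pexp2l // -ltnS prednK.
move=> le2; have := leq_trans le2 le1.
rewrite -{1}(prednK d0) expnS expnMn leq_pmul2r ?expn_gt0 //.
rewrite /N leqNgt ltnS leq_pexp2l //; exact: leq_pred.
Qed.

(** Baire argument in a box: each relation is avoided in turn on a smaller closed cube, and nested
    cubes have a common point. Countably many relations are therefore harmless. *)
Lemma thin_cover d (dims : nat -> nat) (Rel : nat -> (nat -> R) -> (nat -> R) -> Prop) a r :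
  (forall i, (dims i < d)%N) -> (forall i, thin d (dims i) (Rel i)) -> 0 < r ->
  exists q, cball d a r q /\ forall i, ~ exists w, Rel i q w.
Proof.
move=> hd ht r0.
have step (st : nat * ((nat -> R) * R)) : exists y : (nat -> R) * R, 0 < st.2.2 ->
    [/\ 0 < y.2, forall q, cball d y.1 y.2 q -> cball d st.2.1 st.2.2 q &
      forall q, cball d y.1 y.2 q -> ~ exists w, Rel st.1 q w].
  have [s0|s0] := pselect (0 < st.2.2); last by exists (a, r).
  have [b [s h]] := thin_hole st.2.1 (hd st.1) (ht st.1) s0.
  by exists (b, s).
have [F hF] := choice step.
pose B := fix B i := if i is i'.+1 then F (i', B i') else (a, r).
have B0 i : 0 < (B i).2.
  by elim: i => [|i IH] //=; have [] := hF (i, B i) IH.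
have Bsub i q : cball d (B i.+1).1 (B i.+1).2 q -> cball d (B i).1 (B i).2 q.
  by have [_ h _] := hF (i, B i) (B0 i); exact: h.
have Bsub' i j q : (i <= j)%N -> cball d (B j).1 (B j).2 q -> cball d (B i).1 (B i).2 q.
  elim: j => [|j IH]; first by rewrite leqn0 => /eqP ->.
  by rewrite leq_eqVlt => /orP[/eqP->//|ij] /Bsub; exact: IH.
(* Every lower corner lies below every upper corner, so the suprema of the lower corners give a
   point of all the cubes. *)
pose lo i k := (B i).1 k - (B i).2.
have inlo i : cball d (B i).1 (B i).2 (lo i).
  by move=> k kd; rewrite /lo addrAC subrr add0r normrN gtr0_norm.
have lohi i j k : (k < d)%N -> lo i k <= (B j).1 k + (B j).2.
  move=> kd; have [ij|ji] := leqP i j.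
    have [h1 h2] := ler_normlP _ _ (Bsub' i j _ ij (inlo j) k kd).
    have hi : cball d (B j).1 (B j).2 (fun k => (B j).1 k + (B j).2).
      by move=> k' _; rewrite addrC addKr gtr0_norm.
    have [h3 h4] := ler_normlP _ _ (Bsub' i j _ ij hi k kd).
    rewrite /lo; lra.
  have [h1 h2] := ler_normlP _ _ (Bsub' j i _ (ltnW ji) (inlo i) k kd); lra.
pose E k : set R := [set z | exists i, z = lo i k]%classic.
have hE k : (k < d)%N -> has_sup (E k).
  move=> kd; split; first by exists (lo 0%N k), 0%N.
  by exists ((B 0%N).1 k + (B 0%N).2) => _ [i ->]; exact: lohi.
pose q k := sup (E k).
have qB i : cball d (B i).1 (B i).2 q.
  move=> k kd; have h1 : lo i k <= q k by apply: (ub_le_sup (proj2 (hE k kd))); exists i.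
  have h2 : q k <= (B i).1 k + (B i).2.
    by apply: ge_sup; [exact: (proj1 (hE k kd)) | move=> _ [j ->]; exact: lohi].
  by rewrite /lo in h1; apply/ler_normlP; split; lra.
exists q; split; first exact: (qB 0%N).
move=> i; have [_ _ h] := hF (i, B i) (B0 i); apply: h; exact: (qB i.+1).
Qed.

End Porosity.

(** * Direction sets *)

Section Convert.
Variable R : realType.
Implicit Types (n : nat).

Definition ext n (x : pt R n) : nat -> R := fun i => if insub i is Some j then x j else 0.
Definition res n (y : nat -> R) : pt R n := fun i => y i.
Arguments res n y : clear implicits.

Lemma ext_ord n (x : pt R n) (i : 'I_n) : ext x i = x i.
Proof. by rewrite /ext valK. Qed.

Lemma ext_lt n (x : pt R n) i (h : (i < n)%N) : ext x i = x (Ordinal h).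
Proof. by rewrite -[i]/(val (Ordinal h)) ext_ord. Qed.

Lemma extK n (x : pt R n) : res n (ext x) = x.
Proof. by apply/funext => i; rewrite /res ext_ord. Qed.

Lemma res_eq n (y z : nat -> R) : (forall i, (i < n)%N -> y i = z i) -> res n y = res n z.
Proof. by move=> yz; apply/funext => i; rewrite /res yz. Qed.

Lemma ext_res n (y : nat -> R) i : (i < n)%N -> ext (res n y) i = y i.
Proof. by move=> h; rewrite ext_lt. Qed.

Lemma coord_le_enorm n (x : pt R n) i : `|x i| <= enorm x.
Proof.
rewrite /enorm -sqrtr_sqr; apply: ler_wsqrtr.
by rewrite (bigD1 i) //= lerDl sumr_ge0 // => j _; rewrite sqr_ge0.
Qed.

Lemma enorm_ge0 n (x : pt R n) : 0 <= enorm x.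
Proof. exact: sqrtr_ge0. Qed.

Lemma enorm_sqr n (x : pt R n) : enorm x ^+ 2 = \sum_(i < n) x i ^+ 2.
Proof. by rewrite sqr_sqrtr // sumr_ge0 // => j _; rewrite sqr_ge0. Qed.

Lemma enorm_le n (x : pt R n) d : 0 <= d -> (forall i, `|x i| <= d) -> enorm x <= n%:R * d.
Proof.
move=> d0 h; have nd : 0 <= n%:R * d by rewrite mulr_ge0.
rewrite -(@ler_pXn2r _ 2) ?nnegrE ?enorm_ge0 // enorm_sqr.
apply: (@le_trans _ _ (\sum_(i < n) d ^+ 2)).
  apply: ler_sum => i _; rewrite -real_normK ?num_real // lerXn2r ?nnegrE //.
rewrite sumr_const card_ord exprMn -[leLHS]mulr_natl ler_wpM2r ?sqr_ge0 //.
by rewrite -natrX ler_nat; case: n {x h nd} => // n; rewrite leq_pmull.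
Qed.

Definition exps n (be : {ffun 'I_n -> nat}) : nat -> nat := fun i => if insub i is Some j then be j else 0%N.

Lemma mono_exps n (be : {ffun 'I_n -> nat}) (y : nat -> R) :
  mono n (exps be) y = \prod_(i < n) y i ^+ be i.
Proof. by apply: eq_bigr => i _; rewrite /exps valK. Qed.

Definition boxf n N : seq {ffun 'I_n -> nat} :=
  [seq [ffun i => nat_of_ord (al i)] | al : {ffun 'I_n -> 'I_N.+1}].

Lemma boxf_uniq n N : uniq (boxf n N).
Proof.
rewrite map_inj_uniq ?enum_uniq // => al al' /ffunP E; apply/ffunP => i.
by apply: val_inj; have := E i; rewrite !ffunE.
Qed.

Lemma boxf_mem n N (be : {ffun 'I_n -> nat}) : (be \in boxf n N) = [forall i, (be i <= N)%N].
Proof.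
apply/mapP/forallP => [[al _ -> i]|h]; first by rewrite ffunE -ltnS ltn_ord.
exists [ffun i => inord (be i)]; first by rewrite mem_enum.
by apply/ffunP => i; rewrite !ffunE inordK // ltnS h.
Qed.

Lemma box_sumE n (c : ('I_n -> nat) -> R) (x : pt R n) N :
  box_sum c x N = \sum_(be <- boxf n N) c (fun i => be i) * \prod_(i < n) x i ^+ be i.
Proof.
rewrite big_map big_enum /=; apply: eq_bigr => al _; congr (c _ * _).
  by apply/funext => i; rewrite ffunE.
by apply: eq_bigr => i _; rewrite ffunE.
Qed.

Lemma boxf_sub n (S : seq {ffun 'I_n -> nat}) : exists N, forall N', (N <= N')%N ->
  {subset S <= boxf n N'}.
Proof.
exists (\sum_(be <- S) \sum_(i < n) be i)%N => N' le be beS.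
rewrite boxf_mem; apply/forallP => i; apply: leq_trans le.
rewrite (big_rem be) //=; apply: leq_trans (leq_addr _ _).
by rewrite (bigD1 i) //= leq_addr.
Qed.

(** Convergence in [analytic_at] is that of sums over boxes of exponents. Given absolute
    convergence, these agree with the unconditional sum because boxes absorb every finite set of
    exponents. *)
Lemma analytic_at_anat n (f : pt R n -> R) (x0 : nat -> R) :
  analytic_at f (res n x0) -> anat n x0 (fun y => f (res n y)).
Proof.
move=> [c [r [r0 [[M hM] hf]]]].
(* Passes from a Euclidean ball to a box: [n * d < r]. *)
pose d := r / (n.+1)%:R / 2.
have d0 : 0 < d by rewrite !divr_gt0 // ltr0n.
have dr : d <= r.
  have h1 : (1 : R) <= n.+1%:R by rewrite ler1n.
  have h2 : r / n.+1%:R <= r by rewrite ler_pdivrMr ?ltr0n // ler_peMr // ltW.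
  have h3 : 0 < r / n.+1%:R by rewrite divr_gt0 // ltr0n.
  by rewrite /d; move: h2 h3; set X := r / _; lra.
have ndr : n%:R * d < r.
  have h1 : n%:R < n.+1%:R :> R by rewrite ltr_nat.
  have n1 : (0 : R) < n.+1%:R by rewrite ltr0n.
  have E : d * n.+1%:R = r / 2 by rewrite /d mulrAC divfK ?pnatr_eq0.
  have := ltr_pM2l d0 n%:R n.+1%:R; rewrite h1 E => h2; rewrite mulrC; lra.
pose cc (be : {ffun 'I_n -> nat}) := c (fun i => be i).
have abs_r : abs_le (fun be => cc be * mono n (exps be) (fun=> r)) M.
  move=> S u; have [N hN] := boxf_sub S.
  apply: le_trans (hM N); rewrite box_sumE.
  have E be : `|cc be * mono n (exps be) (fun=> r)| = `|c (fun i => be i)| * \prod_(i < n) r ^+ be i.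
    rewrite normrM mono_exps; congr (_ * _); rewrite ger0_norm //.
    by apply: prodr_ge0 => i _; rewrite exprn_ge0 // ltW.
  rewrite (eq_bigr _ (fun be _ => E be)); apply: sum_sub_le => //.
  - by move=> be; rewrite -E.
  - exact: boxf_uniq.
  - exact: hN.
exists d, M; split=> //.
have ind : inbox n (fun=> r) (fun=> d) by move=> i _; rewrite gtr0_norm.
apply: (@pseriesT R {ffun 'I_n -> nat} n (fun=> d) M _ cc (@exps n)).
  apply: abs_le_dom abs_r => be; rewrite !normrM ler_wpM2l //; exact: mono_le.
move=> y by_.
have inr : inbox n (fun=> r) y by move=> i ni; apply: le_trans (by_ i ni) dr.
have ab : abs_le (fun be => cc be * mono n (exps be) y) M.
  apply: abs_le_dom abs_r => be; rewrite !normrM ler_wpM2l //; exact: mono_le.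
have [s hs] := abs_le_ex ab.
suff -> : f (res n (padd x0 y)) = s by [].
have psubE : psub (res n (padd x0 y)) (res n x0) = res n y.
  by apply/funext => i; rewrite /psub /res /padd addrC addKr.
have near : enorm (psub (res n (padd x0 y)) (res n x0)) < r.
  rewrite psubE; apply: le_lt_trans ndr; apply: enorm_le; first exact: ltW.
  by move=> i; exact: by_.
have cv := hf _ near; rewrite psubE in cv.
apply: eps_eq => e e0; have e2 : 0 < e / 2 by lra.
have [S0 hS] := hs _ e2; have [N1 hN1] := boxf_sub S0; have [N2 hN2] := cv _ e2.
have h1 := hS _ (boxf_uniq n (maxn N1 N2)) (hN1 _ (leq_maxl _ _)).
have h2 := hN2 _ (leq_maxr N1 N2); rewrite box_sumE in h2.
have E be : cc be * mono n (exps be) y = c (fun i => be i) * \prod_(i < n) res n y i ^+ be i.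
  by rewrite mono_exps.
rewrite (eq_bigr _ (fun be _ => E be)) in h1.
by move: h1 h2; set A := \sum_(be <- _) _; abs_lra.
Qed.

Lemma has_sum_abs_le (T : eqType) (a : T -> R) s : has_sum (fun i => `|a i|) s -> abs_le a s.
Proof.
move=> h S u; rewrite leNgt; apply/negP => lt.
have [|S0 hS] := h (\sum_(i <- S) `|a i| - s); first by rewrite subr_gt0.
have sub : {subset S0 <= undup (S0 ++ S)} by move=> x xS; rewrite mem_undup mem_cat xS.
have := hS _ (undup_uniq _) sub.
have : \sum_(i <- S) `|a i| <= \sum_(i <- undup (S0 ++ S)) `|a i|.
  apply: sum_sub_le => //; first exact: undup_uniq.
  by move=> x xS; rewrite mem_undup mem_cat xS orbT.
by move=> + /ltr_normlP[]; lra.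
Qed.

(** The exponents [al] may repeat, so the terms are first grouped: [C be] is the sum of the
    coefficients with exponent [be]. *)
Lemma anat_analytic_at n (f : (nat -> R) -> R) (x0 : pt R n) :
  anat n (ext x0) f -> analytic_at (fun x => f (ext x)) x0.
Proof.
move=> [d [M [d0 [c [al [cM hf]]]]]].
pose rs (j : nat) : {ffun 'I_n -> nat} := [ffun i => al j (val i)].
have mrs j y : mono n (al j) y = \prod_(i < n) y i ^+ rs j i.
  by apply: eq_bigr => i _; rewrite ffunE.
pose sel (be : {ffun 'I_n -> nat}) (t : nat -> R) j := if rs j == be then t j else 0.
have abs_sel be t K : abs_le t K -> abs_le (sel be t) K.
  by apply: abs_le_dom => j; rewrite /sel; case: ifP => // _; rewrite normr0.
have dp be : 0 < \prod_(i < n) d ^+ (be : {ffun 'I_n -> nat}) i.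
  by apply: prodr_gt0 => i _; rewrite exprn_gt0.
have csel be : exists s, has_sum (sel be c) s.
  apply: (@abs_le_ex _ _ _ (M / \prod_(i < n) d ^+ be i)) => S u.
  rewrite ler_pdivlMr // mulr_suml; apply: le_trans (cM S u).
  apply: ler_sum => j _; rewrite /sel; case: eqP => [E|_]; last by rewrite normr0 mul0r.
  by rewrite normrM mrs E [`|\prod_(i < n) _|]gtr0_norm.
have [C hC] := choice csel.
have selM be (y : nat -> R) j : sel be (fun j => c j * mono n (al j) y) j =
    sel be c j * \prod_(i < n) y i ^+ be i.
  by rewrite /sel; case: eqP => [<-|_]; rewrite ?mul0r // mrs.
have hCy be y : has_sum (sel be (fun j => c j * mono n (al j) y)) (C be * \prod_(i < n) y i ^+ be i).
  rewrite mulrC; apply: eq_has_sum (has_sum_scale _ (hC be)) => j.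
  by rewrite selM mulrC.
have sumsel (S : seq {ffun 'I_n -> nat}) t j : uniq S ->
    \sum_(be <- S) sel be t j = if rs j \in S then t j else 0.
  move=> u; case: ifP => h.
    rewrite (bigD1_seq (rs j)) //= /sel eqxx big1 ?addr0 // => be.
    by rewrite eq_sym => /negbTE ->.
  apply: big1_seq => be /= beS; rewrite /sel; case: eqP => // E.
  by rewrite -E h in beS.
exists (fun g => C [ffun i => g i]), d; split=> //; split.
  exists M => N; rewrite box_sumE.
  have /choice[t0 ht0] : forall be, exists F, has_sum (fun j => `|sel be (fun j => c j * mono n (al j) (fun=> d)) j|) F.
    move=> be; apply: (@abs_le_ex _ _ _ M) => S u.
    under eq_bigr do rewrite normr_id.
    exact: (abs_sel be _ _ cM).
  have hs := has_sum_sum (boxf n N) ht0.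
  have : \sum_(be <- boxf n N) t0 be <= M.
    apply: le_trans (ler_norm _) _; apply: (has_sum_le _ hs) => S u.
    apply: le_trans (cM S u); apply: ler_sum => j _.
    rewrite ger0_norm ?sumr_ge0 //.
    have E be : `|sel be (fun j => c j * mono n (al j) (fun=> d)) j| =
        sel be (fun j => `|c j * mono n (al j) (fun=> d)|) j.
      by rewrite /sel; case: ifP; rewrite ?normr0.
    rewrite (eq_bigr _ (fun be _ => E be)) sumsel ?boxf_uniq //.
    by case: ifP.
  apply: le_trans; apply: ler_sum => be _.
  have -> : [ffun i => be i] = be by apply/ffunP => i; rewrite ffunE.
  have := has_sum_le (has_sum_abs_le (ht0 be)) (hCy be (fun=> d)).
  by rewrite normrM [`|\prod_(i < n) _|]gtr0_norm.
move=> x xd; pose y := ext (psub x x0).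
have by_ : inbox n (fun=> d) y.
  move=> i ni; rewrite /y ext_lt; apply: le_trans (coord_le_enorm _ _) _; exact: ltW.
have := hf y by_.
have -> : f (padd (ext x0) y) = f (ext x).
  congr f; apply/funext => i; rewrite /padd /y /ext; case: insub => [j|]; last by rewrite addr0.
  by rewrite /psub addrC subrK.
move=> hs e e0; have e2 : 0 < e / 2 by lra.
have [S0 hS0] := hs _ e2; have [N0 hN0] := boxf_sub [seq rs j | j <- S0].
exists N0 => N le; rewrite box_sumE.
have -> : \sum_(be <- boxf n N) C [ffun i => be i] * \prod_(i < n) psub x x0 i ^+ be i =
   \sum_(be <- boxf n N) C be * \prod_(i < n) y i ^+ be i.
  apply: eq_bigr => be _; congr (C _ * _); first by apply/ffunP => i; rewrite ffunE.
  by apply: eq_bigr => i _; rewrite /y ext_ord.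
have hb := has_sum_sum (boxf n N) (fun be => hCy be y).
have [S1 hS1] := hb _ e2.
pose S := undup (S0 ++ S1).
have uS : uniq S by exact: undup_uniq.
have sub1 : {subset S1 <= S} by move=> j jS; rewrite mem_undup mem_cat jS orbT.
have k1 := hS1 S uS sub1.
pose S' := [seq j <- S | rs j \in boxf n N].
have sub0 : {subset S0 <= S'}.
  move=> j jS; rewrite mem_filter mem_undup mem_cat jS andbT.
  by apply: (hN0 _ le); apply: map_f.
have k0 := hS0 S' (filter_uniq _ uS) sub0.
have E : \sum_(j <- S) \sum_(be <- boxf n N) sel be (fun j => c j * mono n (al j) y) j =
   \sum_(j <- S') c j * mono n (al j) y.
  rewrite [RHS]big_filter [RHS]big_mkcond /=; apply: eq_bigr => j _.
  by rewrite sumsel ?boxf_uniq.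
rewrite E in k1; move: k0 k1; set A := \sum_(j <- S') _; abs_lra.
Qed.

End Convert.
Arguments res {R} n y.

(** * Limits along an ultrafilter *)

Section Ultra.
Variable R : realType.

Definition ultra (U : (nat -> Prop) -> Prop) :=
  [/\ forall S T : nat -> Prop, U S -> U T -> U (fun k => S k /\ T k),
      forall S T : nat -> Prop, (forall k, S k -> T k) -> U S -> U T,
      forall S : nat -> Prop, U S \/ U (fun k => ~ S k),
      forall S, U S -> exists k, S k & forall N, U (fun k => (N <= k)%N)].

Lemma ultra_ex : exists U, ultra U.
Proof.
pose F : set_system nat := [set S | exists N, forall k, (N <= k)%N -> S k]%classic.
have FF : ProperFilter F.
  apply: Build_ProperFilter_ex.
    by move=> S [N hN]; exists N; exact: hN.
  split.
  - by exists 0%N.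
  - move=> S T [N hN] [N' hN']; exists (maxn N N') => k; rewrite geq_max => /andP[k1 k2].
    by split; [exact: hN | exact: hN'].
  - by move=> S T ST [N hN]; exists N => k /hN/ST.
have [U [UU sFU]] := ultraFilterLemma FF.
exists U; split.
- by move=> S T; exact: filterI.
- by move=> S T ST; exact: filterS.
- by move=> S; have [h|h] := in_ultra_setVsetC S UU; [left|right].
- by move=> S; exact: filter_ex.
- by move=> N; apply: sFU; exists N.
Qed.

(** The limit is the supremum of the numbers that lie below almost all terms. *)
Lemma ulim U (x : nat -> R) M : ultra U -> (forall k, `|x k| <= M) ->
  exists l, forall e, 0 < e -> U (fun k => `|x k - l| < e).
Proof.
move=> [UI US UN Uex Uge] xM.
pose E : set R := [set z | U (fun k => z <= x k)]%classic.
have hE : has_sup E.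
  split; first by exists (- M); apply: US (Uge 0%N) => k _; have /ler_normlP[] := xM k; lra.
  by exists M => z /Uex[k zk]; have /ler_normlP[] := xM k; lra.
exists (sup E) => e e0.
have [z0 Ez0 ltz0] := sup_adherent e0 hE.
have : ~ E (sup E + e / 2).
  by move=> /(ub_le_sup (proj2 hE)); rewrite leNgt ltrDl divr_gt0.
have [//|nU _] := UN (fun k => sup E + e / 2 <= x k).
apply: US (UI _ _ Ez0 nU) => k [h1 /negP]; rewrite -ltNge => h2.
by apply/ltr_normlP; split; lra.
Qed.

Lemma ulim_fin U m (x : nat -> nat -> R) M : ultra U -> (forall k j, (j < m)%N -> `|x k j| <= M) ->
  exists l : nat -> R, forall e, 0 < e -> U (fun k => forall j, (j < m)%N -> `|x k j - l j| < e).
Proof.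
move=> hU; have [UI US UN Uex Uge] := hU.
elim: m => [|m IH] xM; first by exists (fun=> 0) => e _; apply: US (Uge 0%N).
have [l hl] := IH (fun k j jm => xM k j (ltnW jm)).
have [lm hlm] := ulim hU (fun k => xM k m (leqnn _)).
exists (fun j => if j == m then lm else l j) => e e0.
apply: US (UI _ _ (hl e e0) (hlm e e0)) => k [h1 h2] j.
by rewrite ltnS leq_eqVlt => /orP[/eqP->|jm]; [rewrite eqxx | rewrite (ltn_eqF jm); exact: h1].
Qed.

Lemma inv_small (e : R) : 0 < e -> exists N, forall k, (N <= k)%N -> (k.+1%:R : R)^-1 < e.
Proof.
move=> e0; have ei : 0 <= e^-1 by rewrite invr_ge0 ltW.
exists (Num.bound e^-1) => k le; rewrite invf_plt ?posrE ?ltr0n //.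
by apply: lt_le_trans (archi_boundP ei) _; rewrite ler_nat leqW.
Qed.

End Ultra.

(** * Direction sets as limit sets *)

Section Cone.
Variable R : realType.

Lemma SA_ex_fin D n (T : finType) (X : T -> (nat -> R) -> Prop) :
  (forall t, SA D n (X t)) -> SA D n (fun x => exists t, X t x).
Proof.
move=> h; have H (s : seq T) : SA D n (fun x => exists2 t, t \in s & X t x).
  elim: s => [|t s IH]; first by apply: SA_ext (@SA_const R D n False) => x _; split=> // -[].
  apply: SA_ext (SA_or (h t) IH) => x _; split.
    by move=> [Xt|[u us Xu]]; [exists t; rewrite ?mem_head | exists u; rewrite // inE us orbT].
  by move=> [u]; rewrite inE => /orP[/eqP->|us] Xu; [left | right; exists u].
apply: SA_ext (H (enum T)) => x _; split=> [[t _ Xt]|[t Xt]]; exists t => //.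
by rewrite mem_enum.
Qed.

Lemma SA_all_fin D n (T : finType) (X : T -> (nat -> R) -> Prop) :
  (forall t, SA D n (X t)) -> SA D n (fun x => forall t, X t x).
Proof.
move=> h; have := SA_not (SA_ex_fin (fun t => SA_not (h t))).
apply: SA_ext => x _; split=> [hn t|h' [t]]; last exact.
by apply: contrapT => nX; apply: hn; exists t.
Qed.

Variables (n m : nat) (Y : set (pt R (n + m))).
Hypothesis saY : semianalytic Y.
Let N := (n + m)%N.

(** Polar coordinates: [x = (t, v, z)] is sent to [(t v, z)], a point of the set whose projection is
    the germ. *)
Definition glue (x : nat -> R) : nat -> R := fun i => if (i < n)%N then x 0%N * x i.+1 else x i.+1.

(* Coordinates (t, v, z) with [|v| = 1] and [(t v, z)] in [Y]. *)
Definition cone_set (x : nat -> R) : Prop := Y (res N (glue x)) /\ \sum_(i < n) x i.+1 ^+ 2 = 1.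

Lemma anat_glue x i : (i < N)%N -> anat N.+1 x (fun x => glue x i).
Proof.
move=> iN; rewrite /glue; case: (i < n)%N; last exact: anat_coord.
by apply: anat_mul; exact: anat_coord.
Qed.

Lemma SAat_cone p : SAat N.+1 p cone_set.
Proof.
have [r [r0 [P [Q [f [g [an E]]]]]]] := saY (res N (glue p)).
have rn0 : 0 < r / N.+1%:R by rewrite divr_gt0 // ltr0n.
have [e e0 he] : exists2 e, 0 < e & forall i, (i < N)%N -> forall e', 0 < e' <= e ->
    forall x, ball N.+1 p e' x -> `|glue x i - glue p i| < r / N.+1%:R.
  apply: unif_radius => i iN; have [e e0 he] := anat_cont rn0 (anat_glue p iN).
  by exists e => // e' /andP[_ le] x b; apply: he; exact: ball_le b.
have ee : 0 < e <= e by rewrite e0 lexx.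
have near x : ball N.+1 p e x -> eball (res N (glue p)) r (res N (glue x)).
  move=> b; rewrite /eball /=; apply: (@le_lt_trans _ _ (N%:R * (r / N.+1%:R))).
    apply: enorm_le; first exact: ltW.
    by move=> i; exact/ltW/(he i (ltn_ord i) e ee x b).
  rewrite mulrA ltr_pdivrMr ?ltr0n // mulrC ltr_pM2l // ltr_nat //.
have af (F : pt R N -> R) : analytic_on (eball (res N (glue p)) r) F ->
    forall x, ball N.+1 p e x -> anat N.+1 x (fun x => F (res N (glue x))).
  move=> aF x b; have := analytic_at_anat (aF _ (near x b)) => h.
  by apply: (anat_comp (g := glue) h) => i iN; exact: anat_glue.
exists e, (fun x => (exists i, forall j, f i j (res N (glue x)) = 0 /\ 0 < g i j (res N (glue x))) /\
   \sum_(i < n) x i.+1 ^+ 2 - 1 = 0); split=> //.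
  apply: SA_and.
    apply: SA_ex_fin => i; apply: SA_all_fin => j; apply: SA_and.
      by apply: SA_eq0; apply: af; have [] := an i j.
    by apply: SA_pos; apply: af; have [] := an i j.
  apply: SA_eq0 => x _; apply: anat_sub; last exact: anat_const.
  apply: anat_sum => i; apply: anat_exp; apply: anat_coord.
  by rewrite ltnS; apply: leq_trans (ltn_ord i) _; exact: leq_addr.
move=> x b _; have EE := congr1 (fun S : set (pt R N) => S (res N (glue x))) E.
have nb := near x b; rewrite /cone_set.
split=> [[Yx sx]|[hx /eqP]].
  split; last by rewrite sx subrr.
  have : (Y `&` eball (res N (glue p)) r)%classic (res N (glue x)) by split.
  by rewrite E => -[].
rewrite subr_eq0 => /eqP sx; split=> //.
have : (eball (res N (glue p)) r `&` [set x | exists i, forall j, f i j x = 0 /\ 0 < g i j x])%classic (res N (glue x)).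
  by split.
by rewrite -E => -[].
Qed.

Lemma Sig_cone : Sig N (fun y => adh N.+1 cone_set (scons 0 y)).
Proof.
have oT : @opn R N.+1 (fun=> True) by move=> x _; exists 1.
apply: Sig_ext (core_b (@LC_all R N) oT (fun p _ _ => SAat_cone p)) => v.
by split=> [[]|].
Qed.

Variables (A : set (pt R n)) (r M : R).
Hypotheses (r0 : 0 < r) (bdY : forall y, Y y -> enorm y <= M)
  (AE : (A `&` eball (@pzero R n) r = (@proj R n m @` Y) `&` eball (@pzero R n) r)%classic).

Lemma psub0 k (x : pt R k) : psub x (@pzero R k) = x.
Proof. by apply/funext => i; rewrite /psub /pzero subr0. Qed.

Lemma enorm_scale k t (x : pt R k) : enorm (pscale t x) = `|t| * enorm x.
Proof.
have h : enorm (pscale t x) ^+ 2 = (`|t| * enorm x) ^+ 2.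
  rewrite exprMn !enorm_sqr real_normK ?num_real // mulr_sumr.
  by apply: eq_bigr => i _; rewrite /pscale exprMn.
have := h => /eqP; rewrite eqrXn2 ?enorm_ge0 ?mulr_ge0 ?enorm_ge0 // => /eqP.
by [].
Qed.

Let tv (x : nat -> R) : pt R n := res n (fun i => x 0%N * x i.+1).
Let vv (x : nat -> R) : pt R n := res n (fun i => x i.+1).

Lemma tvE x : tv x = pscale (x 0%N) (vv x). Proof. by []. Qed.

Lemma cone_vv x : cone_set x -> enorm (vv x) = 1.
Proof. by move=> [_ h]; rewrite /enorm /vv /res h sqrtr1. Qed.

Lemma cone_in_A x : cone_set x -> 0 < x 0%N < r -> A (tv x) /\ enorm (tv x) = x 0%N.
Proof.
move=> hx /andP[x0 xr]; have E : enorm (tv x) = x 0%N.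
  by rewrite tvE enorm_scale cone_vv // mulr1 gtr0_norm.
split=> //.
have : (A `&` eball (@pzero R n) r)%classic (tv x); last by case.
rewrite AE; split; last by rewrite /eball /= psub0 E.
exists (res N (glue x)); first by case: hx.
by apply/funext => i; rewrite /proj /tv /res /glue /= ltn_ord.
Qed.

(** A direction of [A] is the [v]-part of a limit at [t = 0] of the cone family. For a given
    sequence in [A], boundedness of [Y] provides a limit of the auxiliary coordinates [z] along an
    ultrafilter. *)
Lemma dirset_adh (v : nat -> R) : dirset A (res n v) <->
  exists u, adh N.+1 cone_set (scons 0 u) /\ img n (fun i u => u i) u v.
Proof.
split.
  move=> [nv [u [uA [u0 uv]]]].
  (* From the index [k0] on, the points are in the ball where [A] is a projection; the sequence is
     shifted accordingly. *)
  have [k0 hk0] := u0 r r0.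
  have hy k : exists y, Y y /\ proj y = u (k0 + k)%N.
    have [Au _] := uA (k0 + k)%N.
    have : (A `&` eball (@pzero R n) r)%classic (u (k0 + k)%N).
      by split=> //; apply: hk0; exact: leq_addr.
    by rewrite AE => -[[y Yy E] _]; exists y.
  have [y hY] := choice hy.
  have [U hU] := ultra_ex.
  have yM k j : (j < N)%N -> `|ext (y k) j| <= M.
    move=> jN; rewrite ext_lt; apply: le_trans (coord_le_enorm _ _) _.
    by apply: bdY; have [] := hY k.
  have [l hl] := ulim_fin hU yM.
  have [UI US UN Uex Uge] := hU.
  pose w : nat -> R := fun i => if (i < n)%N then v i else l i.
  exists w; split; last by move=> i ni; rewrite /w ni.
  move=> e e0; have [k1 hk1] := u0 e e0; have [k2 hk2] := uv e e0.
  have [k [hk [k1k k2k]]] := Uex _ (UI _ _ (hl e e0) (UI _ _ (Uge k1) (Uge k2))).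
  pose K := (k0 + k)%N; pose t := enorm (u K).
  have [_ uK0] := uA K.
  have t0 : 0 < t.
    rewrite lt_neqAle enorm_ge0 andbT eq_sym; apply/eqP => t0; apply: uK0.
    apply/funext => i; apply/eqP; rewrite -normr_le0.
    by have := coord_le_enorm (u K) i; rewrite -/t t0.
  have kK : (k <= K)%N by exact: leq_addl.
  have te : t < e by have := hk1 K (leq_trans k1k kK); rewrite psub0.
  exists (scons t (fun i => if (i < n)%N then ext (u K) i / t else ext (y k) i)); split=> //=.
    split.
      have [Yy py] := hY k.
      suff -> : res N (glue (scons t (fun i => if (i < n)%N then ext (u K) i / t else ext (y k) i))) = y k by [].
      apply/funext => i; rewrite /res /glue /=; case ni: (i < n)%N; last by rewrite ext_ord.
      rewrite mulrCA divff ?gt_eqF // mulr1 -py (ext_lt _ ni) /proj.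
      by congr (y k _); apply: val_inj.
    rewrite (eq_bigr (fun i : 'I_n => u K i ^+ 2 / t ^+ 2)) => [|i _]; last first.
      by rewrite /= ltn_ord ext_ord expr_div_n.
    by rewrite -mulr_suml -enorm_sqr divff // expf_neq0 ?gt_eqF.
  move=> [|i] iN /=; first by rewrite subr0 gtr0_norm.
  rewrite /w; case ni: (i < n)%N; last by apply: hk.
  have := hk2 K (leq_trans k2k kK); apply: le_lt_trans.
  have := coord_le_enorm (psub (pscale (enorm (u K))^-1 (u K)) (res n v)) (Ordinal ni).
  by rewrite /psub /pscale /res /= (ext_lt _ ni) mulrC.
move=> [u [ad im]].
have uvE : res n u = res n v by apply: res_eq => i ni; rewrite im.
have hx k : exists x, [/\ cone_set x, 0 < x 0%N < r, x 0%N < (k.+1%:R)^-1 &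
    forall i, (i < n)%N -> `|x i.+1 - v i| < (k.+1%:R)^-1].
  have m0 : 0 < Num.min r (k.+1%:R)^-1 by rewrite lt_min r0 invr_gt0 ltr0n.
  have [x [hx x0 b]] := ad _ m0; exists x.
  have := b 0%N isT; rewrite /= subr0 gtr0_norm // lt_min => /andP[xr xk].
  split=> //; first by rewrite x0.
  move=> i ni; have iN : (i.+1 < N.+1)%N by rewrite ltnS; apply: leq_trans ni _; exact: leq_addr.
  by have := b i.+1 iN; rewrite /= lt_min im // => /andP[].
have [x hX] := choice hx.
have cv : pseq_cvg (fun k => vv (x k)) (res n v).
  move=> e e0; have n1 : (0 : R) < n.+1%:R by rewrite ltr0n.
  have [K hK] := inv_small (divr_gt0 e0 n1).
  exists K => k Kk; have [_ _ _ h] := hX k.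
  apply: (@le_lt_trans _ _ (n%:R * (e / n.+1%:R))).
    apply: enorm_le; first by rewrite divr_ge0 // ltW.
    by move=> i; apply/ltW; apply: lt_trans (h i (ltn_ord i)) (hK k Kk).
  by rewrite mulrA ltr_pdivrMr // mulrC ltr_pM2l // ltr_nat.
have norm1 : enorm (res n v) = 1.
  have sq : \sum_(i < n) v i ^+ 2 = 1.
    apply: eps_eq => e e0.
    have aS : anat n v (fun y => \sum_(i < n) y i ^+ 2).
      by apply: anat_sum => i; apply: anat_exp; exact: anat_coord.
    have [d d0 hd] := anat_cont e0 aS; have [K hK] := inv_small d0.
    have [[_ sx] _ _ h] := hX K.
    have := hd (fun i => x K i.+1); rewrite sx distrC; apply=> i ni.
    by apply: lt_trans (h i ni) (hK K (leqnn _)).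
  by rewrite /enorm /res sq sqrtr1.
split=> //; exists (fun k => tv (x k)); split; [|split].
- move=> k; have [cx x0r _ _] := hX k; have [Ax E] := cone_in_A cx x0r.
  split=> // tz; have : enorm (tv (x k)) = 0.
    by rewrite tz /enorm big1 ?sqrtr0 // => i _; rewrite /pzero expr0n.
  by rewrite E => xz; move: x0r; rewrite xz ltxx.
- move=> e e0; have [K hK] := inv_small e0; exists K => k Kk.
  have [cx x0r xk _] := hX k; have [_ E] := cone_in_A cx x0r.
  by rewrite psub0 E; apply: lt_trans xk (hK k Kk).
- suff -> : (fun k => pscale (enorm (tv (x k)))^-1 (tv (x k))) = fun k => vv (x k) by [].
  apply/funext => k; have [cx x0r _ _] := hX k; have [_ E] := cone_in_A cx x0r.
  apply/funext => i; rewrite E /pscale /tv /vv /res mulKf //.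
  by case/andP: x0r => x0 _; rewrite gt_eqF.
Qed.

(** [LCa] gives a point of the cone family at each exact height [t]; its direction is within [e] of
    [v], so after scaling the error is at most [e * t]. *)
Lemma dirset_ssp_aux (v : nat -> R) : dirset A (res n v) -> forall e, 0 < e ->
  exists2 t0, 0 < t0 & forall t, 0 < t < t0 ->
    exists x, A x /\ enorm (psub x (pscale t (res n v))) <= e * t.
Proof.
move=> /dirset_adh[u [ad im]] e e0.
have [lca _] := @LC_all R N cone_set (scons 0 u) erefl (SAat_cone _).
have n1 : (0 : R) < n.+1%:R by rewrite ltr0n.
have en0 : 0 < e / n.+1%:R by rewrite divr_gt0.
have [t0 t00 ht] := lca ad _ en0.
exists (Num.min t0 r); first by rewrite lt_min t00.
move=> t /andP[tp]; rewrite lt_min => /andP[tt0 tr].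
have [|x [cx xt b]] := ht t; first by rewrite tp.
have x0r : 0 < x 0%N < r by rewrite xt tp.
have [Ax _] := cone_in_A cx x0r.
exists (tv x); split=> //.
have -> : psub (tv x) (pscale t (res n v)) = pscale t (psub (vv x) (res n v)).
  by apply/funext => i; rewrite /psub /pscale /tv /vv /res xt mulrBr.
rewrite enorm_scale gtr0_norm // mulrC ler_wpM2r ?(ltW tp) //.
apply: (@le_trans _ _ (n%:R * (e / n.+1%:R))).
  apply: enorm_le; first exact: ltW.
  move=> i; have iN : ((val i).+1 < N.+1)%N.
    by rewrite ltnS; apply: leq_trans (ltn_ord i) _; exact: leq_addr.
  by have := b _ iN; rewrite /= /psub /vv /res im // => /ltW.
by rewrite mulrA ler_pdivrMr // mulrC ler_wpM2l ?(ltW e0) // ler_nat.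
Qed.

End Cone.

Lemma subanalytic_dirset (R : realType) n (A : set (pt R n)) : subanalytic_germ0 A ->
  Sig n (fun v => dirset A (res n v)) /\
  forall v, dirset A v -> forall e, 0 < e -> exists2 t0, 0 < t0 & forall t, 0 < t < t0 ->
    exists x, A x /\ enorm (psub x (pscale t v)) <= e * t.
Proof.
move=> [r [r0 [m [Y [saY [[M bdY] AE]]]]]]; split.
  have aP (x : nat -> R) i : (i < n)%N -> anat (n + m) x (fun u => u i).
    by move=> ni; apply: anat_coord; apply: leq_trans ni _; exact: leq_addr.
  apply: Sig_ext (Sig_img aP (Sig_cone saY)) => v.
  by rewrite (dirset_adh r0 bdY AE).
move=> v hv; rewrite -(extK v) in hv *.
exact: (dirset_ssp_aux saY r0 bdY AE hv).
Qed.

(** * Blowing up a bi-Lipschitz germ *)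

Section Blowup.
Variables (R : realType) (n : nat).
Implicit Types (x y z v w : pt R n) (t s : R).

Definition pplus x y : pt R n := fun i => x i + y i.

Lemma enorm0_eq x : enorm x = 0 -> x = @pzero R n.
Proof.
move=> x0; apply/funext => i; apply/eqP; rewrite -normr_le0 -x0.
exact: coord_le_enorm.
Qed.

Lemma enorm_pzero : enorm (@pzero R n) = 0.
Proof. by rewrite /enorm big1 ?sqrtr0 // => i _; rewrite /pzero expr0n. Qed.

(** Cauchy-Schwarz is read off from the non-negative sum of the squares of [b * x i - a * y i], with
    [a] and [b] the two norms. *)
Lemma enorm_triangle x y : enorm (pplus x y) <= enorm x + enorm y.
Proof.
have a0 := enorm_ge0 x; have b0 := enorm_ge0 y.
set a := enorm x in a0 *; set b := enorm y in b0 *.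
have cs : \sum_(i < n) x i * y i <= a * b.
  have [ez|an] := eqVneq a 0.
    by rewrite ez mul0r big1 // => i _; rewrite (enorm0_eq ez) /pzero mul0r.
  have [ez|bn] := eqVneq b 0.
    by rewrite ez mulr0 big1 // => i _; rewrite (enorm0_eq ez) /pzero mulr0.
  have ap : 0 < a by rewrite lt_neqAle eq_sym an.
  have bp : 0 < b by rewrite lt_neqAle eq_sym bn.
  have : 0 <= \sum_(i < n) (b * x i - a * y i) ^+ 2 by apply: sumr_ge0 => i _; exact: sqr_ge0.
  have -> : \sum_(i < n) (b * x i - a * y i) ^+ 2 =
     b ^+ 2 * a ^+ 2 + a ^+ 2 * b ^+ 2 - 2 * a * b * \sum_(i < n) x i * y i.
    rewrite [in LHS](eq_bigr (fun i => b ^+ 2 * x i ^+ 2 + a ^+ 2 * y i ^+ 2 - 2 * a * b * (x i * y i))); last by move=> i _; ring.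
    by rewrite sumrB big_split /= -!mulr_sumr -!enorm_sqr.
  have ab : 0 < a * b by rewrite mulr_gt0.
  move=> h; have : 0 <= 2 * (a * b) * (a * b - \sum_(i < n) x i * y i).
    by move: h; set S := \sum_(i < n) _; nra.
  by rewrite pmulr_rge0 ?subr_ge0 // mulr_gt0.
rewrite -(@ler_pXn2r _ 2) ?nnegrE ?enorm_ge0 ?addr_ge0 // enorm_sqr.
have -> : \sum_(i < n) pplus x y i ^+ 2 = a ^+ 2 + b ^+ 2 + 2 * \sum_(i < n) x i * y i.
  rewrite /a /b !enorm_sqr mulr_sumr -!big_split /=.
  by apply: eq_bigr => i _; rewrite /pplus; ring.
by move: cs; set S := \sum_(i < n) _; nra.
Qed.

Lemma enorm_sub_triangle x y z : enorm (psub x z) <= enorm (psub x y) + enorm (psub y z).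
Proof.
apply: le_trans (enorm_triangle _ _).
by apply: eq_ler; congr enorm; apply/funext => i; rewrite /pplus /psub addrA subrK.
Qed.

Lemma enorm_subC x y : enorm (psub x y) = enorm (psub y x).
Proof. by rewrite /enorm; congr Num.sqrt; apply: eq_bigr => i _; rewrite /psub -sqrrN opprB. Qed.

Lemma enorm_subl x y : enorm x - enorm y <= enorm (psub x y).
Proof.
have := enorm_sub_triangle x y (@pzero R n); rewrite !psub0; lra.
Qed.

Lemma scale_sub t x y : psub (pscale t x) (pscale t y) = pscale t (psub x y).
Proof. by apply/funext => i; rewrite /psub /pscale mulrBr. Qed.

Lemma dir_lip x y : enorm x != 0 -> enorm y != 0 ->
  enorm (psub (pscale (enorm x)^-1 x) (pscale (enorm y)^-1 y)) <= 2 * enorm (psub x y) / enorm y.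
Proof.
move=> xn yn; have x0 : 0 < enorm x by rewrite lt_neqAle eq_sym xn enorm_ge0.
have y0 : 0 < enorm y by rewrite lt_neqAle eq_sym yn enorm_ge0.
have -> : psub (pscale (enorm x)^-1 x) (pscale (enorm y)^-1 y) =
  pplus (pscale ((enorm y - enorm x) / (enorm x * enorm y)) x) (pscale (enorm y)^-1 (psub x y)).
  by apply/funext => i; rewrite /psub /pscale /pplus; field; rewrite xn yn.
apply: le_trans (enorm_triangle _ _) _; rewrite !enorm_scale.
rewrite normrM !normfV normrM !(gtr0_norm x0) !(gtr0_norm y0).
have h : `|enorm y - enorm x| <= enorm (psub x y).
  have h1 := enorm_subl x y; have h2 := enorm_subl y x; rewrite enorm_subC in h2.
  by apply/ler_normlP; split; lra.
have -> : `|enorm y - enorm x| / (enorm x * enorm y) * enorm x = `|enorm y - enorm x| / enorm y.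
  by field; rewrite xn yn.
rewrite -mulrA mulrDl mul1r [_^-1 * _]mulrC lerD2r ler_wpM2r // invr_ge0 ltW //.
Qed.

Variables (U : set (pt R n)) (h : pt R n -> pt R n) (K1 K2 : R).
Hypotheses (oU : eopen U) (U0 : U (@pzero R n)) (h0 : h (@pzero R n) = @pzero R n)
  (K10 : 0 < K1) (K12 : K1 <= K2)
  (hL : forall x y, U x -> U y -> K1 * enorm (psub x y) <= enorm (psub (h x) (h y)) /\
      enorm (psub (h x) (h y)) <= K2 * enorm (psub x y)).

Let K20 : 0 < K2. Proof. exact: lt_le_trans K12. Qed.

Definition inv1 (k : nat) : R := (k.+1%:R)^-1.

Lemma inv1_gt0 k : 0 < inv1 k. Proof. by rewrite invr_gt0 ltr0n. Qed.

(** Membership in [U] is recorded with the estimate, because the Lipschitz bounds on [h] are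
    available only there. *)
Definition is_blowup (Uf : (nat -> Prop) -> Prop) (hb : pt R n -> pt R n) :=
  forall x e, 0 < e -> Uf (fun k => U (pscale (inv1 k) x) /\
     enorm (psub (pscale (k.+1%:R) (h (pscale (inv1 k) x))) (hb x)) < e).

Lemma blowup Uf : ultra Uf -> exists hb, is_blowup Uf hb.
Proof.
move=> hU; have [UI US UN Uex Uge] := hU.
have [r [r0 hr]] := oU U0.
have evU x : Uf (fun k => U (pscale (inv1 k) x)).
  have x1 : 0 < enorm x + 1 by rewrite ltr_pwDr ?enorm_ge0.
  have [K hK] := inv_small (divr_gt0 r0 x1).
  apply: US (Uge K) => k Kk; apply: hr; rewrite /eball /= psub0 enorm_scale (gtr0_norm (inv1_gt0 k)).
  have := hK k Kk; rewrite ltr_pdivlMr // -/(inv1 k) => hk.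
  apply: le_lt_trans hk; rewrite ler_wpM2l ?(ltW (inv1_gt0 k)) //; lra.
(* The value is 0 at indices where the rescaled point is outside [U]; this keeps the sequence
   bounded at every index, as [ulim_fin] requires. *)
pose xs x k : pt R n := if `[< U (pscale (inv1 k) x) >] then pscale (k.+1%:R) (h (pscale (inv1 k) x))
   else @pzero R n.
have xb x k j : (j < n)%N -> `|ext (xs x k) j| <= K2 * enorm x.
  move=> jn; rewrite ext_lt /xs; case: asboolP => Ux; last first.
    by rewrite /pzero normr0 mulr_ge0 ?enorm_ge0 // ltW.
  apply: le_trans (coord_le_enorm _ _) _; rewrite enorm_scale.
  have [_] := hL Ux U0; rewrite h0 !psub0 enorm_scale (gtr0_norm (inv1_gt0 k)) => hk.
  rewrite ger0_norm //; have k0 : (0 : R) < k.+1%:R by rewrite ltr0n.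
  apply: le_trans (ler_wpM2l (ltW k0) hk) _.
  by rewrite mulrCA [_ * (_ * enorm x)]mulrA divff ?gt_eqF // mul1r.
have /choice[l hl] : forall x, exists l : nat -> R, forall e, 0 < e ->
    Uf (fun k => forall j, (j < n)%N -> `|ext (xs x k) j - l j| < e).
  by move=> x; exact: (ulim_fin hU (xb x)).
exists (fun x => res n (l x)) => x e e0.
have n1 : (0 : R) < n.+1%:R by rewrite ltr0n.
have en0 : 0 < e / n.+1%:R by rewrite divr_gt0.
apply: US (UI _ _ (evU x) (hl x _ en0)) => k [Ux hk]; split=> //.
apply: (@le_lt_trans _ _ (n%:R * (e / n.+1%:R))).
  apply: enorm_le; first exact: ltW.
  move=> i; have := hk i (ltn_ord i); rewrite ext_ord /xs; case: asboolP => // _.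
  by rewrite /psub /res => /ltW.
by rewrite mulrA ltr_pdivrMr // mulrC ltr_pM2l // ltr_nat.
Qed.

Lemma blowup_bilip Uf (hb : pt R n -> pt R n) : ultra Uf ->
  is_blowup Uf hb ->
  forall x y, K1 * enorm (psub x y) <= enorm (psub (hb x) (hb y)) /\
     enorm (psub (hb x) (hb y)) <= K2 * enorm (psub x y).
Proof.
move=> [UI US UN Uex Uge] hhb x y.
have key e : 0 < e -> K1 * enorm (psub x y) - e <= enorm (psub (hb x) (hb y)) <= K2 * enorm (psub x y) + e.
  move=> e0; have e2 : 0 < e / 2 by lra.
  have [k [[Ux hx] [Uy hy]]] := Uex _ (UI _ _ (hhb x _ e2) (hhb y _ e2)).
  set X := pscale k.+1%:R _ in hx; set Y := pscale k.+1%:R _ in hy.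
  have k0 : (0 : R) < k.+1%:R by rewrite ltr0n.
  have E : enorm (psub X Y) = k.+1%:R * enorm (psub (h (pscale (inv1 k) x)) (h (pscale (inv1 k) y))).
    by rewrite /X /Y scale_sub enorm_scale gtr0_norm.
  have [l1 l2] := hL Ux Uy.
  rewrite !scale_sub !enorm_scale !(gtr0_norm (inv1_gt0 k)) in l1 l2.
  have E1 K : k.+1%:R * (K * (inv1 k * enorm (psub x y))) = K * enorm (psub x y).
    by rewrite mulrCA [k.+1%:R * _]mulrA divff ?mul1r // gt_eqF.
  have m1 := ler_wpM2l (ltW k0) l1; have m2 := ler_wpM2l (ltW k0) l2.
  rewrite E1 -E in m1; rewrite E1 -E in m2.
  have t1 := enorm_sub_triangle X (hb x) Y; have t2 := enorm_sub_triangle (hb x) (hb y) Y.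
  have t3 := enorm_sub_triangle (hb x) X (hb y); have t4 := enorm_sub_triangle X Y (hb y).
  rewrite [enorm (psub (hb y) Y)]enorm_subC in t2; rewrite [enorm (psub (hb x) X)]enorm_subC in t3.
  by apply/andP; split; lra.
split; apply/ler_addgt0Pr => e e0; have /andP[h1 h2] := key e e0; lra.
Qed.

Lemma blowup0 Uf (hb : pt R n -> pt R n) : ultra Uf ->
  is_blowup Uf hb ->
  hb (@pzero R n) = @pzero R n.
Proof.
move=> [UI US UN Uex Uge] hhb; apply: enorm0_eq.
apply/eqP; rewrite eq_le enorm_ge0 andbT; apply/ler_addgt0Pr => e e0; rewrite add0r.
have [k [_ hk]] := Uex _ (hhb (@pzero R n) e e0).
have E : pscale k.+1%:R (h (pscale (inv1 k) (@pzero R n))) = @pzero R n.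
  have -> : pscale (inv1 k) (@pzero R n) = @pzero R n by apply/funext => i; rewrite /pscale /pzero mulr0.
  by rewrite h0; apply/funext => i; rewrite /pscale /pzero mulr0.
by rewrite E enorm_subC psub0 in hk; exact: ltW.
Qed.

(** At the scale [t = s / (k + 1)] selection gives [a] in [A] within [e * t] of [t v]. The upper
    Lipschitz bound puts [(k + 1) h a] near [(k + 1) h (t v)], itself near [hb (s v)] for almost all
    [k], so the directions of the points [h a] tend to that of [hb (s v)]. *)
Lemma blowup_dirset Uf (hb : pt R n -> pt R n) (A A' : set (pt R n)) : ultra Uf ->
  is_blowup Uf hb ->
  (forall x, A x -> U x -> A' (h x)) ->
  forall v s, dirset A v -> 0 < s ->
  (forall e, 0 < e -> exists2 t0, 0 < t0 & forall t, 0 < t < t0 ->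
    exists x, A x /\ enorm (psub x (pscale t v)) <= e * t) ->
  dirset A' (pscale (enorm (hb (pscale s v)))^-1 (hb (pscale s v))).
Proof.
move=> hU hhb AA' v s [nv _] s0 ssp; have [UI US UN Uex Uge] := hU.
set y := hb _; have hb0 := blowup0 hU hhb.
have y0 : 0 < enorm y.
  have [l1 _] := blowup_bilip hU hhb (pscale s v) (@pzero R n).
  rewrite hb0 !psub0 enorm_scale nv mulr1 (gtr0_norm s0) in l1.
  by apply: lt_le_trans l1; rewrite mulr_gt0.
have [r [r0 hr]] := oU U0.
(* Total error per unit of [e]: [K2 * s] for replacing [t v] by [a], and 1 for the blow-up
   itself. *)
pose c := K2 * s + 1; have c0 : 0 < c by rewrite /c; have := mulr_gt0 K20 s0; lra.
have H N : exists u, [/\ A' u, enorm u <= 2 * K2 * s * inv1 N, u <> @pzero R n &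
    exists2 k : nat, True & enorm (psub (pscale k.+1%:R u) y) <= c * inv1 N /\
       enorm y / 2 <= enorm (pscale k.+1%:R u)].
  (* The bound 1 gives [enorm a <= 2 * t], the bound [inv1 N] gives convergence, and the last one
     keeps [(k + 1) h a] at least half as long as [y], hence away from 0. *)
  pose e := Num.min 1 (Num.min (inv1 N) (enorm y / 2 / c)).
  have e0 : 0 < e by rewrite !lt_min ltr01 inv1_gt0 !divr_gt0.
  have [e1 eN ey] : [/\ e <= 1, e <= inv1 N & e <= enorm y / 2 / c].
    by rewrite /e; split; rewrite !ge_min lexx ?orbT.
  clearbody e; rewrite ler_pdivlMr // in ey.
  have [t0 t00 ht] := ssp e e0.
  have m0 : 0 < Num.min (t0 / s) (r / (2 * s)) by rewrite lt_min !divr_gt0 // mulr_gt0.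
  have [K hK] := inv_small m0.
  have [k [[Ux hk] [Kk Nk]]] := Uex _ (UI _ _ (hhb (pscale s v) e e0) (UI _ _ (Uge K) (Uge N))).
  pose t := s * inv1 k.
  have k0 : (0 : R) < k.+1%:R by rewrite ltr0n.
  have t0' : 0 < t by rewrite mulr_gt0 // inv1_gt0.
  have := hK k Kk; rewrite -/(inv1 k) lt_min => /andP[].
  rewrite !ltr_pdivlMr ?mulr_gt0 // => kt kr.
  have [|a [Aa ha]] := ht t; first by rewrite t0' /= /t mulrC.
  have tE : pscale (inv1 k) (pscale s v) = pscale t v.
    by apply/funext => i; rewrite /pscale /t; ring.
  rewrite tE in Ux hk.
  have ntv : enorm (pscale t v) = t by rewrite enorm_scale nv mulr1 gtr0_norm.
  have na : enorm a <= 2 * t.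
    have := enorm_subl a (pscale t v); rewrite ntv => h1.
    have : e * t <= 1 * t by rewrite ler_wpM2r // ltW.
    lra.
  have Ua : U a.
    apply: hr; rewrite /eball /= psub0; apply: le_lt_trans na _.
    by rewrite /t; lra.
  have [_ l2] := hL Ua Ux.
  have est : enorm (psub (pscale k.+1%:R (h a)) y) <= c * e.
    apply: le_trans (enorm_sub_triangle _ (pscale k.+1%:R (h (pscale t v))) _) _.
    rewrite scale_sub enorm_scale (gtr0_norm k0).
    have : k.+1%:R * enorm (psub (h a) (h (pscale t v))) <= K2 * s * e.
      apply: le_trans (ler_wpM2l (ltW k0) l2) _.
      apply: le_trans (_ : _ <= k.+1%:R * (K2 * (e * t))) _.
        by rewrite ler_wpM2l ?(ltW k0) // ler_wpM2l // ltW.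
      apply: eq_ler; rewrite /t /inv1; move: (k.+1%:R : R) k0 => q q0; field; exact: lt0r_neq0.
    by rewrite /c; lra.
  have low : enorm y / 2 <= enorm (pscale k.+1%:R (h a)).
    have := enorm_subl y (pscale k.+1%:R (h a)); rewrite enorm_subC => h1; lra.
  exists (h a); split.
  - exact: AA'.
  - have [_ l3] := hL Ua U0; rewrite h0 !psub0 in l3.
    apply: le_trans l3 _; apply: le_trans (ler_wpM2l (ltW K20) na) _.
    have : inv1 k <= inv1 N by rewrite lef_pV2 ?posrE ?ltr0n // ler_nat.
    move=> /(ler_wpM2l (ltW s0)) => h1; rewrite -/t in h1.
    have := ler_wpM2l (ltW K20) h1; lra.
  - move=> hz; move: low; rewrite hz enorm_scale enorm_pzero mulr0; lra.
  exists k => //; split=> //; apply: le_trans est _.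
  by rewrite ler_wpM2l // ltW.
have [u hu] := choice H.
split.
  by rewrite enorm_scale normfV (gtr0_norm y0) mulVf // gt_eqF.
exists u; split; first by move=> k; have [? _ ? _] := hu k.
split.
  move=> e e0; have p0 : 0 < 2 * K2 * s by rewrite !mulr_gt0.
  have [K hK] := inv_small (divr_gt0 e0 p0); exists K => k Kk; rewrite psub0.
  have [_ h1 _ _] := hu k; apply: le_lt_trans h1 _.
  by have := hK k Kk; rewrite ltr_pdivlMr // mulrC.
move=> e e0.
have p0 : 0 < 2 * c / enorm y by rewrite divr_gt0 // mulr_gt0.
have [K hK] := inv_small (divr_gt0 e0 p0); exists K => N KN.
have [_ _ _ [k _ [h1 h2]]] := hu N.
have k0 : (0 : R) < k.+1%:R by rewrite ltr0n.
have nz : enorm (pscale k.+1%:R (u N)) != 0.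
  by rewrite gt_eqF // (lt_le_trans _ h2) // divr_gt0.
have -> : pscale (enorm (u N))^-1 (u N) =
    pscale (enorm (pscale k.+1%:R (u N)))^-1 (pscale k.+1%:R (u N)).
  rewrite enorm_scale (gtr0_norm k0) in nz *; rewrite mulf_eq0 negb_or in nz.
  case/andP: nz => nz1 nz2.
  by move: (k.+1%:R : R) nz1 => q nz1; apply/funext => i; rewrite /pscale; field; rewrite nz2.
apply: le_lt_trans (dir_lip nz _) _; first by rewrite gt_eqF.
have := hK N KN; rewrite -/(inv1 N) ltr_pdivlMr // => h3.
apply: le_lt_trans h3.
have -> : inv1 N * (2 * c / enorm y) = 2 * (c * inv1 N) / enorm y by ring.
by rewrite ler_wpM2r ?invr_ge0 ?(ltW y0) // ler_wpM2l.
Qed.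

End Blowup.

(** * Transport of dimension through the blow-up *)

Section Dimension.
Variables (R : realType) (n : nat).

(** A graph contains its parameters among its coordinates: this makes the parametrisation injective,
    and it gives [l <= n] because two different parameters cannot agree on a whole ball. *)
Lemma has_piece_of_gpiece l X (Y : set (pt R n)) : gpiece n l X ->
  (forall v, X v -> Y (res n v)) -> (l <= n)%N /\ has_piece Y l.
Proof.
move=> [c [rho [psi [I [L [rho0 an hI lip XE]]]]]] XY.
have cb := @ball_center R l c rho rho0.
split.
  pose f (i : 'I_l) : 'I_n := Ordinal (hI i (ltn_ord i)).1.
  have inj : injective f.
    move=> i j /(congr1 val) /= Iij; apply/val_inj/eqP/negPn/negP => ij.
    have E u : ball l c rho u -> u i = u j.
      by move=> bu; rewrite -(hI i (ltn_ord i)).2 // -(hI j (ltn_ord j)).2 // Iij.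
    have := E (upd c i (c i + rho / 2)).
    rewrite /upd eqxx eq_sym (negbTE ij) -(E c) // => h; suff: rho / 2 = 0 by lra.
    apply: (addrI (c i)); rewrite addr0 h // => m ml.
    case: (eqVneq m i) => [->|_]; last by rewrite subrr normr0.
    by rewrite addrAC subrr add0r gtr0_norm //; lra.
  by have := leq_card f inj; rewrite !card_ord.
exists (fun u : pt R l => ball l c rho (ext u)), (fun u => res n (psi ^~ (ext u))).
split.
  move=> a /ball_open[e e0 he]; exists e; split=> // y hy; apply: he => i il.
  rewrite !(ext_lt _ il); apply: le_lt_trans hy.
  exact: (coord_le_enorm (psub y a)).
split; first by exists (res l c) => i il; rewrite ext_res // subrr normr0.
split; first by move=> i a Wa; exact: (anat_analytic_at (an _ Wa i (ltn_ord i))).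
split.
  move=> x y Wx Wy E; apply/funext => i.
  have [In hi] := hI i (ltn_ord i).
  rewrite -(ext_ord x) -(ext_ord y) -(hi _ Wx) -(hi _ Wy).
  exact: (congr1 (fun z => z (Ordinal In)) E).
by move=> x Wx; apply: XY; apply/XE; exists (ext x); split.
Qed.

Lemma gpiece_of_has_piece k (E : set (pt R n)) : has_piece E k ->
  exists X, gpiece n k X /\ forall v, X v -> E (res n v).
Proof.
move=> [W [phi [oW [[w0 Ww0] [an [inj WE]]]]]].
have [r [r0 hr]] := oW _ Ww0.
have k0 : (0 : R) < k.+1%:R by rewrite ltr0n.
pose d := r / k.+1%:R; have d0 : 0 < d by rewrite divr_gt0.
have bW y : ball k (ext w0) d y -> W (res k y).
  move=> b; apply: hr; apply: (@le_lt_trans _ _ (k%:R * d)).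
    apply: enorm_le; first exact: ltW.
    by move=> i; have := b i (ltn_ord i); rewrite ext_ord => /ltW.
  by rewrite /d mulrA ltr_pdivrMr // mulrC ltr_pM2l // ltr_nat.
pose phi' i y := ext (phi (res k y)) i.
have [|//||X [gX hX]] := @injective_piece R n k 0%N k (add0n k) (ext w0) d phi' id d0.
- move=> x b i ni; have -> : phi' i = fun y => phi (res k y) (Ordinal ni).
    by apply/funext => y; rewrite /phi' (ext_lt _ ni).
  by apply: (analytic_at_anat (f := fun z => phi z (Ordinal ni))); exact: an (bW _ b).
- move=> x y bx by_ Exy i ik.
  have := inj _ _ (bW _ bx) (bW _ by_).
  have -> : phi (res k x) = phi (res k y).
    by apply/funext => j; have := Exy j (ltn_ord j); rewrite /phi' !ext_ord.
  by move=> /(_ erefl)/(congr1 (fun z => z (Ordinal ik))).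
exists X; split=> // v /hX[x [bx im]].
have -> : res n v = phi (res k x).
  by apply/funext => i; rewrite /res im // /phi' ext_ord.
exact: WE (bW _ bx).
Qed.

(* The cone over an analytic graph of dimension [l] in the sphere is, in
   bi-Lipschitz coordinates, a subset of R^(l+1). *)
Lemma cone_thin d l X (dom : (nat -> R) -> Prop) (G : (nat -> R) -> pt R n) K T0 :
  0 < K -> 0 < T0 -> gpiece n l X -> (forall v, X v -> enorm (res n v) = 1) ->
  (forall q q', dom q -> dom q' -> forall i, (i < d)%N ->
     `|q i - q' i| <= K * enorm (psub (G q) (G q'))) ->
  (forall q, dom q -> 0 < enorm (G q) <= T0) ->
  exists Rel, thin d l.+1 Rel /\
    forall q, dom q -> X (ext (pscale (enorm (G q))^-1 (G q))) -> exists w, Rel q w.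
Proof.
move=> K0 T00 [c [rho [psi [I [L [rho0 an hI lip XE]]]]]] X1 GL GT.
exists (fun q w => [/\ dom q, w l = enorm (G q) & exists u, [/\ ball l c rho u,
  forall j, (j < l)%N -> w j = u j & forall i : 'I_n, G q i = w l * psi i u]]).
split; last first.
  move=> q dq /XE[u [bu im]]; exists (upd u l (enorm (G q))).
  split=> //; first by rewrite /upd eqxx.
  exists u; split=> //; first by move=> j jl; rewrite /upd ltn_eqF.
  move=> i; rewrite /upd eqxx -im // ext_ord /pscale mulrA divff ?mul1r //.
  by have /andP[/gt_eqF->] := GT q dq.
have [W W0 hW] := fin_bound l c.
(* Lipschitz constant of the map that sends a parameter and a radius to radius times graph point,
   for radii at most [T0] and graph points of norm 1. *)
pose D := 1 + T0 * `|L|.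
have D0 : 0 < D by rewrite ltr_pwDl // mulr_ge0 // ltW.
have nD : 0 <= n%:R * D by rewrite mulr_ge0 // ltW.
exists (W + rho + T0), (K * (n%:R * D) + 1); split.
- lra.
- by rewrite ltr_pwDr // mulr_ge0 // ltW.
- move=> q w [dq wl [u [bu wu _]]] j; rewrite ltnS leq_eqVlt => /orP[/eqP->|jl].
    have /andP[y0 yT] := GT q dq; rewrite wl ger0_norm ?(ltW y0) //; lra.
  rewrite wu //; have := bu j jl; have := hW j jl; abs_lra.
move=> q q' w w' dl dl0 [dq wl [u [bu wu Gu]]] [dq' wl' [u' [bu' wu' Gu']]] ww i id.
rewrite distrC; apply: le_trans (GL _ _ dq dq' _ id) _.
suff h : enorm (psub (G q) (G q')) <= n%:R * (D * dl).
  apply: le_trans (ler_wpM2l (ltW K0) h) _; nra.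
apply: enorm_le; first by rewrite mulr_ge0 // ltW.
move=> j; rewrite /psub Gu Gu'.
have p1 : `|psi j u| <= 1.
  have E : X (fun i => psi i u) by apply/XE; exists u; split.
  by rewrite -(X1 _ E); exact: (coord_le_enorm (res n (fun i => psi i u))).
have p2 : `|psi j u - psi j u'| <= `|L| * dl.
  apply: le_trans (lip u u' dl dl0 bu bu' _ j (ltn_ord j)) _.
    by move=> m ml; rewrite -wu // -wu' //; apply: ww; rewrite ltnS ltnW.
  by rewrite ler_wpM2r ?ler_norm // ltW.
have p3 := ww l (leqnn _).
have /andP[y0 yT] := GT q' dq'; rewrite -wl' in y0 yT.
have -> : w l * psi j u - w' l * psi j u' =
  (w l - w' l) * psi j u + w' l * (psi j u - psi j u') by ring.
apply: le_trans (ler_normD _ _) _; rewrite !normrM /D mulrDl mul1r.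
apply: lerD.
  by rewrite -[dl]mulr1; apply: ler_pM.
by rewrite -mulrA; apply: ler_pM => //; rewrite gtr0_norm.
Qed.

(** Coordinates on the cone over a piece: the [k] parameters and the radius. The radius is the norm,
    and for radii at least 1 the direction, hence each parameter, is controlled by [dir_lip], whence
    the constant 2. *)
Lemma cone_coord k X : gpiece n k X -> (forall v, X v -> enorm (res n v) = 1) ->
  exists c rho (F : (nat -> R) -> pt R n), 0 < rho /\
  forall q, ball k c rho q -> 1 <= q k ->
    (exists v, X (ext v) /\ F q = pscale (q k) v) /\
    forall q', ball k c rho q' -> 1 <= q' k -> forall i, (i < k.+1)%N ->
      `|q i - q' i| <= 2 * enorm (psub (F q) (F q')).
Proof.
move=> [c [rho [psi [I [L [rho0 an hI lip XE]]]]]] X1.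
pose V q := res n (psi ^~ q); exists c, rho, (fun q => pscale (q k) (V q)); split=> //.
have XV q : ball k c rho q -> X (ext (V q)).
  by move=> bq; apply/XE; exists q; split=> // i ni; rewrite ext_res.
have nV q : ball k c rho q -> enorm (V q) = 1 by move=> /XV/X1; rewrite extK.
move=> q bq q1; split; first by exists (V q); split=> //; exact: XV.
move=> q' bq' q1' i; set x := pscale (q k) _; set y := pscale _ _.
have q0 : 0 < q k by lra.
have q0' : 0 < q' k by lra.
have nx : enorm x = q k by rewrite enorm_scale nV // mulr1 gtr0_norm.
have ny : enorm y = q' k by rewrite enorm_scale nV // mulr1 gtr0_norm.
have xy0 := enorm_ge0 (psub x y).
rewrite ltnS leq_eqVlt => /orP[/eqP->|ik].
  have h1 := enorm_subl x y; have h2 := enorm_subl y x.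
  rewrite enorm_subC in h2; rewrite nx ny in h1 h2; move: h1 h2 xy0; abs_lra.
have [In hi] := hI i ik.
have E1 : pscale (q k)^-1 x = V q.
  by apply/funext => j; rewrite /x /pscale mulrA mulVf ?mul1r // gt_eqF.
have E2 : pscale (q' k)^-1 y = V q'.
  by apply/funext => j; rewrite /y /pscale mulrA mulVf ?mul1r // gt_eqF.
have -> : q i - q' i = psub (V q) (V q') (Ordinal In) by rewrite /psub /V /res /= !hi.
apply: le_trans (coord_le_enorm _ _) _.
have := @dir_lip R n x y; rewrite nx ny E1 E2 !gt_eqF // => /(_ isT isT) h2.
apply: le_trans h2 _; rewrite ler_pdivrMr //.
by move: xy0 q1'; set N := enorm _; nra.
Qed.

(** If all pieces of the target had dimension below [k], the cones over them would pull back under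
    the blow-up to thin subsets of a cube in dimension [k + 1]. Some [q] would avoid them all,
    although the blow-up sends its cone point into the target cone. *)
Lemma dir_pieces_transport (A B A' B' U : set (pt R n)) (h : pt R n -> pt R n) K1 K2 k :
  eopen U -> U (@pzero R n) -> h (@pzero R n) = @pzero R n -> 0 < K1 -> K1 <= K2 ->
  (forall x y, U x -> U y -> K1 * enorm (psub x y) <= enorm (psub (h x) (h y)) /\
     enorm (psub (h x) (h y)) <= K2 * enorm (psub x y)) ->
  (forall x, A x -> U x -> A' (h x)) -> (forall x, B x -> U x -> B' (h x)) ->
  subanalytic_germ0 A -> subanalytic_germ0 B ->
  subanalytic_germ0 A' -> subanalytic_germ0 B' ->
  has_piece (dirset A `&` dirset B)%classic k ->
  exists2 l, (k <= l <= n)%N & has_piece (dirset A' `&` dirset B')%classic l.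
Proof.
move=> oU U0 h0 K10 K12 hL AA BB sA sB sA' sB' hp.
have [//|no] := pselect (exists2 l, (k <= l <= n)%N & has_piece (dirset A' `&` dirset B')%classic l).
exfalso; have K20 : 0 < K2 by apply: lt_le_trans K12.
have [X [gX XD]] := gpiece_of_has_piece hp.
have X1 v : X v -> enorm (res n v) = 1 by move=> /XD[[]].
have [c [rho [F [rho0 hF]]]] := cone_coord gX X1.
have [Uf hU] := ultra_ex.
have [hb hhb] := blowup oU U0 h0 K10 K12 hL hU.
have bl := blowup_bilip hL hU hhb.
have hb0 := blowup0 h0 hU hhb.
have [Xi [hXi XiE]] := Sig_pieces (Sig_inter (subanalytic_dirset sA').1 (subanalytic_dirset sB').1).
(* Radii at least 1 stay away from the apex, as [cone_coord] demands; radii at most 2 give the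
   bounded box in the definition of [thin]. *)
pose dom q := ball k c rho q /\ 1 <= q k <= 2.
have nF q : dom q -> enorm (F q) = q k.
  move=> [bq /andP[q1 _]]; have [[v [Xv ->]] _] := hF q bq q1.
  by rewrite enorm_scale -(extK v) X1 // mulr1 gtr0_norm //; lra.
pose G q := hb (F q).
have GT q : dom q -> 0 < enorm (G q) <= K2 * 2.
  move=> dq; have [l1 l2] := bl (F q) (@pzero R n).
  rewrite hb0 !psub0 nF // in l1 l2; case: dq => _ /andP[q1 q2].
  apply/andP; split; first by apply: lt_le_trans l1; rewrite mulr_gt0 //; lra.
  by apply: le_trans l2 _; rewrite ler_wpM2l // ltW.
have GL q q' : dom q -> dom q' -> forall i, (i < k.+1)%N ->
    `|q i - q' i| <= 2 / K1 * enorm (psub (G q) (G q')).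
  move=> [bq /andP[q1 _]] [bq' /andP[q1' _]] i ik.
  have [_ /(_ _ bq' q1' _ ik) h1] := hF q bq q1.
  apply: le_trans h1 _; rewrite -mulrA ler_wpM2l // mulrC ler_pdivlMr // mulrC.
  by have [] := bl (F q) (F q').
have dK : 0 < 2 / K1 by rewrite divr_gt0.
have K22 : 0 < K2 * 2 by rewrite mulr_gt0.
have /choice[dr hdr] i : exists p : nat * ((nat -> R) -> (nat -> R) -> Prop),
    [/\ (p.1 < k.+1)%N, thin k.+1 p.1 p.2 &
     forall q, dom q -> Xi i (ext (pscale (enorm (G q))^-1 (G q))) -> exists w, p.2 q w].
  have [[l gl]|em] := hXi i; last first.
    (* An empty piece receives the empty relation, thin in dimension 0. *)
    exists (0%N, fun _ _ => False); split=> //; last by move=> q _ /em.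
    by exists 1, 1; split=> //.
  have XiD v : Xi i v -> (dirset A' `&` dirset B')%classic (res n v).
    by move=> Xv; apply/XiE; exists i.
  have [ln hl] := has_piece_of_gpiece gl XiD.
  (* A piece of dimension at least [k] is excluded by [no]; its cone therefore has dimension
     [l.+1 < k.+1]. *)
  have lk : (l < k)%N.
    by rewrite ltnNge; apply/negP => kl; apply: no; exists l => //; rewrite kl.
  have [|Rel [t cov]] := @cone_thin k.+1 l (Xi i) dom G _ _ dK K22 gl _ GL GT.
    by move=> v /XiD[[]].
  by exists (l.+1, Rel).
pose r := Num.min (rho / 2) (1 / 2).
have r0 : 0 < r by rewrite lt_min !divr_gt0.
have [r1 r2] : r <= rho / 2 /\ r <= 1 / 2 by rewrite /r; split; rewrite ge_min lexx ?orbT.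
clearbody r.
(* The cube is centred at radius 3/2, and [r <= 1 / 2] together with [r <= rho / 2] keeps it inside
   [dom]. *)
have [q [cq nq]] := @thin_cover R k.+1 (fun i => (dr i).1) (fun i => (dr i).2) (upd c k (3 / 2)) r
  (fun i => let: And3 a _ _ := hdr i in a) (fun i => let: And3 _ a _ := hdr i in a) r0.
have dq : dom q.
  split.
    move=> i ik; have := cq i (ltnW ik); rewrite /upd ltn_eqF // => hq.
    by apply: le_lt_trans hq _; lra.
  by have := cq k (leqnn _); rewrite /upd eqxx => hq; apply/andP; split; move: hq; abs_lra.
have [bq /andP[q1 q2]] := dq; have q0 : 0 < q k by lra.
have [[v [Xv Fq]] _] := hF q bq q1.
have [vA vB] := XD _ Xv; rewrite extK in vA vB.
have yA := blowup_dirset oU U0 h0 K10 K12 hL hU hhb AA vA q0 ((subanalytic_dirset sA).2 v vA).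
have yB := blowup_dirset oU U0 h0 K10 K12 hL hU hhb BB vB q0 ((subanalytic_dirset sB).2 v vB).
rewrite -Fq -/(G q) in yA yB.
have [i Xy] : exists i, Xi i (ext (pscale (enorm (G q))^-1 (G q))) by apply/XiE; rewrite extK.
by have [_ _ cov] := hdr i; apply: (nq i); exact: cov.
Qed.

(** A point is a piece of dimension 0, so a nonempty [X] forces [Y] to be nonempty and the value -1
    causes no trouble. The bound [l <= n] puts the new piece in the range of the maximum. *)
Lemma sdim_le (X Y : set (pt R n)) :
  (forall k, has_piece X k -> exists2 l, (k <= l <= n)%N & has_piece Y l) -> sdim X <= sdim Y.
Proof.
move=> XY; rewrite /sdim; case: asboolP => X0.
  by case: asboolP => Y0.
have [x Xx] : exists x, X x by exact/set0P/eqP.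
have p0 : has_piece X 0.
  exists (fun _ => True), (fun _ => x).
  split; first by move=> a _; exists 1; split.
  split; first by exists (fun _ => 0).
  split.
    move=> i a _; exact: (@anat_analytic_at R 0 (fun=> x i) a (anat_const _ _ _)).
  split=> // u v _ _ _; by apply/funext => -[].
case: asboolP => Y0.
  by have [l _ [W [phi [_ [[w Ww] [_ [_ /(_ w Ww)]]]]]]] := XY _ p0; rewrite Y0.
rewrite lez_nat; apply/bigmax_leqP => k /asboolP/XY[l /andP[kl ln] hl].
apply: leq_trans kl _; have ln' : (l < n.+1)%N by [].
by rewrite -[l]/(val (Ordinal ln')); apply: leq_bigmax_cond; apply/asboolP.
Qed.

End Dimension.

Local Open Scope classical_set_scope.

Theorem mainTheorem1 (R : realType) (n : nat) (A B U : set (pt R n))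
    (h : pt R n -> pt R n) :
  zero_in_closure A -> zero_in_closure B ->
  subanalytic_germ0 A -> subanalytic_germ0 B ->
  eopen U -> U (@pzero R n) -> h (@pzero R n) = @pzero R n ->
  bilipschitz_on U h -> eopen (h @` U) ->
  subanalytic_germ0 (h @` (A `&` U)) -> subanalytic_germ0 (h @` (B `&` U)) ->
  sdim (dirset (h @` (A `&` U)) `&` dirset (h @` (B `&` U)))
  = sdim (dirset A `&` dirset B).
Proof.
move=> _ _ sA sB oU U0 h0 [K1 [K2 [K10 [K12 hL]]]] oV sA' sB'.
have K20 : 0 < K2 by apply: lt_le_trans K12.
have inj x y : U x -> U y -> h x = h y -> x = y.
  move=> Ux Uy E; have [l1 _] := hL _ _ Ux Uy.
  have psubxx (z : pt R n) : psub z z = @pzero R n by apply/funext => i; rewrite /psub subrr.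
  rewrite E psubxx enorm_pzero in l1.
  have /enorm0_eq/(congr1 (fun z => z _)) E0 : enorm (psub x y) = 0.
    by apply/eqP; rewrite eq_le enorm_ge0 andbT -(ler_pM2l K10) mulr0.
  by apply/funext => i; apply/eqP; rewrite -subr_eq0; apply/eqP; exact: E0.
(* A total inverse of [h]; its values off the image of [U] are arbitrary. *)
have /choice[g hg] y : exists x, (h @` U) y -> U x /\ h x = y.
  have [[x Ux hx]|no] := pselect ((h @` U) y); first by exists x.
  by exists y.
have gh x : U x -> g (h x) = x.
  by move=> Ux; have [|Ug E] := hg (h x); [exists x|exact: inj].
apply/eqP; rewrite eq_le; apply/andP; split; apply: sdim_le => k hp.
  (* The inverse [g] is bi-Lipschitz on the image of [U] with constants [K2^-1] and [K1^-1], and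
     carries the image germs back into [A] and [B]. *)
  apply: (@dir_pieces_transport R n (h @` (A `&` U)) (h @` (B `&` U)) A B (h @` U) g K2^-1 K1^-1 k) => //.
  - by exists (@pzero R n).
  - by rewrite -{1}h0 gh.
  - by rewrite invr_gt0.
  - by rewrite lef_pV2.
  - move=> x y [a Ua <-] [b Ub <-]; rewrite !gh //; have [l1 l2] := hL _ _ Ua Ub.
    by split; [rewrite ler_pdivrMl|rewrite ler_pdivlMl].
  - by move=> x [a [Aa Ua] <-] _; rewrite gh.
  - by move=> x [a [Aa Ua] <-] _; rewrite gh.
apply: (@dir_pieces_transport R n A B (h @` (A `&` U)) (h @` (B `&` U)) U h K1 K2 k) => //.
- by move=> x Ax Ux; exists x.
- by move=> x Ax Ux; exists x.
Qed.
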